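(* Let $L>0$, $0\le v<1$, $\eta\ge 0$ with $\eta\neq 1$, and let $\phi^0\in\mathcal H_L(\mathbf I_0)$ and $\phi^1\in L^2(\mathbf I_0)$. Then the solution $\phi$ of Problem (WP), with $$\phi\in C\left([0,T];\mathcal H_{L+vt}(\mathbf I_t)\right)\cap C^1\left([0,T];L^2(\mathbf I_t)\right)\qquad\text{for } T>0,$$ is given by the series $$\phi(x,t)=\sum_{n\in\mathbb Z}a_n\left(\gamma_\eta e^{\frac{1-v}{L}\omega_n(t+x)}+e^{\frac{1+v}{L}\omega_n(t-x)}\right),\qquad x\in\mathbf I_t,\ t\ge 0,$$ where the coefficients $a_n\in\mathbb C$ are given by $$a_n=\frac{1}{4\gamma_\eta\omega_n}\int_0^{L_2}\left(\tilde\phi^0_x+\tilde\phi^1\right)e^{-\frac{1-v}{L}\omega_n x}\,dx,\qquad n\in\mathbb Z,$$ and, for every $t\ge 0$, $$\sum_{n\in\mathbb Z}|\omega_na_n|^2=\frac{L}{8(1-v)\gamma_\eta^2}\int_{vt}^{L_2+vt}e^{\frac{1-v}{L}\ln|\gamma_\eta|(t+x)}\left(\tilde\phi_x+\tilde\phi_t\right)^2dx<+\infty .$$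
   Context: Setting. $L>0$ is the length of the string, $0\le v<1$ its speed, $\eta\ge0$, $\eta\ne1$, the damping factor. For $t\ge 0$ let $\mathbf I_t:=(vt,L+vt)$, so $\mathbf I_0=(0,L)$. Subscripts $x,t$ denote partial derivatives. Functions $\phi^0,\phi^1,\phi$ are real-valued. Problem (WP): - $\phi_{tt}-\phi_{xx}=0$ for $x\in\mathbf I_t$, $t>0$; - $(1-\eta v)\phi_x(vt,t)-(\eta-v)\phi_t(vt,t)=0$ for $t>0$; - $\phi(L+vt,t)=0$ for $t>0$; - $\phi(x,0)=\phi^0(x)$, $\phi_t(x,0)=\phi^1(x)$ for $x\in\mathbf I_0$. Function space: $\mathcal H_{L+vt}(\mathbf I_t):=\{w\in H^1(\mathbf I_t): w(L+vt)=0\}$ for $t\ge0$; in particular $\mathcal H_L(\mathbf I_0)=\{w\in H^1(0,L): w(L)=0\}$. Constants: $\gamma_v:=\frac{1+v}{1-v}$, $\gamma_\eta:=\frac{1+\eta}{1-\eta}$ (negative if $\eta>1$), $L_2:=\frac{2L}{1-v}$, and for $n\in\mathbb Z$ $$\omega_n:=\frac{2n+1}{2}i\pi-\frac12\ln\gamma_\eta\ \text{ if }0\le\eta<1,\qquad \omega_n:=ni\pi-\frac12\ln|\gamma_\eta|\ \text{ if }\eta>1.$$ Extensions. The symbols $\tilde\phi_x$ and $\tilde\phi_t$ denote the following functions on $(vt,L_2+vt)$. For $x\in(vt,L+vt)$: $\tilde\phi_x(x,t)=\phi_x(x,t)$ and $\tilde\phi_t(x,t)=\phi_t(x,t)$.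 For $x\in(L+vt,L_2+vt)$, with $X:=\frac1{\gamma_v}(vt-x)+\frac{2L}{1+v}+vt\in(vt,L+vt)$: $$\tilde\phi_x(x,t)=\frac1{\gamma_v}\phi_x(X,t),\qquad \tilde\phi_t(x,t)=-\frac1{\gamma_v}\phi_t(X,t).$$ The extensions $\tilde\phi^0_x$ and $\tilde\phi^1$ of the initial data to $(0,L_2)$ are given by the same formulas at $t=0$, with $\phi_x(\cdot,0)=\phi^0_x$ and $\phi_t(\cdot,0)=\phi^1$. *)

(* Defs.v *)
(* MathComp-Analysis, with the complex numbers R[i] of mathcomp-real-closed *)
From HB Require Import structures.
From mathcomp Require Export all_boot all_order all_algebra complex.
From mathcomp Require Export all_classical all_reals all_analysis.
Export Order.TTheory GRing.Theory Num.Theory.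
Export numFieldNormedType.Exports.

Set Implicit Arguments.
Unset Strict Implicit.
Unset Printing Implicit Defensive.

#[global] Open Scope classical_set_scope.
#[global] Open Scope ring_scope.
#[global] Open Scope complex_scope.

Section Spaces.
Variable R : realType.
Local Notation mu := (@lebesgue_measure R).

Definition L2 (a b : R) (f : R -> R) : Prop :=
  measurable_fun `]a, b[ f /\ mu.-integrable `]a, b[ (fun x => (f x ^+ 2)%:E).

(* Squared norm, in the extended reals so that no integrability is presupposed *)
Definition normL2sq (a b : R) (f : R -> R) : \bar R :=
  (\int[mu]_(x in `]a, b[) (f x ^+ 2)%:E)%E.

Definition test1 (a b : R) (psi : R -> R) : Prop :=
  [/\ forall x, derivable psi x 1,
      continuous (derive1 psi)
    & exists c d, [/\ a < c, d < b & forall x, ~~ (c <= x <= d) -> psi x = 0]].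

Definition weak_derivative (a b : R) (w wx : R -> R) : Prop :=
  forall psi, test1 a b psi ->
    \int[mu]_(x in `]a, b[) (w x * derive1 psi x) =
    - \int[mu]_(x in `]a, b[) (wx x * psi x).

(* w belongs to H^1(a, b) and has weak derivative wx; as usual w denotes the
   representative of its class that is continuous on [a, b], so that the
   boundary values w a and w b are meaningful *)
Definition H1 (a b : R) (w wx : R -> R) : Prop :=
  [/\ {within `[a, b], continuous w}, L2 a b w, L2 a b wx
    & weak_derivative a b w wx].

(* H_b(a, b) : the elements of H^1(a, b) vanishing at the right end point *)
Definition H1r (a b : R) (w wx : R -> R) : Prop := H1 a b w wx /\ w b = 0.

End Spaces.

(* Functions of (x, t) are curried, with x first; the string occupies
   I_t = ]v t, L + v t[ at time t. *)
Section Problem.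
Variables (R : realType) (L v eta : R).
Local Notation mu := (@lebesgue_measure R).

(* The spaces of functions of t with values in functions on the moving interval
   I_t are those of functions with values in the fixed space over ]0, L[, after
   the change of variable x = y + v t. *)
Definition pull (w : R -> R -> R) (t y : R) : R := w (y + v * t) t.

(* C([0, T]; L^2(I_t)) *)
Definition C_L2 (T : R) (w : R -> R -> R) : Prop :=
  forall t, 0 <= t <= T ->
    L2 (v * t) (L + v * t) (w^~ t) /\
    normL2sq 0 L (fun y => pull w s y - pull w t y)
      @[s --> within `[0, T] (nbhs t)] --> 0%E.

(* C([0, T]; H_(L + v t)(I_t)), for phi with x-derivative phix *)
Definition C_H1r (T : R) (phi phix : R -> R -> R) : Prop :=
  forall t, 0 <= t <= T ->
    H1r (v * t) (L + v * t) (phi^~ t) (phix^~ t) /\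
    (normL2sq 0 L (fun y => pull phi s y - pull phi t y)%R +
     normL2sq 0 L (fun y => pull phix s y - pull phix t y)%R)%E
      @[s --> within `[0, T] (nbhs t)] --> 0%E.

(* C^1([0, T]; L^2(I_t)), for phi with t-derivative phit: the derivative in
   L^2(0, L) of t |-> phi(. + v t, t) is (phit + v phix)(. + v t, t). *)
Definition C1_L2 (T : R) (phi phix phit : R -> R -> R) : Prop :=
  [/\ C_L2 T phi, C_L2 T phit &
    forall t, 0 <= t <= T ->
      normL2sq 0 L (fun y => (pull phi s y - pull phi t y) / (s - t)
                             - (pull phit t y + v * pull phix t y))
        @[s --> within `[0, T] t^'] --> 0%E].

Definition dx (psi : R -> R -> R) (x t : R) : R := derive1 (psi^~ t) x.
Definition dt (psi : R -> R -> R) (x t : R) : R := derive1 (psi x) t.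

Definition test2 (psi : R -> R -> R) : Prop :=
  [/\ forall x t, derivable (psi^~ t) x 1 /\ derivable (psi x) t 1,
      continuous (fun z : R * R => dx psi z.1 z.2),
      continuous (fun z : R * R => dt psi z.1 z.2),
      exists t1 t2, 0 < t1 /\
        forall x t, ~~ (t1 <= t <= t2) -> psi x t = 0
    & forall t, 0 < t -> psi (L + v * t) t = 0].

(* Variational form of the wave equation phi_tt = phi_xx in {x \in I_t, t > 0}
   together with the damping condition at x = v t; the derivatives of a finite
   energy solution have no a priori trace on x = v t.
   Multiplying the equation by psi and integrating by parts gives
     \int\int (phi_t psi_t - phi_x psi_x)
       = \int_0^oo (phi_x + v phi_t)(v t, t) psi(v t, t) dt,
   since psi vanishes on x = L + v t.  The damping condition
     (1 - eta v) phi_x (v t, t) - (eta - v) phi_t (v t, t) = 0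
   reads
     (phi_x + v phi_t)(v t, t) = eta (phi_t + v phi_x)(v t, t)
                               = eta d/dt (phi(v t, t)),
   and a last integration by parts in t moves d/dt onto psi(v t, t). *)
Definition weak_WP (phi phix phit : R -> R -> R) : Prop :=
  forall psi, test2 psi ->
    \int[mu]_(t in `]0, +oo[) (\int[mu]_(x in `](v * t), (L + v * t)[)
        (phit x t * dt psi x t - phix x t * dx psi x t))
    + eta * \int[mu]_(t in `]0, +oo[)
        (phi (v * t) t * (dt psi (v * t) t + v * dx psi (v * t) t)) = 0.

(* phi is a solution, phix and phit being its derivatives; the condition
   phi(L + v t, t) = 0 is part of C_H1r. *)
Definition is_solution (phi0 phi1 : R -> R) (phi phix phit : R -> R -> R)
    : Prop :=
  [/\ forall T, 0 < T -> C_H1r T phi phix /\ C1_L2 T phi phix phit,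
      weak_WP phi phix phit,
      forall x, 0 < x < L -> phi x 0 = phi0 x
    & {ae mu, forall x, 0 < x < L -> phit x 0 = phi1 x}].

Definition gamma_v : R := (1 + v) / (1 - v).
Definition gamma_eta : R := (1 + eta) / (1 - eta).
Definition L_2 : R := 2 * L / (1 - v).

Definition omega (n : int) : R[i] :=
  if eta < 1
  then (- (ln gamma_eta / 2)) +i* ((2 * n%:~R + 1) / 2 * pi)
  else (- (ln `|gamma_eta| / 2)) +i* (n%:~R * pi).

Definition reflect_pt (t x : R) : R :=
  (v * t - x) / gamma_v + 2 * L / (1 + v) + v * t.

(* Extensions to ]v t, L_2 + v t[ of a function w on I_t; the value at the
   single point L + v t is immaterial. *)
Definition ext_x (t : R) (w : R -> R) (x : R) : R :=
  if x < L + v * t then w x else w (reflect_pt t x) / gamma_v.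
Definition ext_t (t : R) (w : R -> R) (x : R) : R :=
  if x < L + v * t then w x else - (w (reflect_pt t x) / gamma_v).

Definition expC (z : R[i]) : R[i] :=
  let: a +i* b := z in (expR a * cos b) +i* (expR a * sin b).

Definition integralC (a b : R) (f : R -> R[i]) : R[i] :=
  (\int[mu]_(x in `]a, b[) complex.Re (f x))
    +i* (\int[mu]_(x in `]a, b[) complex.Im (f x)).

Definition coef (phi0x phi1 : R -> R) (n : int) : R[i] :=
  (4 * gamma_eta%:C * omega n)^-1 *
  integralC 0 L_2 (fun x =>
    (ext_x 0 phi0x x + ext_t 0 phi1 x)%:C *
    expC (- (((1 - v) / L * x)%:C * omega n))).

Definition mode (n : int) (x t : R) : R[i] :=
  gamma_eta%:C * expC (((1 - v) / L * (t + x))%:C * omega n)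
  + expC (((1 + v) / L * (t - x))%:C * omega n).

(* Convergence of a two-sided series: the series over n >= 0 and over n < 0
   converge separately (Negz k is - (k + 1)). *)
Definition sumZ_to (u : int -> R[i]) (l : R[i]) : Prop :=
  exists l1 l2 : R[i]^o,
    [/\ (series (fun k : nat => u (Posz k)) : nat -> R[i]^o) @ \oo --> l1,
        (series (fun k : nat => u (Negz k)) : nat -> R[i]^o) @ \oo --> l2
      & l = l1 + l2].

Definition sqnormC (z : R[i]) : R := complex.Re z ^+ 2 + complex.Im z ^+ 2.

End Problem.

(* Main.v *)
Require Import Defs.
From mathcomp Require Import measurable_realfun ring lra.
Set Implicit Arguments.
Unset Strict Implicit.
Unset Printing Implicit Defensive.

(** Let y = x - v t be the abscissa in the moving frame, g = gamma_v and M = L_2,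
    so that y |-> M - g y exchanges ]0, L[ and ]L, M[ and fixes L.  Unfolding the
    pair (phi_x, phi_t) across the end y = L, evenly for phi_x and oddly for
    phi_t, gives one profile H_t on ]0, M[ per time t; it is the function under
    the integral signs of the theorem.  For a smooth solution the wave equation
    and the Dirichlet condition amount to H_t(y) = 2 h((1 + v) t + y) for a fixed
    function h, and the damping condition to h(s + M) = - h(s) / gamma_eta.  The
    exponentials with this quasi-periodicity are the e^(lambda_n s) with
    lambda_n = (1 - v) / L omega_n.  They have the same modulus, so that a weight
    turns them into e^(i nu_n s) with nu_n = 2 pi (n + theta) / M, an orthogonal
    system of L^2(0, M).

    A solution of finite energy has no trace of phi_x or phi_t, so this transport
    is used through moments.  Testing the variational equation with
    chi(t) k(x - v t) differentiates the moments of phi_t (weak_moment_deriv), and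
    integration by parts in H^1 expresses those of phi_x by moments of phi
    (moment_x_by_parts).  Together they give, for the integral j_q(t) of H_t q,
    that j_q' = - (1 + v) j_(q') as soon as
    (1 + eta) q(0) + (1 - eta) q(M) = 0 (fold_moment_deriv).  For
    q(y) = e^(- lambda_n y) this makes e^(- lambda_n (1 + v) t) j_q(t) constant
    (conservation), and at t = 0 it is 4 gamma_eta omega_n a_n.  Therefore, at
    every time t, the a_n are known multiples of the Fourier coefficients of the
    weighted profile (data_coefE).

    Both statements on the series follow from the completeness of the system.
    Parseval's identity at time t is the energy identity (energy).  For the
    pointwise series, phi(x, t) is minus half the integral of H_t over
    ]y, M - g y[, that is, a pairing of the weighted profile with a window whose
    n-th Fourier coefficient is a multiple of the n-th mode at (x, t) (mode_win);
    the polarised Parseval identity expands this pairing.  Its two halves converge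
    separately, because products of square-summable sequences are summable
    (pairing).  Completeness is proved by Fejer means that sample the function at
    N points, twisted so as to contain only the frequencies nu_n (trig_dense).

    Existence reverses the unfolding: h is half the unfolded data on ]0, M[,
    continued by the quasi-periodicity, F is a primitive of h, and
    phi(x, t) = F(t + x) - F(g (t - x) + M).  Continuity in time is the continuity
    of translations in L^2 (transl_L2, quot_L2).  In the variational equation,
    Fubini's theorem along the characteristics leaves the integral of
    (h(s) + h(s + M)) psi along the damped end, which the boundary term cancels by
    the quasi-periodicity of h (weak_balance). *)

(** * Integrals and squares over open intervals *)

Notation leb := (@lebesgue_measure _).
Notation intg a b f := (leb.-integrable `]a, b[ (EFin \o f)).

Section Intervals.
Variable R : realType.
Local Notation mu := (@lebesgue_measure R).
Implicit Types (a b c k : R) (f g : R -> R).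

Lemma intg_cont a b f : continuous f -> intg a b f.
Proof.
move=> cf; have : mu.-integrable `[a, b] (EFin \o f).
  apply: continuous_compact_integrable; first exact: segment_compact.
  by apply: continuous_subspaceT cf.
by apply: integrableS => //=; apply: subset_itvW.
Qed.

Lemma intgS a b c d f : a <= c -> d <= b -> intg a b f -> intg c d f.
Proof.
move=> ac db; apply: integrableS => //=.
by apply: subset_itvW.
Qed.

Lemma intgD a b f g : intg a b f -> intg a b g -> intg a b (fun x => f x + g x).
Proof. by move=> If Ig; apply: integrableD If Ig. Qed.

Lemma intgB a b f g : intg a b f -> intg a b g -> intg a b (fun x => f x - g x).
Proof. by move=> If Ig; apply: integrableB If Ig. Qed.

Lemma intgZ a b k f : intg a b f -> intg a b (fun x => k * f x).
Proof. by move=> If; apply: integrableZl If. Qed.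

Lemma eq_intg a b f g : (forall x, a < x < b -> f x = g x) -> intg a b f -> intg a b g.
Proof.
move=> fg; apply: eq_integrable => //= x; rewrite inE /= in_itv /= => /fg ->//.
Qed.

Lemma IntD a b f g : intg a b f -> intg a b g ->
  \int[mu]_(x in `]a, b[) (f x + g x) = \int[mu]_(x in `]a, b[) f x + \int[mu]_(x in `]a, b[) g x.
Proof. exact: RintegralD. Qed.

Lemma IntB a b f g : intg a b f -> intg a b g ->
  \int[mu]_(x in `]a, b[) (f x - g x) = \int[mu]_(x in `]a, b[) f x - \int[mu]_(x in `]a, b[) g x.
Proof. exact: RintegralB. Qed.

Lemma IntZ a b k f : intg a b f ->
  \int[mu]_(x in `]a, b[) (k * f x) = k * \int[mu]_(x in `]a, b[) f x.
Proof. by move=> If; exact: RintegralZl. Qed.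

Lemma IntN a b f : intg a b f ->
  \int[mu]_(x in `]a, b[) (- f x) = - \int[mu]_(x in `]a, b[) f x.
Proof.
move=> If; rewrite -mulN1r -IntZ//; apply: eq_Rintegral => x _; by rewrite mulN1r.
Qed.

Lemma eq_Int a b f g : (forall x, a < x < b -> f x = g x) ->
  \int[mu]_(x in `]a, b[) f x = \int[mu]_(x in `]a, b[) g x.
Proof.
by move=> fg; apply: eq_Rintegral => x; rewrite inE /= in_itv /= => /fg.
Qed.

Lemma intg_sum a b (I : Type) (r : seq I) (F : I -> R -> R) :
  (forall i, intg a b (F i)) -> intg a b (fun x => \sum_(i <- r) F i x).
Proof.
move=> IF; elim: r => [|i r IH].
  by apply: (@eq_intg _ _ (fun=> 0)) => [x _|]; [rewrite big_nil|exact/intg_cont/cst_continuous].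
apply: (@eq_intg _ _ (fun x => F i x + \sum_(i <- r) F i x)) => [x _|]; first by rewrite big_cons.
exact: intgD.
Qed.

Lemma Int_sum a b (I : Type) (r : seq I) (F : I -> R -> R) :
  (forall i, intg a b (F i)) ->
  \int[mu]_(x in `]a, b[) (\sum_(i <- r) F i x) = \sum_(i <- r) \int[mu]_(x in `]a, b[) (F i x).
Proof.
move=> IF; elim: r => [|i r IH].
  rewrite big_nil (@eq_Int _ _ _ (fun=> 0 * 0)); last by move=> x _; rewrite big_nil mulr0.
  by rewrite IntZ ?mul0r//; exact/intg_cont/cst_continuous.
rewrite big_cons -IH -IntD//; last exact: intg_sum.
by apply: eq_Int => x _; rewrite big_cons.
Qed.

Lemma Int_ge0 a b f : (forall x, a < x < b -> 0 <= f x) -> 0 <= \int[mu]_(x in `]a, b[) f x.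
Proof. by move=> f0; apply: Rintegral_ge0 => x /=; rewrite in_itv; exact: f0. Qed.

Lemma le_Int a b f g : intg a b f -> intg a b g -> (forall x, a < x < b -> f x <= g x) ->
  \int[mu]_(x in `]a, b[) f x <= \int[mu]_(x in `]a, b[) g x.
Proof.
by move=> If Ig fg; apply: le_Rintegral => //= x; rewrite in_itv; exact: fg.
Qed.

Lemma intg_norm a b f : intg a b f -> intg a b (fun x => `|f x|).
Proof. by move=> If; apply: integrable_norm. Qed.

Lemma norm_Int a b f : intg a b f ->
  `|\int[mu]_(x in `]a, b[) f x| <= \int[mu]_(x in `]a, b[) `|f x|.
Proof. by move=> If; apply: le_normr_Rintegral. Qed.

Lemma Int_cst a b k : a <= b -> \int[mu]_(x in `]a, b[) k = k * (b - a).
Proof.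
move=> ab; rewrite Rintegral_cst//; congr (_ * _).
apply: (etrans (congr1 fine (lebesgue_measure_itv `]a, b[%R))).
rewrite /= lte_fin; case: ltP => //= ba; apply/eqP; rewrite eq_sym subr_eq0; apply/eqP/le_anti; by rewrite ba.
Qed.

Lemma Int_point a f : \int[mu]_(x in `]a, a[) f x = 0.
Proof. by rewrite set_itvoo0 Rintegral_set0. Qed.

Lemma Int_cat a b c f : a <= b -> b <= c -> intg a c f ->
  \int[mu]_(x in `]a, c[) f x = \int[mu]_(x in `]a, b[) f x + \int[mu]_(x in `]b, c[) f x.
Proof.
move=> ab bc If.
have [->|nab] := eqVneq a b; first by rewrite Int_point add0r.
have [->|nbc] := eqVneq b c; first by rewrite Int_point addr0.
have ab' : a < b by rewrite lt_neqAle nab ab.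
have bc' : b < c by rewrite lt_neqAle nbc bc.
have -> : `]a, c[%classic = `]a, b[ `|` `[b, c[.
  by rewrite (@itv_bndbnd_setU _ _ _ (BLeft b))//= bnd_simp ltW.
rewrite Rintegral_setU//=.
- congr (_ + _); rewrite (Rintegral_itv_obnd_cbnd (r:=b))//.
  exact: intgS If.
- rewrite -(@itv_bndbnd_setU _ _ _ (BLeft b))//= bnd_simp; exact: ltW.
- rewrite disj_set2E; apply/eqP; rewrite -subset0 => x [] /=; rewrite !in_itv /= => /andP[_ xb] /andP[bx _].
  by have := lt_le_trans xb bx; rewrite ltxx.
Qed.

Lemma intg_cat a b c f : intg a b f -> intg b c f -> intg a c f.
Proof.
move=> I1 I2.
have [ab|ab] := ltP a b; last first.
  exact: (intgS ab (lexx _) I2).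
have [bc|bc] := ltP b c; last exact: (intgS (lexx _) bc I1).
have mf1 : measurable_fun `]a, b[ f by case/integrableP : I1 => /measurable_EFinP.
have mf2 : measurable_fun `[b, c[ f.
  by apply/measurable_fun_itv_obnd_cbndP; case/integrableP : I2 => /measurable_EFinP.
have E : `]a, c[%classic = `]a, b[ `|` `[b, c[.
  by rewrite (@itv_bndbnd_setU _ _ _ (BLeft b))//= bnd_simp ltW.
have D : [disjoint `]a, b[%classic & `[b, c[%classic]%classic.
  rewrite disj_set2E; apply/eqP; rewrite -subset0 => x [] /=; rewrite !in_itv /= => /andP[_ xb] /andP[bx _].
  by have := lt_le_trans xb bx; rewrite ltxx.
have mf : measurable_fun (`]a, b[ `|` `[b, c[) f by apply/measurable_funU.
rewrite E; apply/integrableP; split; first exact/measurable_EFinP.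
rewrite ge0_integral_setU//=; last first.
  by apply/measurable_EFinP; apply: measurableT_comp.
case/integrableP : I1 => _ I1; case/integrableP : I2 => _ I2.
rewrite -(integral_itv_obnd_cbnd (r:=b)).
  by rewrite lte_add_pinfty.
apply/measurable_EFinP; apply: measurableT_comp => //.
exact/measurable_fun_itv_obnd_cbndP.
Qed.

Lemma intgM_bd a b f g k : intg a b f -> measurable_fun `]a, b[ g ->
  (forall x, a < x < b -> `|g x| <= k) -> intg a b (fun x => f x * g x).
Proof.
move=> If mg gk; apply: (@le_integrable _ _ _ mu _ _ _ (fun x => (k * `|f x|)%:E)) => //=.
- apply/measurable_EFinP; apply: measurable_funM => //.
  by case/integrableP : If => /measurable_EFinP.
- move=> x; rewrite /= in_itv /= => /gk gxk.
  rewrite lee_fin [leRHS]ger0_norm; last by rewrite mulr_ge0// (le_trans _ gxk).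
  by rewrite normrM mulrC; exact: ler_wpM2r.
- by apply: intgZ; exact: intg_norm.
Qed.

Lemma cont_bd a b f : continuous f -> exists k, forall x, a <= x <= b -> `|f x| <= k.
Proof.
move=> cf; have : compact (f @` `[a, b]).
  by apply: continuous_compact; [exact: continuous_subspaceT|exact: segment_compact].
move/compact_bounded => [M [Mr +]] => /(_ (M + 1)); rewrite ltrDl ltr01 => /(_ isT) H.
exists (M + 1) => x xab; apply: H; exists x => //=; by rewrite in_itv.
Qed.

Lemma intgM_cont a b f g : intg a b f -> continuous g -> intg a b (fun x => f x * g x).
Proof.
move=> If cg; have [k gk] := cont_bd a b cg.
apply: (intgM_bd If (k := k)).
  by apply: measurable_funTS; exact: continuous_measurable_fun.
by move=> x /andP[/ltW ax /ltW xb]; rewrite gk// ax xb.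
Qed.

Lemma eq_L2 a b f g : (forall x, a < x < b -> f x = g x) -> L2 a b f -> L2 a b g.
Proof.
move=> fg [mf If]; split.
  apply: eq_measurable_fun mf => x; by rewrite inE /= in_itv => /fg.
by apply: (eq_intg (f:=fun x => f x ^+ 2)) => // x /fg ->.
Qed.

Lemma L2_cont a b f : continuous f -> L2 a b f.
Proof.
move=> cf; split; first by apply: measurable_funTS; exact: continuous_measurable_fun.
apply: (@intg_cont a b (fun x => f x ^+ 2)) => x; apply: (@continuous_comp _ _ _ f (fun y => y ^+ 2)); [exact: cf|exact: exprn_continuous].
Qed.

Lemma L2S a b c d f : a <= c -> d <= b -> L2 a b f -> L2 c d f.
Proof.
move=> ac db [mf If]; split.
  by apply: measurable_funS mf => //; apply: subset_itvW.
exact: (@intgS a b c d (fun x => f x ^+ 2)).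
Qed.

Lemma L2_mul a b f g : L2 a b f -> L2 a b g -> intg a b (fun x => f x * g x).
Proof.
move=> [mf If] [mg Ig].
apply: (@le_integrable _ _ _ mu _ _ _ (fun x => (f x ^+ 2 + g x ^+ 2)%:E)) => //=.
- by apply/measurable_EFinP; apply: measurable_funM.
- move=> x _; rewrite lee_fin normrM (ger0_norm (x:= _ + _)); last by rewrite addr_ge0// sqr_ge0.
  rewrite -(real_normK (num_real (f x))) -(real_normK (num_real (g x))).
  have := normr_ge0 (f x); have := normr_ge0 (g x).
  set p := `|f x|; set q := `|g x|; nra.
- exact: (@intgD a b (fun x => f x ^+ 2) (fun x => g x ^+ 2)).
Qed.

Lemma L2_sqr a b f : L2 a b f -> intg a b (fun x => f x ^+ 2).
Proof. by case. Qed.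

Lemma L2Z a b k f : L2 a b f -> L2 a b (fun x => k * f x).
Proof.
move=> [mf If]; split; first exact: measurable_funM.
apply: (eq_intg (f:=fun x => k ^+ 2 * (f x ^+ 2))) => [x _|]; first by rewrite exprMn.
exact: intgZ.
Qed.

Lemma L2D a b f g : L2 a b f -> L2 a b g -> L2 a b (fun x => f x + g x).
Proof.
move=> Lf Lg; split.
  by apply: measurable_funD; [case: Lf|case: Lg].
apply: (eq_intg (f:=fun x => (f x ^+ 2 + g x ^+ 2) + 2 * (f x * g x))) => [x _|].
  by ring.
apply: intgD; last by apply: intgZ; exact: L2_mul.
by apply: intgD; exact: L2_sqr.
Qed.

Lemma L2N a b f : L2 a b f -> L2 a b (fun x => - f x).
Proof. by move/(L2Z (-1)); apply: eq_L2 => x _; rewrite mulN1r. Qed.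

Lemma L2B a b f g : L2 a b f -> L2 a b g -> L2 a b (fun x => f x - g x).
Proof. by move=> Lf /L2N; exact: L2D. Qed.

Lemma L2_intg a b f : L2 a b f -> intg a b f.
Proof.
move=> Lf; have : intg a b (fun x => f x * 1).
  by apply: L2_mul => //; apply: L2_cont; exact: cst_continuous.
by apply: eq_intg => x _; rewrite mulr1.
Qed.

Lemma L2M_cont a b f g : L2 a b f -> continuous g -> L2 a b (fun x => f x * g x).
Proof.
move=> Lf cg; split.
  apply: measurable_funM; first by case: Lf.
  by apply: measurable_funTS; exact: continuous_measurable_fun.
apply: (eq_intg (f:=fun x => f x ^+ 2 * (g x ^+ 2))) => [x _|]; first by rewrite exprMn.
apply: (@intgM_cont a b (fun x => f x ^+ 2) (fun x => g x ^+ 2)); first exact: L2_sqr.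
by move=> x; apply: (@continuous_comp _ _ _ g (fun y => y ^+ 2)); [exact: cg|exact: exprn_continuous].
Qed.

Lemma L2_cat a b c f : L2 a b f -> L2 b c f -> L2 a c f.
Proof.
move=> Lf Lg; split.
  by have /integrableP[/measurable_EFinP] := intg_cat (L2_intg Lf) (L2_intg Lg).
by apply: (intg_cat (f := fun x => f x ^+ 2) (b := b)); exact: L2_sqr.
Qed.

Lemma L2_sum a b (I : Type) (r : seq I) (F : I -> R -> R) :
  (forall i, L2 a b (F i)) -> L2 a b (fun x => \sum_(i <- r) F i x).
Proof.
move=> IF; elim: r => [|i r IH].
  by apply: (@eq_L2 _ _ (fun=> 0)) => [x _|]; [rewrite big_nil|exact/L2_cont/cst_continuous].
apply: (@eq_L2 _ _ (fun x => F i x + \sum_(i <- r) F i x)) => [x _|]; first by rewrite big_cons.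
exact: L2D.
Qed.

Lemma normL2sqE a b f : L2 a b f ->
  normL2sq a b f = (\int[mu]_(x in `]a, b[) (f x ^+ 2))%:E.
Proof.
move=> Lf; rewrite /normL2sq /Rintegral fineK//.
by apply: integrable_fin_num => //; exact: L2_sqr.
Qed.

(** The discriminant of the nonnegative polynomial
    s |-> int (f + s g)^2. *)
Lemma Int_CS a b f g : L2 a b f -> L2 a b g ->
  (\int[mu]_(x in `]a, b[) (f x * g x)) ^+ 2 <=
  \int[mu]_(x in `]a, b[) (f x ^+ 2) * \int[mu]_(x in `]a, b[) (g x ^+ 2).
Proof.
move=> Lf Lg.
set F := \int[mu]_(x in _) (f x ^+ 2); set G := \int[mu]_(x in _) (g x ^+ 2).
set C := \int[mu]_(x in _) (f x * g x).
have H s : 0 <= F + 2 * s * C + s ^+ 2 * G.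
  have -> : F + 2 * s * C + s ^+ 2 * G = \int[mu]_(x in `]a, b[) ((f x + s * g x) ^+ 2).
    rewrite /F /C /G -!IntZ; [|exact: L2_sqr|exact: L2_mul].
    rewrite -IntD; [|exact: L2_sqr|by apply/intgZ/L2_mul].
    rewrite -IntD; [by apply: eq_Int => x _; ring| |by apply/intgZ/L2_sqr].
    by apply: intgD; [exact: L2_sqr|by apply/intgZ/L2_mul].
  by apply: Int_ge0 => x _; exact: sqr_ge0.
have F0 : 0 <= F by apply: Int_ge0 => x _; exact: sqr_ge0.
have G0 : 0 <= G by apply: Int_ge0 => x _; exact: sqr_ge0.
have [G00|Gn0] := eqVneq G 0.
  have [->|Cn0] := eqVneq C 0; first by rewrite expr0n mulr_ge0.
  have := H (- (F + 1) / (2 * C)); rewrite G00 mulr0 addr0.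
  have -> : F + 2 * (- (F + 1) / (2 * C)) * C = -1 by field.
  by rewrite ler0N1.
have := H (- C / G).
have -> : F + 2 * (- C / G) * C + (- C / G) ^+ 2 * G = (F * G - C ^+ 2) / G by field.
by rewrite pmulr_lge0 ?invr_gt0 ?lt_neqAle ?G0 1?eq_sym ?Gn0// subr_ge0.
Qed.

End Intervals.

Section Affine.
Variable R : realType.
Local Notation mu := (@lebesgue_measure R).
Variables (c d : R).
Hypothesis c0 : c != 0.
Let phi (x : measurableTypeR R) : measurableTypeR R := c * x + d.
Let mphi : measurable_fun setT phi.
Proof.
apply: continuous_measurable_fun => x; apply: cvgD; last exact: cvg_cst.
by apply: cvgM; [exact: cvg_cst|exact: cvg_id].
Qed.

(** The image measure, scaled by |c|, has the right value on half-open intervals,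
    and this determines the Lebesgue measure. *)
Lemma affine_lebesgue_measure A : measurable A -> 
  mu A = (`|c|%:E * mu (phi @^-1` A))%E.
Proof.
have [m mE] : exists m : {measure set measurableTypeR R -> \bar R},
   forall A, m A = (`|c|%:E * mu (phi @^-1` A))%E.
  unshelve eexists (mscale (NngNum (normr_ge0 c)) (pushforward mu phi)).
  - exact: mphi.
  - by [].
move=> mA; rewrite -mE; apply: lebesgue_measure_unique mA => X [[a b] _ <-] /=.
rewrite mE.
have [cp|cn] := ltP 0 c.
  rewrite (_ : phi @^-1` `]a, b] = `](a - d) / c, (b - d) / c]%classic); last first.
    apply/seteqP; split => x /=; rewrite !in_itv /phi /=.
      by rewrite ltr_pdivrMr// ler_pdivlMr// ltrBlDr lerBrDr (mulrC x).
    by rewrite ltr_pdivrMr// ler_pdivlMr// ltrBlDr lerBrDr (mulrC x).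
  rewrite (lebesgue_measure_itv `](a - d) / c, (b - d) / c]%R) (lebesgue_measure_itv `]a, b]%R) /=.
  rewrite !lte_fin ltr_pM2r ?invr_gt0// ltrD2r; case: ifPn => ab; last by rewrite mule0.
  by rewrite -!EFinB -EFinM (gtr0_norm cp); congr EFin; field.
have cn' : c < 0 by rewrite lt_neqAle c0 cn.
rewrite (_ : phi @^-1` `]a, b] = `[(b - d) / c, (a - d) / c[%classic); last first.
  apply/seteqP; split => x /=; rewrite !in_itv /phi /=.
    by rewrite ltr_ndivlMr// ler_ndivrMr// ltrBlDr lerBrDr (mulrC x) andbC.
  by rewrite ltr_ndivlMr// ler_ndivrMr// ltrBlDr lerBrDr (mulrC x) andbC.
rewrite (lebesgue_measure_itv `[(b - d) / c, (a - d) / c[%R) (lebesgue_measure_itv `]a, b]%R) /=.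
rewrite !lte_fin ltr_nM2r ?invr_lt0// ltrD2r; case: ifPn => ab; last by rewrite mule0.
by rewrite -!EFinB -EFinM (ltr0_norm cn'); congr EFin; field.
Qed.

Lemma affine_ge0_integral D f : measurable D -> measurable_fun D f -> (forall x, D x -> (0 <= f x)%E) ->
  (\int[mu]_(x in D) f x = `|c|%:E * \int[mu]_(x in phi @^-1` D) f (phi x))%E.
Proof.
move=> mD mf f0.
rewrite -(ge0_integral_pushforward mphi)//; last by move=> y; rewrite inE; exact: f0.
rewrite -(ge0_integral_mscale _ _ (NngNum (normr_ge0 c)))//.
by apply: eq_measure_integral => A mA _; exact: affine_lebesgue_measure.
Qed.

Lemma affine_measurable (D : set R) (f : R -> R) : measurable D -> measurable_fun D f ->
  measurable_fun (phi @^-1` D) (fun x => f (c * x + d)).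
Proof.
move=> mD mf; apply: (measurable_comp (F := D)) => //.
- by move=> x [y Dy <-].
- exact: measurable_funTS.
Qed.
End Affine.

Section AffineItv.
Variable R : realType.
Local Notation mu := (@lebesgue_measure R).
Implicit Types (a b c d : R) (f g : R -> R).

Lemma affine_preim_pos a b c d : 0 < c ->
  (fun x => c * x + d) @^-1` `](c * a + d), (c * b + d)[ = `]a, b[%classic.
Proof.
by move=> cp; apply/seteqP; split => x /=; rewrite !in_itv /= !ltrD2r !ltr_pM2l.
Qed.

Lemma affine_preim_neg a b c d : c < 0 ->
  (fun x => c * x + d) @^-1` `](c * b + d), (c * a + d)[ = `]a, b[%classic.
Proof.
by move=> cp; apply/seteqP; split => x /=; rewrite !in_itv /= !ltrD2r !ltr_nM2l// andbC.
Qed.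

(** End points of the image of ]a, b[ under x |-> c x + d, whose order depends on
    the sign of c. *)
Definition affl c d a b := c * (if 0 < c then a else b) + d.
Definition affr c d a b := c * (if 0 < c then b else a) + d.

Lemma affine_preim a b c d : c != 0 ->
  (fun x => c * x + d) @^-1` `](affl c d a b), (affr c d a b)[ = `]a, b[%classic.
Proof.
rewrite /affl /affr neq_lt => /orP[c0|c0]; last by rewrite c0 affine_preim_pos.
by rewrite ltNge (ltW c0) /= affine_preim_neg.
Qed.

Lemma intg_affine a b c d f : c != 0 -> intg (affl c d a b) (affr c d a b) f ->
  intg a b (fun x => f (c * x + d)).
Proof.
move=> c0 /integrableP[mf If].
have mf' : measurable_fun `]a, b[ (fun x => f (c * x + d)).
  rewrite -(affine_preim a b d c0); apply: affine_measurable => //; exact/measurable_EFinP.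
apply/integrableP; split; first exact/measurable_EFinP.
move: If; rewrite (affine_ge0_integral d c0)//; last first.
  apply/measurable_EFinP; apply: measurableT_comp => //; exact/measurable_EFinP.
rewrite affine_preim//= => H.
rewrite ltey; apply/eqP => K; move: H; rewrite K.
by rewrite gt0_muley ?ltxx// lte_fin normr_gt0.
Qed.

Lemma Int_affine a b c d f : c != 0 -> intg (affl c d a b) (affr c d a b) f ->
  \int[mu]_(x in `]affl c d a b, affr c d a b[) f x = `|c| * \int[mu]_(x in `]a, b[) f (c * x + d).
Proof.
move=> c0 If.
have If' := intg_affine c0 If.
have mf : measurable_fun `](affl c d a b), (affr c d a b)[ f by case/integrableP : If => /measurable_EFinP.
have H (g : R -> R) : measurable_fun `](affl c d a b), (affr c d a b)[ g -> (forall x, 0 <= g x) -> 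
   (\int[mu]_(x in `]affl c d a b, affr c d a b[) (g x)%:E = `|c|%:E * \int[mu]_(x in `]a, b[) (g (c * x + d))%:E)%E.
  move=> mg g0; rewrite (affine_ge0_integral d c0)//; [|exact/measurable_EFinP|by move=> x _; rewrite lee_fin].
  by rewrite affine_preim.
have E x : f x = (f^\+ x - f^\- x)%R by rewrite -[in LHS](funrposBneg f).
have Ip : intg (affl c d a b) (affr c d a b) f^\+ by apply: integrable_funrpos.
have In : intg (affl c d a b) (affr c d a b) f^\- by apply: integrable_funrneg.
transitivity (\int[mu]_(x in `]affl c d a b, affr c d a b[) (f^\+ x - f^\- x)); first exact: eq_Int.
transitivity (`|c| * \int[mu]_(x in `]a, b[) (f^\+ (c * x + d) - f^\- (c * x + d))); last first.
  by congr (_ * _); apply: eq_Int => x _; rewrite -E.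
rewrite IntB// IntB; [|exact: intg_affine Ip|exact: intg_affine In].
rewrite mulrBr; congr (_ - _).
  rewrite /Rintegral H//; last exact: measurable_funrpos.
  rewrite fineM//; apply: integrable_fin_num => //; exact: intg_affine Ip.
rewrite /Rintegral H//; last exact: measurable_funrneg.
rewrite fineM//; apply: integrable_fin_num => //; exact: intg_affine In.
Qed.

Lemma L2_affine a b c d f : c != 0 -> L2 (affl c d a b) (affr c d a b) f ->
  L2 a b (fun x => f (c * x + d)).
Proof.
move=> c0 [mf If]; split.
  by rewrite -(affine_preim a b d c0); exact: affine_measurable.
exact: (@intg_affine a b c d (fun x => f x ^+ 2)).
Qed.

End AffineItv.

(** * The trigonometric system with shifted frequencies *)

Section FTC.
Variable R : realType.
Local Notation mu := (@lebesgue_measure R).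
Implicit Types (a b c d : R) (f g : R -> R).

Lemma is_derive_cont (F f : R -> R) : (forall x : R, is_derive x 1 F (f x)) -> continuous F.
Proof.
move=> dF x; apply: differentiable_continuous; apply/derivable1_diffP.
by have [] := dF x.
Qed.

Lemma Int_FTC a b (F f : R -> R) : a <= b -> (forall x : R, is_derive x 1 F (f x)) -> continuous f ->
  \int[mu]_(x in `]a, b[) f x = F b - F a.
Proof.
move=> ab dF cf; have cF := is_derive_cont dF.
have [->|nab] := eqVneq a b; first by rewrite Int_point subrr.
have {nab}ab : a < b by rewrite lt_neqAle nab ab.
rewrite Rintegral_itv_obnd_cbnd; last exact: intg_cont.
have I : mu.-integrable `[a, b] (EFin \o f).
  apply: continuous_compact_integrable; first exact: segment_compact.
  by apply: continuous_subspaceT.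
rewrite Rintegral_itv_bndo_bndc; last first.
  by apply: integrableS I => //=; apply: subset_itvl; rewrite bnd_simp.
rewrite /Rintegral (@continuous_FTC2 _ f F)//.
- exact: continuous_subspaceT.
- split.
  + by move=> x _; have [] := dF x.
  + exact: cvg_at_right_filter (cF a).
  + exact: cvg_at_left_filter (cF b).
- by move=> x _; rewrite derive1E; apply: derive_val.
Qed.

Lemma cosc_cont c : continuous (fun x : R => cos (c * x)).
Proof.
move=> x; apply: (@continuous_comp _ _ _ (fun x => c * x) cos); last exact: continuous_cos.
exact: mulrl_continuous.
Qed.

Lemma sinc_cont c : continuous (fun x : R => sin (c * x)).
Proof.
move=> x; apply: (@continuous_comp _ _ _ (fun x => c * x) sin); last exact: continuous_sin.
exact: mulrl_continuous.
Qed.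

Lemma Int_cosc a b c : a <= b -> c != 0 -> \int[mu]_(x in `]a, b[) cos (c * x) = (sin (c * b) - sin (c * a)) / c.
Proof.
move=> ab c0.
have D (x : R) : is_derive x 1 (fun x => c^-1 * sin (c * x)) (cos (c * x)).
  by apply: is_derive_eq; rewrite /GRing.scale /=; field.
by rewrite (Int_FTC ab D); [field|exact: cosc_cont].
Qed.

Lemma Int_sinc a b c : a <= b -> c != 0 -> \int[mu]_(x in `]a, b[) sin (c * x) = (cos (c * a) - cos (c * b)) / c.
Proof.
move=> ab c0.
have D (x : R) : is_derive x 1 (fun x => - c^-1 * cos (c * x)) (sin (c * x)).
  by apply: is_derive_eq; rewrite /GRing.scale /=; field.
by rewrite (Int_FTC ab D); [field|exact: sinc_cont].
Qed.

Lemma cos_int2pi (n : int) : cos (2 * pi * n%:~R) = 1 :> R.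
Proof.
have H (k : nat) : cos (2 * pi * k%:R) = 1 :> R.
  elim: k => [|k IH]; first by rewrite mulr0 cos0.
  have -> : 2 * pi * k.+1%:R = 2 * pi * k%:R + pi *+ 2 :> R by rewrite -natr1 -mulr_natl; ring.
  by rewrite cosD2pi.
case: n => k; first exact: H.
by rewrite NegzE mulrNz mulrN cosN H.
Qed.

Lemma sin_int2pi (n : int) : sin (2 * pi * n%:~R) = 0 :> R.
Proof.
have H (k : nat) : sin (2 * pi * k%:R) = 0 :> R.
  elim: k => [|k IH]; first by rewrite mulr0 sin0.
  have -> : 2 * pi * k.+1%:R = 2 * pi * k%:R + pi *+ 2 :> R by rewrite -natr1 -mulr_natl; ring.
  by rewrite sinD2pi.
case: n => k; first exact: H.
by rewrite NegzE mulrNz mulrN sinN H oppr0.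
Qed.

End FTC.

Section Trig.
Variable R : realType.
Local Notation mu := (@lebesgue_measure R).
Variables (l th : R).
Hypothesis l0 : 0 < l.
Implicit Types (n m : int) (r : seq int) (p q : int -> R) (f g : R -> R).

(** The frequencies of the functions on the line that are multiplied by
    e^(2 i pi th) under translation by l. *)
Definition nu n : R := 2 * pi * (n%:~R + th) / l.
Definition cos_mode n x : R := cos (nu n * x).
Definition sin_mode n x : R := sin (nu n * x).
(** Real and imaginary parts of the sum of (p n + i q n) e^(i nu_n x); the whole
    development is kept over the reals. *)
Definition trig_re r p q x := \sum_(n <- r) (p n * cos_mode n x - q n * sin_mode n x).
Definition trig_im r p q x := \sum_(n <- r) (p n * sin_mode n x + q n * cos_mode n x).
Definition cos_coef f n := \int[mu]_(x in `]0, l[) (f x * cos_mode n x).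
Definition sin_coef f n := \int[mu]_(x in `]0, l[) (f x * sin_mode n x).

Lemma cos_mode_cont n : continuous (cos_mode n). Proof. exact: cosc_cont. Qed.
Lemma sin_mode_cont n : continuous (sin_mode n). Proof. exact: sinc_cont. Qed.

Lemma trig_re_L2 r p q : L2 0 l (trig_re r p q).
Proof.
apply: L2_sum => n; apply: L2B; apply: L2Z; apply: L2_cont; [exact: cos_mode_cont|exact: sin_mode_cont].
Qed.

Lemma trig_im_L2 r p q : L2 0 l (trig_im r p q).
Proof.
apply: L2_sum => n; apply: L2D; apply: L2Z; apply: L2_cont; [exact: sin_mode_cont|exact: cos_mode_cont].
Qed.

Lemma nuB n m : (nu n - nu m) * l = 2 * pi * (n - m)%:~R.
Proof. by rewrite /nu intrB; field; rewrite lt0r_neq0. Qed.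

Lemma Int_cos_orth n m : \int[mu]_(x in `]0, l[) cos ((nu n - nu m) * x) = l *+ (n == m).
Proof.
have [->|nm] := eqVneq n m.
  rewrite (@eq_Int _ _ _ _ (fun=> 1)); last by move=> x _; rewrite subrr mul0r cos0.
  by rewrite Int_cst ?ltW// subr0 mul1r.
rewrite Int_cosc ?(ltW l0)//.
  by rewrite nuB sin_int2pi mulr0 sin0 subrr mul0r mulr0n.
have : (nu n - nu m) * l != 0.
  rewrite nuB; apply: mulf_neq0; last by rewrite intr_eq0 subr_eq0.
  by apply: mulf_neq0; [rewrite pnatr_eq0|rewrite gt_eqF ?pi_gt0].
by rewrite mulf_eq0 negb_or => /andP[].
Qed.

Lemma Int_sin_orth n m : \int[mu]_(x in `]0, l[) sin ((nu n - nu m) * x) = 0.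
Proof.
have [->|nm] := eqVneq n m.
  rewrite (@eq_Int _ _ _ _ (fun=> 0)); last by move=> x _; rewrite subrr mul0r sin0.
  by rewrite Int_cst ?ltW// mul0r.
rewrite Int_sinc ?(ltW l0)//.
  by rewrite nuB cos_int2pi mulr0 cos0 subrr mul0r.
have : (nu n - nu m) * l != 0.
  rewrite nuB; apply: mulf_neq0; last by rewrite intr_eq0 subr_eq0.
  by apply: mulf_neq0; [rewrite pnatr_eq0|rewrite gt_eqF ?pi_gt0].
by rewrite mulf_eq0 negb_or => /andP[].
Qed.

Lemma trig_sqr r p q x : trig_re r p q x ^+ 2 + trig_im r p q x ^+ 2 =
  \sum_(n <- r) \sum_(m <- r) ((p n * p m + q n * q m) * cos ((nu n - nu m) * x)
                              + (p n * q m - q n * p m) * sin ((nu n - nu m) * x)).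
Proof.
rewrite !expr2 /trig_re /trig_im !mulr_suml -big_split /=; apply: eq_bigr => n _.
rewrite !mulr_sumr -big_split /=; apply: eq_bigr => m _.
by rewrite (mulrBl x) cosB sinB /cos_mode /sin_mode; ring.
Qed.

(** Only differences of frequencies occur, and these are multiples of 2 pi / l. *)
Lemma trig_norm r p q : uniq r ->
  \int[mu]_(x in `]0, l[) (trig_re r p q x ^+ 2 + trig_im r p q x ^+ 2) =
  l * \sum_(n <- r) (p n ^+ 2 + q n ^+ 2).
Proof.
move=> ur; under eq_Rintegral do rewrite trig_sqr.
have ic c k : intg 0 l (fun x => k * cos (c * x)) by apply/intgZ/intg_cont/cosc_cont.
have isn c k : intg 0 l (fun x => k * sin (c * x)) by apply/intgZ/intg_cont/sinc_cont.
rewrite Int_sum => [|n]; last by apply: intg_sum => m; exact: intgD.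
rewrite mulr_sumr; apply: eq_big_seq => n nr.
rewrite Int_sum => [|m]; last exact: intgD.
rewrite (bigD1_seq n)//= big1 ?addr0 => [|m mn]; last first.
  rewrite IntD// !IntZ; [|exact/intg_cont/sinc_cont|exact/intg_cont/cosc_cont].
  by rewrite Int_cos_orth Int_sin_orth eq_sym (negbTE mn) mulr0n !mulr0 addr0.
rewrite IntD// !IntZ; [|exact/intg_cont/sinc_cont|exact/intg_cont/cosc_cont].
by rewrite Int_cos_orth Int_sin_orth eqxx mulr1n !mulr0 addr0; ring.
Qed.

Lemma Int_trig_re f r p q : L2 0 l f ->
  \int[mu]_(x in `]0, l[) (f x * trig_re r p q x) = \sum_(n <- r) (p n * cos_coef f n - q n * sin_coef f n).
Proof.
move=> Lf; have If := L2_intg Lf.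
have i1 n : intg 0 l (fun x => f x * cos_mode n x) by apply: intgM_cont => //; exact: cos_mode_cont.
have i2 n : intg 0 l (fun x => f x * sin_mode n x) by apply: intgM_cont => //; exact: sin_mode_cont.
transitivity (\int[mu]_(x in `]0, l[) (\sum_(n <- r) (p n * (f x * cos_mode n x) - q n * (f x * sin_mode n x)))).
  apply: eq_Int => x _; rewrite /trig_re mulr_sumr; apply: eq_bigr => n _; ring.
rewrite Int_sum => [|n]; last by apply: intgB; exact: intgZ.
by apply: eq_bigr => n _; rewrite IntB ?IntZ//; exact: intgZ.
Qed.

Lemma Int_trig_im f r p q : L2 0 l f ->
  \int[mu]_(x in `]0, l[) (f x * trig_im r p q x) = \sum_(n <- r) (p n * sin_coef f n + q n * cos_coef f n).
Proof.
move=> Lf; have If := L2_intg Lf.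
have i1 n : intg 0 l (fun x => f x * cos_mode n x) by apply: intgM_cont => //; exact: cos_mode_cont.
have i2 n : intg 0 l (fun x => f x * sin_mode n x) by apply: intgM_cont => //; exact: sin_mode_cont.
transitivity (\int[mu]_(x in `]0, l[) (\sum_(n <- r) (p n * (f x * sin_mode n x) + q n * (f x * cos_mode n x)))).
  apply: eq_Int => x _; rewrite /trig_im mulr_sumr; apply: eq_bigr => n _; ring.
rewrite Int_sum => [|n]; last by apply: intgD; exact: intgZ.
by apply: eq_bigr => n _; rewrite IntD ?IntZ//; exact: intgZ.
Qed.

(** The squared distance, in the complex L^2(0, l), from the real function f to a
    trigonometric polynomial. *)
Definition defect f r p q :=
  \int[mu]_(x in `]0, l[) ((f x - trig_re r p q x) ^+ 2 + trig_im r p q x ^+ 2).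

Lemma defectE f r p q : uniq r -> L2 0 l f ->
  defect f r p q = \int[mu]_(x in `]0, l[) (f x ^+ 2)
    - 2 * \sum_(n <- r) (p n * cos_coef f n - q n * sin_coef f n) + l * \sum_(n <- r) (p n ^+ 2 + q n ^+ 2).
Proof.
move=> ur Lf; rewrite -trig_norm// -Int_trig_re//.
have i1 := L2_sqr Lf; have i2 := L2_mul Lf (trig_re_L2 r p q).
have i3 : intg 0 l (fun x => trig_re r p q x ^+ 2 + trig_im r p q x ^+ 2).
  by apply: intgD; apply: L2_sqr; [exact: trig_re_L2|exact: trig_im_L2].
rewrite -IntZ// -IntB//; last exact: intgZ.
rewrite -IntD//; last by apply: intgB => //; exact: intgZ.
by apply: eq_Int => x _; ring.
Qed.

(** The coefficients of the orthogonal projection of f. *)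
Definition opt_re f n := cos_coef f n / l.
Definition opt_im f n := - sin_coef f n / l.
Definition coef_sqr f n := cos_coef f n ^+ 2 + sin_coef f n ^+ 2.

Lemma defect_opt f r : uniq r -> L2 0 l f ->
  defect f r (opt_re f) (opt_im f) = \int[mu]_(x in `]0, l[) (f x ^+ 2) - l^-1 * \sum_(n <- r) coef_sqr f n.
Proof.
move=> ur Lf; rewrite defectE// !mulr_sumr -addrA; congr (_ + _).
rewrite -sumrN -big_split /= -sumrN; apply: eq_bigr => n _; rewrite /opt_re /opt_im /coef_sqr; field.
by rewrite lt0r_neq0.
Qed.

Lemma defect_ge0 f r p q : 0 <= defect f r p q.
Proof. by apply: Int_ge0 => x _; rewrite addr_ge0 ?sqr_ge0. Qed.

Lemma bessel f r : uniq r -> L2 0 l f ->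
  \sum_(n <- r) coef_sqr f n <= l * \int[mu]_(x in `]0, l[) (f x ^+ 2).
Proof.
move=> ur Lf; have := defect_ge0 f r (opt_re f) (opt_im f).
by rewrite defect_opt// subr_ge0 mulrC ler_pdivrMr// mulrC.
Qed.

(** The square is completed coefficient by coefficient. *)
Lemma defect_min f r p q : uniq r -> L2 0 l f -> defect f r (opt_re f) (opt_im f) <= defect f r p q.
Proof.
move=> ur Lf; rewrite !defectE// -!addrA lerD2l !mulr_sumr -!sumrN -!big_split /=.
apply: ler_sum => n _; rewrite /opt_re /opt_im -subr_ge0.
have -> : - (2 * (p n * cos_coef f n - q n * sin_coef f n)) + l * (p n ^+ 2 + q n ^+ 2) -
  (- (2 * (cos_coef f n / l * cos_coef f n - - sin_coef f n / l * sin_coef f n)) + l * ((cos_coef f n / l) ^+ 2 + (- sin_coef f n / l) ^+ 2))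
  = l * ((p n - cos_coef f n / l) ^+ 2 + (q n + sin_coef f n / l) ^+ 2) by field; rewrite lt0r_neq0.
by apply: mulr_ge0; [exact: ltW|rewrite addr_ge0 ?sqr_ge0].
Qed.

End Trig.

(** * Density of trigonometric polynomials by sampled Fejer means *)

Section Fejer.
Variable R : realType.
Implicit Types (w u th : R).

Definition dir_cos (N : nat) w : R := \sum_(k < N) cos (2 * pi * w * k%:R).
Definition dir_sin (N : nat) w : R := \sum_(k < N) sin (2 * pi * w * k%:R).
(** The Fejer kernel, scaled so that its samples at N equally spaced points have
    sum 1. *)
Definition fejer N w : R := (dir_cos N w ^+ 2 + dir_sin N w ^+ 2) / N%:R ^+ 2.

Lemma fejer_ge0 N w : 0 <= fejer N w.
Proof. by rewrite /fejer divr_ge0 ?addr_ge0 ?sqr_ge0// exprn_ge0. Qed.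

(** Multiplication by 2 sin a makes the sum telescope. *)
Lemma sum_cos_step (a b : R) N :
  2 * sin a * (\sum_(k < N) cos (b + 2 * a * k%:R)) = sin (b + 2 * a * N%:R - a) - sin (b - a).
Proof.
pose F (k : nat) : R := sin (b + 2 * a * k%:R - a).
transitivity (\sum_(0 <= k < N) (F k.+1 - F k)); last first.
  by rewrite telescope_sumr // /F mulr0 addr0.
rewrite big_mkord mulr_sumr; apply: eq_bigr => k _; rewrite /F.
have -> : b + 2 * a * k.+1%:R - a = b + 2 * a * k%:R + a by rewrite -natr1; ring.
by rewrite sinD sinB; ring.
Qed.

Lemma sum_sin_step (a b : R) N :
  2 * sin a * (\sum_(k < N) sin (b + 2 * a * k%:R)) = cos (b - a) - cos (b + 2 * a * N%:R - a).
Proof.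
pose F (k : nat) : R := - cos (b + 2 * a * k%:R - a).
transitivity (\sum_(0 <= k < N) (F k.+1 - F k)); last first.
  by rewrite telescope_sumr // /F mulr0 addr0 opprK addrC.
rewrite big_mkord mulr_sumr; apply: eq_bigr => k _; rewrite /F.
have -> : b + 2 * a * k.+1%:R - a = b + 2 * a * k%:R + a by rewrite -natr1; ring.
by rewrite cosD cosB; ring.
Qed.

(** The Dirichlet sum has modulus |sin (pi N w) / sin (pi w)|; this form avoids
    the division. *)
Lemma sin2_dir_le1 N w : sin (pi * w) ^+ 2 * (dir_cos N w ^+ 2 + dir_sin N w ^+ 2) <= 1.
Proof.
have := sum_cos_step (pi * w) 0 N; have := sum_sin_step (pi * w) 0 N.
have -> : \sum_(k < N) sin (0 + 2 * (pi * w) * k%:R) = dir_sin N w.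
  by apply: eq_bigr => k _; congr sin; ring.
have -> : \sum_(k < N) cos (0 + 2 * (pi * w) * k%:R) = dir_cos N w.
  by apply: eq_bigr => k _; congr cos; ring.
rewrite sub0r sinN cosN add0r.
set b := 2 * _ * _ - _; set a := pi * w.
have := cos2Dsin2 a; have := cos2Dsin2 b.
set C := cos b; set S := sin b; set c := cos a; set s := sin a; set X := dir_cos N w; set Y := dir_sin N w.
move=> H1 H2 H3 H4.
have E : 4 * (s ^+ 2 * (X ^+ 2 + Y ^+ 2)) = (c - C) ^+ 2 + (S - - s) ^+ 2.
  by rewrite -H3 -H4; ring.
have : 0 <= (c + C) ^+ 2 + (S - s) ^+ 2 by rewrite addr_ge0 ?sqr_ge0.
nra.
Qed.

Lemma dir_sqr N w : dir_cos N w ^+ 2 + dir_sin N w ^+ 2 =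
  \sum_(k < N) \sum_(m < N) cos (2 * pi * w * (k%:R - m%:R)).
Proof.
rewrite !expr2 /dir_cos /dir_sin !mulr_suml -big_split /=; apply: eq_bigr => k _.
rewrite !mulr_sumr -big_split /=; apply: eq_bigr => m _.
by rewrite mulrBr cosB.
Qed.

(** The square of the Dirichlet sum is a double sum over k and m; multiplied by
    a phase it becomes a double sum over the frequencies k - m + th, because the
    terms odd in k - m cancel. *)
Lemma phase_sum N w th :
  (\sum_(k < N) \sum_(m < N) cos (2 * pi * w * (k%:R - m%:R + th)) =
    cos (2 * pi * th * w) * (dir_cos N w ^+ 2 + dir_sin N w ^+ 2)) /\
  (\sum_(k < N) \sum_(m < N) sin (2 * pi * w * (k%:R - m%:R + th)) =
    sin (2 * pi * th * w) * (dir_cos N w ^+ 2 + dir_sin N w ^+ 2)).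
Proof.
have Z : \sum_(k < N) \sum_(m < N) sin (2 * pi * w * (k%:R - m%:R)) = 0.
  transitivity (dir_sin N w * dir_cos N w - dir_cos N w * dir_sin N w); last by ring.
  rewrite {1}/dir_sin {2}/dir_cos !mulr_suml -sumrB; apply: eq_bigr => k _.
  rewrite /dir_cos /dir_sin !mulr_sumr -sumrB; apply: eq_bigr => m _.
  by rewrite mulrBr sinB.
rewrite dir_sqr; split.
  transitivity (cos (2 * pi * th * w) * (\sum_(k < N) \sum_(m < N) cos (2 * pi * w * (k%:R - m%:R)))
     - sin (2 * pi * th * w) * (\sum_(k < N) \sum_(m < N) sin (2 * pi * w * (k%:R - m%:R)))); last first.
    by rewrite Z mulr0 subr0.
  rewrite !mulr_sumr -sumrB; apply: eq_bigr => k _.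
  rewrite !mulr_sumr -sumrB; apply: eq_bigr => m _.
  by rewrite -cosD; congr cos; ring.
transitivity (sin (2 * pi * th * w) * (\sum_(k < N) \sum_(m < N) cos (2 * pi * w * (k%:R - m%:R)))
     + cos (2 * pi * th * w) * (\sum_(k < N) \sum_(m < N) sin (2 * pi * w * (k%:R - m%:R)))); last first.
  by rewrite Z mulr0 addr0.
rewrite !mulr_sumr -big_split /=; apply: eq_bigr => k _.
rewrite !mulr_sumr -big_split /=; apply: eq_bigr => m _.
by rewrite -sinD; congr sin; ring.
Qed.

Lemma sin_piM_frac (N k m : nat) : (k < N)%N -> (m < N)%N -> k != m ->
  sin (pi * ((k%:R - m%:R) / N%:R)) != 0 :> R.
Proof.
have H (i j : nat) : (i < N)%N -> (j < i)%N -> sin (pi * ((i%:R - j%:R) / N%:R)) != 0 :> R.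
  move=> iN ji; have N0 : 0 < N%:R :> R by rewrite ltr0n (leq_ltn_trans _ iN).
  rewrite gt_eqF// sin_gt0_pi// mulr_gt0 ?pi_gt0 ?divr_gt0 ?subr_gt0 ?ltr_nat//=.
  rewrite -[ltRHS]mulr1 ltr_pM2l ?pi_gt0// ltr_pdivrMr// mul1r.
  by rewrite (le_lt_trans (y := i%:R)) ?ltr_nat// gerBl.
move=> kN mN; rewrite neq_ltn => /orP[km|mk]; last exact: H.
by rewrite -opprB mulNr mulrN sinN oppr_eq0; exact: H.
Qed.

(** Summation over the samples kills every frequency k - m with
    0 < |k - m| < N. *)
Lemma fejer_sum1 N u : (0 < N)%N -> \sum_(j < N) fejer N (u - j%:R / N%:R) = 1.
Proof.
move=> N0; have N0' : N%:R != 0 :> R by rewrite pnatr_eq0 -lt0n.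
rewrite /fejer -mulr_suml.
under eq_bigr do rewrite dir_sqr.
rewrite exchange_big /=.
have E (k m : 'I_N) : \sum_(j < N) cos (2 * pi * (u - j%:R / N%:R) * (k%:R - m%:R)) = N%:R *+ (k == m) :> R.
  have [->|km] := eqVneq k m.
    rewrite (eq_bigr (fun=> 1)) ?sumr_const ?card_ord// => j _.
    by rewrite subrr mulr0 cos0.
  pose a : R := - (pi * ((k%:R - m%:R) / N%:R)).
  have := sum_cos_step a (2 * pi * u * (k%:R - m%:R)) N.
  rewrite (eq_bigr (fun j : 'I_N => cos (2 * pi * (u - j%:R / N%:R) * (k%:R - m%:R)))); last first.
    by move=> j _; congr cos; rewrite /a; field.
  have -> : 2 * pi * u * (k%:R - m%:R) + 2 * a * N%:R - a =
     2 * pi * u * (k%:R - m%:R) - a - 2 * pi * ((Posz k - Posz m)%:~R).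
    by rewrite intrB /a; field.
  rewrite [sin (_ - _ - _)]sinB cos_int2pi sin_int2pi mulr1 mulr0 subr0 subrr => /eqP.
  have s0 := @sin_piM_frac N k m (ltn_ord k) (ltn_ord m) km.
  by rewrite !mulf_eq0 pnatr_eq0 /= /a sinN oppr_eq0 (negbTE s0) => /eqP ->.
transitivity ((\sum_(k < N) \sum_(m < N) (N%:R *+ (k == m))) / N%:R ^+ 2 : R).
  congr (_ / _); apply: eq_bigr => k _; rewrite exchange_big /=; apply: eq_bigr => m _; exact: E.
rewrite (eq_bigr (fun=> N%:R)) => [|k _]; last first.
  rewrite (bigD1 k)//= eqxx big1 ?addr0// => m mk; by rewrite eq_sym (negbTE mk).
by rewrite sumr_const card_ord -mulr_natr; field.
Qed.

(** Since sin^2 times the kernel is at most 1 / N^2, the N samples of the term in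
    C contribute at most C / N. *)
Lemma fejer_close N u (h : nat -> R) (v eps C : R) : (0 < N)%N -> 0 <= C ->
  (forall j, (j < N)%N -> `|h j - v| <= eps + C * sin (pi * (u - j%:R / N%:R)) ^+ 2) ->
  `|\sum_(j < N) h j * fejer N (u - j%:R / N%:R) - v| <= eps + C / N%:R.
Proof.
move=> N0 C0 H; have N0' : N%:R != 0 :> R by rewrite pnatr_eq0 -lt0n.
have -> : \sum_(j < N) h j * fejer N (u - j%:R / N%:R) - v =
   \sum_(j < N) (h j - v) * fejer N (u - j%:R / N%:R).
  have Ev : v = \sum_(j < N) v * fejer N (u - j%:R / N%:R) by rewrite -mulr_sumr fejer_sum1 ?mulr1.
  by rewrite [X in _ - X = _]Ev -sumrB; apply: eq_bigr => j _; rewrite mulrBl.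
apply: (le_trans (ler_norm_sum _ _ _)).
apply: (@le_trans _ _ (\sum_(j < N) (eps * fejer N (u - j%:R / N%:R) + C / N%:R ^+ 2))).
  apply: ler_sum => j _; rewrite normrM (ger0_norm (fejer_ge0 _ _)).
  apply: (le_trans (ler_wpM2r (fejer_ge0 _ _) (H j (ltn_ord j)))).
  rewrite mulrDl lerD2l /fejer mulrA; apply: ler_wpM2r.
    by rewrite invr_ge0 exprn_ge0.
  by rewrite -mulrA -[leRHS]mulr1 ler_wpM2l// sin2_dir_le1.
rewrite big_split /= -mulr_sumr fejer_sum1// mulr1 lerD2l sumr_const card_ord -mulr_natr.
by rewrite le_eqVlt; apply/orP; left; apply/eqP; field.
Qed.

Lemma ler_sin_pi (a w : R) : 0 < a -> a <= w -> w <= 1 - a -> sin (pi * a) <= sin (pi * w).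
Proof.
move=> a0 aw w1.
have M (x y : R) : 0 <= x -> x <= y -> y <= 2^-1 -> sin (pi * x) <= sin (pi * y).
  move=> x0 xy y2; rewrite leNgt ltr_sin ?in_itv /=; [by rewrite -leNgt ler_pM2l ?pi_gt0| |].
    by have p0 := pi_gt0 R; apply/andP; split; nra.
  by have p0 := pi_gt0 R; apply/andP; split; nra.
have [w2|w2] := leP w 2^-1; first by apply: M => //; exact: ltW.
have -> : sin (pi * w) = sin (pi * (1 - w)).
  by rewrite mulrBr mulr1 sinB sinpi cospi; ring.
by apply: M; [exact: ltW| lra | lra].
Qed.

End Fejer.

Section Lipschitz.
Variable R : realType.
Local Notation mu := (@lebesgue_measure R).
Implicit Types (f g : R -> R).

Lemma lip_cont (K : R) f : (forall x y, `|f x - f y| <= K * `|x - y|) -> continuous f.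
Proof.
move=> H x; apply/cvgrPdist_le => /= e e0.
have K0 : 0 <= K.
  have := H 1 0; rewrite subr0 normr1 mulr1; apply: le_trans; exact: normr_ge0.
have K1 : 0 < K + 1 by lra.
apply/nbhs_ballP; exists (e / (K + 1)) => /=; first by rewrite divr_gt0.
move=> y; rewrite /ball /= => xy.
apply: (le_trans (H _ _)); apply: (@le_trans _ _ ((K + 1) * `|x - y|)).
  by rewrite ler_wpM2r// lerDl.
by rewrite mulrC -ler_pdivlMr//; apply: ltW.
Qed.

Lemma affine_cont (p : R -> R) (c d : R) : continuous p -> continuous (fun x => p (c * x + d)).
Proof.
move=> cp x; apply: (@continuous_comp _ _ _ (fun x => c * x + d) p); last exact: cp.
by apply: cvgD; [apply: cvgM; [exact: cvg_cst|exact: cvg_id]|exact: cvg_cst].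
Qed.

Lemma eq_cont (p p' : R -> R) : continuous p -> (forall x, p x = p' x) -> continuous p'.
Proof. by move=> cp /funext <-. Qed.

Lemma shift_cont (p : R -> R) (c : R) : continuous p -> continuous (fun x => p (x + c)).
Proof.
move=> cp x; apply: (@continuous_comp _ _ _ (fun x => x + c) p); last exact: cp.
by apply: cvgD; [exact: cvg_id|exact: cvg_cst].
Qed.

Definition clamp (A B x : R) : R := if x < A then A else if B < x then B else x.

Lemma clamp_bd (A B x : R) : A <= B -> A <= clamp A B x <= B.
Proof. by move=> AB; rewrite /clamp; case: ltP => h1; [|case: ltP => h2]; apply/andP; split; lra. Qed.

Lemma clamp_lip (A B x y : R) : A <= B -> `|clamp A B x - clamp A B y| <= `|x - y|.
Proof.
move=> AB; have h1 := ler_norm (x - y); have h2 := ler_norm (y - x); rewrite distrC in h2.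
rewrite /clamp ler_norml; set d := `|_| in h1 h2 *.
by case: (ltP x) => ?; case: (ltP y) => ?; do ?case: (ltP B) => ?; apply/andP; split; lra.
Qed.

Lemma clamp_id (A B x : R) : A <= x <= B -> clamp A B x = x.
Proof. by move=> /andP[Ax xB]; rewrite /clamp !ltNge Ax xB. Qed.

Lemma clamp_cont (A B : R) : A <= B -> continuous (clamp A B).
Proof. by move=> AB; apply: (@lip_cont 1) => x y; rewrite mul1r clamp_lip. Qed.

Definition clip (M x : R) : R := clamp (- M) M x.

Lemma clip_bd (M x : R) : 0 <= M -> `|clip M x| <= M.
Proof. by move=> M0; rewrite ler_norml; apply: clamp_bd; lra. Qed.

Lemma clip_lip (M x y : R) : 0 <= M -> `|clip M x - clip M y| <= `|x - y|.
Proof. by move=> M0; apply: clamp_lip; lra. Qed.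

Lemma clip_id (M x : R) : `|x| <= M -> clip M x = x.
Proof. by rewrite ler_norml; exact: clamp_id. Qed.

Lemma clip_err (M x : R) : 0 <= M -> (x - clip M x) ^+ 2 <= x ^+ 2.
Proof. by move=> M0; rewrite /clip /clamp; case: ltP => h1; [nra|case: ltP => h2; nra]. Qed.

Lemma clip_cont (M : R) : 0 <= M -> continuous (clip M).
Proof. by move=> M0; apply: clamp_cont; lra. Qed.

End Lipschitz.

Section DCT.
Variable R : realType.
Local Notation mu := (@lebesgue_measure R).

Lemma Int0 (a b : R) : \int[mu]_(x in `]a, b[) (0 : R) = 0.
Proof.
rewrite (@eq_Int _ _ _ _ (fun=> 0 * 0)); last by move=> x _; rewrite mulr0.
by rewrite IntZ ?mul0r//; exact/intg_cont/cst_continuous.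
Qed.

Lemma Int_dct (a b : R) (F : nat -> R -> R) (f g : R -> R) :
  (forall n, measurable_fun `]a, b[ (F n)) -> measurable_fun `]a, b[ f -> intg a b g ->
  (forall n x, a < x < b -> `|F n x| <= g x) ->
  (forall x, a < x < b -> (fun n => F n x) @ \oo --> f x) ->
  (fun n => \int[mu]_(x in `]a, b[) F n x) @ \oo --> \int[mu]_(x in `]a, b[) f x.
Proof.
move=> mF mf ig bF cF.
have [] := @dominated_convergence _ _ R mu (`]a, b[%classic : set R) (measurable_itv _)
  (fun n x => (F n x)%:E) (fun x => (f x)%:E) (fun x => (g x)%:E).
- by move=> n; apply/measurable_EFinP; exact: mF.
- by apply/measurable_EFinP; exact: mf.
- by apply: aeW => x /=; rewrite in_itv /= => /cF ?; exact: cvg_EFin (nearW _ _) _.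
- by [].
- by apply: aeW => x n /=; rewrite in_itv /= => /bF ?; rewrite lee_fin.
move=> If _ H; apply: fine_cvg; rewrite fineK//.
exact: integrable_fin_num.
Qed.

End DCT.

Section Approx.
Variable R : realType.
Local Notation mu := (@lebesgue_measure R).
Variables (l th : R).
Hypothesis l0 : 0 < l.
Implicit Types (f g : R -> R).

(** Equal frequencies are gathered, since [trig_norm] wants them distinct. *)
Lemma trig_collect (T : eqType) (I : seq T) (h : T -> int) (a b : T -> R) :
  exists r p q, [/\ uniq r,
    forall x, trig_re l th r p q x = \sum_(i <- I) (a i * cos_mode l th (h i) x - b i * sin_mode l th (h i) x) &
    forall x, trig_im l th r p q x = \sum_(i <- I) (a i * sin_mode l th (h i) x + b i * cos_mode l th (h i) x)].
Proof.
exists (undup (map h I)), (fun n => \sum_(i <- I | h i == n) a i), (fun n => \sum_(i <- I | h i == n) b i).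
have E (F : T -> R) : \sum_(n <- undup (map h I)) \sum_(i <- I | h i == n) F i = \sum_(i <- I) F i.
  rewrite (exchange_big_dep predT)//=; apply: eq_big_seq => i iI.
  rewrite (eq_bigl (fun n => n == h i)); last by move=> n; rewrite eq_sym.
  rewrite -big_filter filter_pred1_uniq ?undup_uniq// ?big_seq1//.
  by rewrite mem_undup; apply: map_f.
split; first exact: undup_uniq.
  move=> x; rewrite -E; apply: eq_bigr => n _.
  by rewrite !mulr_suml -sumrB; apply: eq_bigr => i /eqP ->.
move=> x; rewrite -E; apply: eq_bigr => n _.
by rewrite !mulr_suml -big_split /=; apply: eq_bigr => i /eqP ->.
Qed.

(** Fejer means of g, computed from N samples instead of an integral, and twisted
    by th: expanding the kernel leaves only the frequencies nu_n. *)
Definition fejer_re N g x := \sum_(j < N) (g (l * (j%:R / N%:R)) * cos (2 * pi * th * (x / l - j%:R / N%:R)))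
   * fejer N (x / l - j%:R / N%:R).
Definition fejer_im N g x := \sum_(j < N) (g (l * (j%:R / N%:R)) * sin (2 * pi * th * (x / l - j%:R / N%:R)))
   * fejer N (x / l - j%:R / N%:R).

Lemma fejer_trig N g : exists r p q, [/\ uniq r,
  forall x, fejer_re N g x = trig_re l th r p q x & forall x, fejer_im N g x = trig_im l th r p q x].
Proof.
pose T := ('I_N * ('I_N * 'I_N))%type.
pose h (i : T) : int := (Posz i.2.1 - Posz i.2.2).
pose ph (i : T) : R := 2 * pi * (i.1%:R / N%:R) * (i.2.1%:R - i.2.2%:R + th).
pose G (j : 'I_N) : R := g (l * (j%:R / N%:R)) / N%:R ^+ 2.
have [r [p [q [ur HR HI]]]] := trig_collect (index_enum T) h (fun i => G i.1 * cos (ph i)) (fun i => - G i.1 * sin (ph i)).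
have K (i : T) x : nu l th (h i) * x - ph i = 2 * pi * (x / l - i.1%:R / N%:R) * (i.2.1%:R - i.2.2%:R + th).
  by rewrite /nu /h /ph intrB; ring.
have P (F : 'I_N -> 'I_N -> 'I_N -> R) : \sum_(i : T) F i.1 i.2.1 i.2.2 = \sum_j \sum_k \sum_m F j k m.
  by under [RHS]eq_bigr do rewrite pair_bigA; rewrite pair_bigA.
exists r, p, q; split => // x.
  rewrite HR (eq_bigr (fun i : T => G i.1 * cos (2 * pi * (x / l - i.1%:R / N%:R) * (i.2.1%:R - i.2.2%:R + th)))); last first.
    by move=> i _; rewrite -K cosB /cos_mode /sin_mode; ring.
  rewrite (P (fun j k m => G j * cos (2 * pi * (x / l - j%:R / N%:R) * (k%:R - m%:R + th)))).
  apply: eq_bigr => j _.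
  set w := x / l - _.
transitivity (G j * (cos (2 * pi * th * w) * (dir_cos N w ^+ 2 + dir_sin N w ^+ 2))); first by rewrite /fejer /G; ring.
rewrite -(phase_sum N w th).1.
  by rewrite !mulr_sumr; apply: eq_bigr => k _; rewrite !mulr_sumr.
rewrite HI (eq_bigr (fun i : T => G i.1 * sin (2 * pi * (x / l - i.1%:R / N%:R) * (i.2.1%:R - i.2.2%:R + th)))); last first.
  by move=> i _; rewrite -K sinB /cos_mode /sin_mode; ring.
rewrite (P (fun j k m => G j * sin (2 * pi * (x / l - j%:R / N%:R) * (k%:R - m%:R + th)))).
apply: eq_bigr => j _.
set w := x / l - _.
transitivity (G j * (sin (2 * pi * th * w) * (dir_cos N w ^+ 2 + dir_sin N w ^+ 2))); first by rewrite /fejer /G; ring.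
rewrite -(phase_sum N w th).2.
by rewrite !mulr_sumr; apply: eq_bigr => k _; rewrite !mulr_sumr.
Qed.

(** Continuity at x handles the points near x; the other ones are handled by the
    bound on G, since sin^2 stays away from 0 there. *)
Lemma fejer_loc (G : R -> R) (x M eps : R) : 0 < x < l -> {for x, continuous G} ->
  (forall y, `|G y| <= M) -> 0 < eps ->
  exists2 C : R, 0 <= C & forall y : R, 0 <= y <= l -> `|G y - G x| <= eps + C * sin (pi * ((x - y) / l)) ^+ 2.
Proof.
move=> /andP[x0 xl] cG bG e0.
have M0 : 0 <= M := le_trans (normr_ge0 _) (bG 0).
move/cvgrPdist_le : cG => /(_ _ e0)/nbhs_ballP[d /= d0 Hd].
pose a := Num.min (d / l) (Num.min (x / l) ((l - x) / l)).
have a0 : 0 < a by rewrite !lt_min !divr_gt0// subr_gt0.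
have ad : a <= d / l by rewrite ge_min lexx.
have ax : a <= x / l by rewrite !ge_min lexx orbT.
have al : a <= (l - x) / l by rewrite !ge_min lexx !orbT.
have ah : a <= 1 - a.
  have : x / l + (l - x) / l = 1 by field; rewrite gt_eqF.
  lra.
have s0 : 0 < sin (pi * a).
  have p0 := pi_gt0 R; rewrite sin_gt0_pi// mulr_gt0//= -[ltRHS]mulr1 ltr_pM2l//; lra.
(* beyond the distance d of x, |G y - G x| <= 2 M while sin^2 is at least sin^2 (pi a) *)
exists (2 * M / sin (pi * a) ^+ 2); first by apply: divr_ge0; [exact: mulr_ge0|exact: sqr_ge0].
move=> y /andP[y0 yl].
have [xy|xy] := ltP `|x - y| d.
  rewrite distrC (le_trans (Hd y _))//= lerDl; apply: mulr_ge0; last exact: sqr_ge0.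
  by apply: divr_ge0; [exact: mulr_ge0|exact: sqr_ge0].
have wa : a <= `|x - y| / l by apply: (le_trans ad); rewrite ler_pM2r ?invr_gt0.
have w1 : `|x - y| / l <= 1 - a.
  have : `|x - y| / l <= Num.max (x / l) ((l - x) / l).
    rewrite le_max !ler_pM2r ?invr_gt0//; case: (lerP 0 (x - y)) => h.
      by rewrite (ger0_norm h); apply/orP; left; lra.
    by rewrite (ltr0_norm h); apply/orP; right; lra.
  move=> H; apply: (le_trans H); rewrite ge_max.
  have E : x / l + (l - x) / l = 1 by field; rewrite gt_eqF.
  by apply/andP; split; lra.
have S := ler_sin_pi a0 wa w1.
have E : sin (pi * ((x - y) / l)) ^+ 2 = sin (pi * (`|x - y| / l)) ^+ 2.
  have [h|h] := leP 0 (x - y); first by rewrite (ger0_norm h).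
  by rewrite (ltr0_norm h) mulNr mulrN sinN sqrrN.
rewrite E; apply: (@le_trans _ _ (2 * M)).
  by rewrite (le_trans (ler_normB _ _))//; have := bG x; have := bG y; lra.
rewrite -[leLHS]add0r; apply: lerD; first exact: ltW.
rewrite mulrAC ler_pdivlMr ?exprn_gt0//; apply: ler_wpM2l; first by rewrite mulr_ge0.
by rewrite lerXn2r ?nnegrE ?(ltW s0)// (le_trans _ S)// ltW.
Qed.

Lemma cvg_fejer (G : R -> R) (x M : R) : 0 < x < l -> {for x, continuous G} ->
  (forall y, `|G y| <= M) ->
  (fun N => \sum_(j < N.+1) G (l * (j%:R / N.+1%:R)) * fejer N.+1 (x / l - j%:R / N.+1%:R)) @ \oo --> G x.
Proof.
move=> xl cG bG; apply/cvgrPdist_le => /= e e0.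
have ln := lt0r_neq0 l0.
have e20 : 0 < e / 2 by lra.
have [C C0 HC] := fejer_loc xl cG bG e20.
near=> N.
rewrite distrC; apply: (@le_trans _ _ (e / 2 + C / N.+1%:R)).
  apply: (@fejer_close _ N.+1 (x / l) (fun j => G (l * (j%:R / N.+1%:R)))) => // j jN.
  have -> : x / l - j%:R / N.+1%:R = (x - l * (j%:R / N.+1%:R)) / l.
    by field; rewrite ln nat1r pnatr_eq0.
  apply: HC; apply/andP; split; first by rewrite mulr_ge0 ?divr_ge0// ltW.
  rewrite -[leRHS]mulr1 ler_pM2l// ler_pdivrMr// mul1r ler_nat; exact: ltnW.
rewrite [leRHS](splitr e) lerD2l.
rewrite ler_pdivrMr// mulrC -ler_pdivrMr//.
near: N; exists (Num.truncn (C / (e / 2))) => // N /= HN.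
apply: ltW; apply: (lt_le_trans (truncnS_gt _)); by rewrite ler_nat.
Unshelve. all: by end_near. Qed.

Lemma fejer_re_cvg g (x M : R) : 0 < x < l -> continuous g -> (forall y, `|g y| <= M) ->
  (fun N => fejer_re N.+1 g x) @ \oo --> g x.
Proof.
move=> xl cg bg.
pose G y := g y * cos (2 * pi * th * ((x - y) / l)).
have Gx : G x = g x by rewrite /G subrr mul0r mulr0 cos0 mulr1.
rewrite -Gx; have := @cvg_fejer G x M xl _ _.
have -> : (fun N : nat => \sum_(j < N.+1) G (l * (j%:R / N.+1%:R)) * fejer N.+1 (x / l - j%:R / N.+1%:R))
   = (fun N => fejer_re N.+1 g x).
  apply/funext => N; apply: eq_bigr => j _; rewrite /G; congr (_ * cos (_ * _) * _).
  by field; rewrite (lt0r_neq0 l0) nat1r pnatr_eq0.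
apply.
  move=> y; apply: cvgM; first exact: cg.
  apply: (@continuous_comp _ _ _ (fun y => 2 * pi * th * ((x - y) / l)) cos); last exact: continuous_cos.
  apply: cvgM; first exact: cvg_cst.
  apply: cvgM; last exact: cvg_cst.
  by apply: cvgB; [exact: cvg_cst|exact: cvg_id].
move=> y; rewrite /G normrM -[leRHS]mulr1 ler_pM//; exact: cos_max.
Qed.

Lemma fejer_im_cvg g (x M : R) : 0 < x < l -> continuous g -> (forall y, `|g y| <= M) ->
  (fun N => fejer_im N.+1 g x) @ \oo --> (0 : R).
Proof.
move=> xl cg bg.
pose G y := g y * sin (2 * pi * th * ((x - y) / l)).
have Gx : G x = 0 by rewrite /G subrr mul0r mulr0 sin0 mulr0.
rewrite -Gx; have := @cvg_fejer G x M xl _ _.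
have -> : (fun N : nat => \sum_(j < N.+1) G (l * (j%:R / N.+1%:R)) * fejer N.+1 (x / l - j%:R / N.+1%:R))
   = (fun N => fejer_im N.+1 g x).
  apply/funext => N; apply: eq_bigr => j _; rewrite /G; congr (_ * sin (_ * _) * _).
  by field; rewrite (lt0r_neq0 l0) nat1r pnatr_eq0.
apply.
  move=> y; apply: cvgM; first exact: cg.
  apply: (@continuous_comp _ _ _ (fun y => 2 * pi * th * ((x - y) / l)) sin); last exact: continuous_sin.
  apply: cvgM; first exact: cvg_cst.
  apply: cvgM; last exact: cvg_cst.
  by apply: cvgB; [exact: cvg_cst|exact: cvg_id].
move=> y; rewrite /G normrM -[leRHS]mulr1 ler_pM//; exact: sin_max.
Qed.

Lemma fejer_avg_bd N (u M : R) (c d : nat -> R) : 0 <= M -> (forall j, `|c j| <= M) -> (forall j, `|d j| <= 1) ->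
  `|\sum_(j < N.+1) (c j * d j) * fejer N.+1 (u - j%:R / N.+1%:R)| <= M.
Proof.
move=> M0 cM d1; apply: (le_trans (ler_norm_sum _ _ _)).
apply: (@le_trans _ _ (\sum_(j < N.+1) M * fejer N.+1 (u - j%:R / N.+1%:R))).
  apply: ler_sum => j _; rewrite normrM (ger0_norm (fejer_ge0 _ _)) ler_wpM2r ?fejer_ge0//.
  by rewrite normrM -[leRHS]mulr1 ler_pM.
by rewrite -mulr_sumr fejer_sum1// mulr1.
Qed.

Lemma Int_fejer_cvg g (M : R) : continuous g -> (forall y, `|g y| <= M) ->
  (fun N => \int[mu]_(x in `]0, l[) ((g x - fejer_re N.+1 g x) ^+ 2 + fejer_im N.+1 g x ^+ 2)) @ \oo --> (0 : R).
Proof.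
move=> cg bg; have M0 : 0 <= M := le_trans (normr_ge0 _) (bg 0).
rewrite -[X in _ --> X](Int0 0 l).
apply: (@Int_dct _ 0 l (fun N x => (g x - fejer_re N.+1 g x) ^+ 2 + fejer_im N.+1 g x ^+ 2) (fun=> 0) (fun=> (2 * M) ^+ 2 + M ^+ 2)).
- move=> N; have [r [p [q [ur HR HI]]]] := fejer_trig N.+1 g.
  apply: (eq_measurable_fun (fun x => (g x - trig_re l th r p q x) ^+ 2 + trig_im l th r p q x ^+ 2)).
    by move=> x _; rewrite HR HI.
  apply: measurable_funD; apply: measurable_funX; last by case: (trig_im_L2 l th r p q).
  by case: (L2B (L2_cont 0 l cg) (trig_re_L2 l th r p q)).
- exact: measurable_cst.
- by apply: intg_cont; exact: cst_continuous.
- move=> N x _; rewrite ger0_norm ?addr_ge0 ?sqr_ge0//.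
  have h1 : `|fejer_re N.+1 g x| <= M.
    apply: (@fejer_avg_bd N (x / l) M (fun j => g (l * (j%:R / N.+1%:R)))
      (fun j => cos (2 * pi * th * (x / l - j%:R / N.+1%:R)))) => // j; exact: cos_max.
  have h2 : `|fejer_im N.+1 g x| <= M.
    apply: (@fejer_avg_bd N (x / l) M (fun j => g (l * (j%:R / N.+1%:R)))
      (fun j => sin (2 * pi * th * (x / l - j%:R / N.+1%:R)))) => // j; exact: sin_max.
  have h3 := bg x; move: h1 h2 h3; rewrite !ler_norml => /andP[? ?] /andP[? ?] /andP[? ?].
  apply: lerD; nra.
- move=> x xl; rewrite -[X in _ --> X](_ : (g x - g x) ^+ 2 + 0 ^+ 2 = 0); last by rewrite subrr expr0n addr0.
  apply: cvgD; apply: (@cvg_comp _ _ _ _ (fun y => y ^+ 2)); [|exact: exprn_continuous| |exact: exprn_continuous].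
    by apply: cvgB; [exact: cvg_cst|exact: fejer_re_cvg bg].
  exact: fejer_im_cvg bg.
Qed.

Lemma trig_dense_cont g (M eps : R) : continuous g -> (forall y, `|g y| <= M) -> 0 < eps ->
  exists r p q, uniq r /\ defect l th g r p q < eps.
Proof.
move=> cg bg e0; have /cvgrPdist_lt/(_ _ e0)[N _ /(_ N (leqnn _))/=] := Int_fejer_cvg cg bg.
rewrite sub0r normrN => H.
have [r [p [q [ur HR HI]]]] := fejer_trig N.+1 g; exists r, p, q; split => //.
apply: le_lt_trans H; rewrite /defect; apply: le_trans (ler_norm _).
by rewrite le_eqVlt; apply/orP; left; apply/eqP; apply: eq_Int => x _; rewrite HR HI.
Qed.

(** f is truncated at height M, approximated in L^1 by a continuous function, and
    the latter is truncated too: among functions bounded by M, closeness in L^1 is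
    closeness in L^2. *)
Lemma cont_dense f (eps : R) : L2 0 l f -> 0 < eps ->
  exists g M, [/\ continuous g, forall y, `|g y| <= M & \int[mu]_(x in `]0, l[) ((f x - g x) ^+ 2) < eps].
Proof.
move=> Lf e0.
have e4 : 0 < eps / 4 by lra.
have mc (M : R) : 0 <= M -> measurable_fun `]0, l[ (clip M \o f).
  move=> M0; apply: measurableT_comp; last by case: Lf.
  by apply: continuous_measurable_fun; exact: clip_cont.
have [M [M0 HM]] : exists M : R, 0 < M /\ \int[mu]_(x in `]0, l[) ((f x - clip M (f x)) ^+ 2) < eps / 4.
  have : (fun N : nat => \int[mu]_(x in `]0, l[) ((f x - clip N.+1%:R (f x)) ^+ 2)) @ \oo --> (0 : R).
    rewrite -[X in _ --> X](Int0 0 l).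
    apply: (@Int_dct _ 0 l (fun N x => (f x - clip N.+1%:R (f x)) ^+ 2) (fun=> 0) (fun x => f x ^+ 2)).
    - move=> N; apply: measurable_funX; apply: measurable_funB; first by case: Lf.
      exact: mc.
    - exact: measurable_cst.
    - exact: L2_sqr.
    - by move=> N x _; rewrite ger0_norm ?sqr_ge0// clip_err.
    - move=> x _; apply/cvgrPdist_le => /= e e1; near=> N.
      rewrite clip_id ?subrr ?expr0n ?subr0 ?normr0 ?ltW//.
      near: N; exists (Num.truncn `|f x|) => // N /= HN.
      apply: (lt_le_trans (truncnS_gt _)); by rewrite ler_nat.
  move=> /cvgrPdist_lt/(_ _ e4)[N _ /(_ N (leqnn _))/=]; rewrite sub0r normrN => H.
  by exists N.+1%:R; split => //; apply: le_lt_trans H; exact: ler_norm.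
have If : intg 0 l (fun x => clip M (f x)).
  apply: (@le_integrable _ _ _ mu _ _ _ (fun=> M%:E)) => //=.
  - by apply/measurable_EFinP; apply: mc; exact: ltW.
  - move=> x _; rewrite lee_fin (ger0_norm (ltW M0)); apply: clip_bd; exact: ltW.
  - by apply: (@intg_cont _ 0 l (fun=> M)); exact: cst_continuous.
have lf : (mu `]0%R, l[%classic < +oo)%E.
  by rewrite (lebesgue_measure_itv `]0%R, l[%R) /= ; case: ifP => _; rewrite ?ltry// -EFinB ltry.
have [g_ [cg ig Hg]] := approximation_continuous_integrable (measurable_itv _) lf If.
(* the L^1 error is multiplied by 2 M, then by 2, and eps / 4 is left for it *)
have e8 : 0 < eps / (16 * M) by rewrite divr_gt0// mulr_gt0.
have [N] : exists N, \int[mu]_(x in `]0, l[) `|clip M (f x) - g_ N x| < eps / (16 * M).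
  have : (fun n => \int[mu]_(x in `]0, l[) `|clip M (f x) - g_ n x|) @ \oo --> (0 : R).
    exact: (fine_cvg Hg).
  move=> /cvgrPdist_lt/(_ _ e8)[N _ /(_ N (leqnn _))/=].
  rewrite sub0r normrN => H; exists N; apply: le_lt_trans H; exact: ler_norm.
move=> HN; exists (clip M \o g_ N), M; split.
- by move=> x; apply: continuous_comp; [exact: cg|exact/clip_cont/ltW].
- by move=> y; apply: clip_bd; exact: ltW.
have ccg : continuous (clip M \o g_ N).
  by move=> x; apply: continuous_comp; [exact: cg|exact/clip_cont/ltW].
have Lc : L2 0 l (fun x => clip M (f x)).
  split; first by apply: mc; exact: ltW.
  apply: (@le_integrable _ _ _ mu _ _ _ (fun=> (M ^+ 2)%:E)) => //=.
  - by apply/measurable_EFinP; apply: measurable_funX; apply: mc; exact: ltW.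
  - move=> x _; rewrite lee_fin !ger0_norm ?sqr_ge0//.
    have := clip_bd (f x) (ltW M0); rewrite ler_norml => /andP[? ?]; nra.
  - by apply: (@intg_cont _ 0 l (fun=> M ^+ 2)); exact: cst_continuous.
have Lg : L2 0 l (clip M \o g_ N) := L2_cont 0 l ccg.
have i1 : intg 0 l (fun x => (f x - clip M (f x)) ^+ 2) := L2_sqr (L2B Lf Lc).
have i2 : intg 0 l (fun x => (clip M (f x) - clip M (g_ N x)) ^+ 2) := L2_sqr (L2B Lc Lg).
have i3 : intg 0 l (fun x => `|clip M (f x) - g_ N x|) by apply: intg_norm; apply: intgB => //; exact: ig.
have i4 : intg 0 l (fun x => (f x - clip M (g_ N x)) ^+ 2) := L2_sqr (L2B Lf Lg).
apply: (@le_lt_trans _ _ (\int[mu]_(x in `]0, l[) (2 * (f x - clip M (f x)) ^+ 2 + (4 * M) * `|clip M (f x) - g_ N x|))).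
  apply: le_Int => //; first by apply: intgD; exact: intgZ.
  move=> x _ /=.
  have := clip_lip (clip M (f x)) (g_ N x) (ltW M0).
  rewrite (clip_id (clip_bd (f x) (ltW M0))).
  have := clip_bd (f x) (ltW M0); have := clip_bd (g_ N x) (ltW M0).
  set A := clip M (f x); set B := clip M (g_ N x); set D := `|A - g_ N x|.
  have D0 : 0 <= D by exact: normr_ge0.
  rewrite !ler_norml => /andP[? ?] /andP[? ?] /andP[? ?].
  have E : (A - B) ^+ 2 <= (2 * M) * D by nra.
  have : 0 <= (f x - A - (A - B)) ^+ 2 by exact: sqr_ge0.
  nra.
rewrite IntD ?IntZ//; [|exact: intgZ|exact: intgZ].
have : 4 * M * \int[mu]_(x in `]0, l[) `|clip M (f x) - g_ N x| < 4 * M * (eps / (16 * M)).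
  by rewrite ltr_pM2l// mulr_gt0.
have -> : 4 * M * (eps / (16 * M)) = eps / 4 by field; rewrite gt_eqF.
lra.
Unshelve. all: by end_near. Qed.

Lemma trig_dense f (eps : R) : L2 0 l f -> 0 < eps ->
  exists r p q, uniq r /\ defect l th f r p q < eps.
Proof.
move=> Lf e0; have e4 : 0 < eps / 4 by lra.
have [g [M [cg bg Hg]]] := cont_dense Lf e4.
have [r [p [q [ur Hd]]]] := trig_dense_cont cg bg e4.
exists r, p, q; split => //.
have Lg := L2_cont 0 l cg.
have LR := trig_re_L2 l th r p q; have LI := trig_im_L2 l th r p q.
have i1 : intg 0 l (fun x => (f x - g x) ^+ 2) := L2_sqr (L2B Lf Lg).
have i2 : intg 0 l (fun x => (g x - trig_re l th r p q x) ^+ 2 + trig_im l th r p q x ^+ 2).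
  by apply: intgD; [exact: L2_sqr (L2B Lg LR)|exact: L2_sqr].
apply: (@le_lt_trans _ _ (\int[mu]_(x in `]0, l[) (2 * (f x - g x) ^+ 2 +
   2 * ((g x - trig_re l th r p q x) ^+ 2 + trig_im l th r p q x ^+ 2)))).
  apply: le_Int; [|by apply: intgD; exact: intgZ|].
    by apply: intgD; [exact: L2_sqr (L2B Lf LR)|exact: L2_sqr].
  move=> x _; set a := f x; set b := g x; set c := trig_re _ _ _ _ _ _; set d := trig_im _ _ _ _ _ _.
  have : 0 <= (a - b - (b - c)) ^+ 2 by exact: sqr_ge0.
  have : 0 <= d ^+ 2 by exact: sqr_ge0.
  nra.
rewrite IntD ?IntZ//; [|exact: intgZ|exact: intgZ].
rewrite /defect in Hd; lra.
Qed.

End Approx.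

(** * Parseval's identity and its polarisation *)

Section Parseval.
Variable R : realType.
Local Notation mu := (@lebesgue_measure R).
Variables (l th : R).
Hypothesis l0 : 0 < l.
Implicit Types (f g : R -> R) (n : int) (r : seq int).

Local Notation cos_coef := (cos_coef l th).
Local Notation sin_coef := (sin_coef l th).
Local Notation coef_sqr := (coef_sqr l th).

Lemma coef_sqr_ge0 f n : 0 <= coef_sqr f n. Proof. by rewrite addr_ge0 ?sqr_ge0. Qed.

Lemma ler_sum_sub (F : int -> R) (r0 r : seq int) : (forall n, 0 <= F n) ->
  uniq r0 -> uniq r -> {subset r0 <= r} -> \sum_(n <- r0) F n <= \sum_(n <- r) F n.
Proof.
move=> F0 u0 ur sub; rewrite [leRHS](bigID (mem r0)) /=.
rewrite (_ : \sum_(n <- r0) F n = \sum_(i <- r | i \in r0) F i); last first.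
  rewrite -[RHS]big_filter; apply: perm_big; apply: uniq_perm => //; first exact: filter_uniq.
  move=> n; rewrite mem_filter; case: (boolP (n \in r0)) => //= /sub ->//.
by rewrite lerDl sumr_ge0.
Qed.

(** The projection onto a larger set of frequencies is closer to f. *)
Lemma parseval_lim f (eps : R) : L2 0 l f -> 0 < eps ->
  exists2 r0, uniq r0 & forall r, uniq r -> {subset r0 <= r} ->
    defect l th f r (opt_re l th f) (opt_im l th f) < eps.
Proof.
move=> Lf e0; have [r0 [p [q [u0 H]]]] := trig_dense th l0 Lf e0.
exists r0 => // r ur sub.
apply: le_lt_trans H; apply: le_trans (defect_min th l0 p q u0 Lf).
rewrite !defect_opt// lerD2l lerN2 ler_pM2l ?invr_gt0//.
exact: ler_sum_sub (coef_sqr_ge0 f) _ _ _.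
Qed.

(** One inequality is Bessel's, the other one is completeness. *)
Lemma parseval f : L2 0 l f ->
  (\esum_(n in [set: int]) (coef_sqr f n)%:E)%E = (l * \int[mu]_(x in `]0, l[) (f x ^+ 2))%:E.
Proof.
move=> Lf; apply/eqP; rewrite eq_le; apply/andP; split.
  apply: ub_ereal_sup => _ [A [finA _] <-].
  rewrite fsbig_finite//= sumEFin lee_fin; apply: bessel => //; exact: finmap.fset_uniq.
apply/lee_addgt0Pr => e e0.
have el : 0 < e / l by rewrite divr_gt0.
have [r u H] := parseval_lim Lf el.
have {H} := H r u (fun=> id); rewrite defect_opt// => H.
apply: (@le_trans _ _ ((\sum_(n <- r) coef_sqr f n)%:E + e%:E)%E).
  rewrite -EFinD lee_fin mulrC -ler_pdivlMr// mulrDl; move: H.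
  rewrite mulrC ltrBlDr => /ltW; rewrite addrC => /le_trans; apply.
  by rewrite mulrC.
rewrite leeD2r//; apply: esum_ge; exists [set` r]; first by split => //; exact: finite_seq.
by rewrite -fsbig_seq// sumEFin.
Qed.

(** The frequencies from - N to N - 1, so that sums over them are sums of the two
    halves of a series indexed by int. *)
Definition zrange N : seq int := map Posz (iota 0 N) ++ map Negz (iota 0 N).

Lemma zrange_uniq N : uniq (zrange N).
Proof.
rewrite cat_uniq !map_inj_uniq ?iota_uniq//=; [|by move=> ? ? []|by move=> ? ? []].
by rewrite andbT; apply/hasPn => x /mapP[k _ ->]; apply/negP => /mapP[].
Qed.

Lemma zrange_sub r : exists N0, forall N, (N0 <= N)%N -> {subset r <= zrange N}.
Proof.
elim: r => [|n r [N0 IH]]; first by exists 0%N.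
exists (maxn N0 (absz n).+1) => N; rewrite geq_max => /andP[h1 h2] m; rewrite inE => /orP[/eqP ->|]; last exact: IH.
rewrite mem_cat; case: n h2 => k h2.
  by apply/orP; left; apply: map_f; rewrite mem_iota.
by apply/orP; right; apply: map_f; rewrite mem_iota /= add0n ltnW.
Qed.

Lemma sum_zrange (V : zmodType) (F : int -> V) N :
  \sum_(n <- zrange N) F n = series (fun k => F (Posz k)) N + series (fun k => F (Negz k)) N.
Proof.
by rewrite big_cat /= !big_map /series /= /index_iota !subn0.
Qed.

Lemma bounded_series_cvg (u : nat -> R) (C : R) :
  (forall N, \sum_(0 <= k < N) `|u k| <= C) -> cvgn (series u).
Proof.
move=> H; apply: normed_cvg; apply: nondecreasing_is_cvgn.
  by apply: nondecreasing_series => n _ _; exact: normr_ge0.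
by exists C => _ [N _ <-]; exact: H.
Qed.

Lemma half_bessel f N : L2 0 l f -> 
  (\sum_(0 <= k < N) coef_sqr f (Posz k) <= l * \int[mu]_(x in `]0, l[) (f x ^+ 2)) /\
  (\sum_(0 <= k < N) coef_sqr f (Negz k) <= l * \int[mu]_(x in `]0, l[) (f x ^+ 2)).
Proof.
move=> Lf; have H := bessel th l0 (zrange_uniq N) Lf; rewrite sum_zrange in H.
split; apply: le_trans H; rewrite /series /=.
  by rewrite lerDl sumr_ge0// => k _; exact: coef_sqr_ge0.
by rewrite lerDr sumr_ge0// => k _; exact: coef_sqr_ge0.
Qed.

Lemma cauchy_schwarz_small f (e : R) : 0 < e -> exists2 d : R, 0 < d & forall h, L2 0 l h -> L2 0 l f ->
  \int[mu]_(x in `]0, l[) (h x ^+ 2) < d -> `|\int[mu]_(x in `]0, l[) (h x * f x)| < e.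
Proof.
move=> e0; set F := \int[mu]_(x in `]0, l[) (f x ^+ 2).
have F0 : 0 <= F by apply: Int_ge0 => x _; exact: sqr_ge0.
exists (e ^+ 2 / (F + 1)); first by rewrite divr_gt0 ?exprn_gt0//; lra.
move=> h Lh Lf H.
have CS := Int_CS Lh Lf.
have H0 : 0 <= \int[mu]_(x in `]0, l[) (h x ^+ 2) by apply: Int_ge0 => x _; exact: sqr_ge0.
have : (\int[mu]_(x in `]0, l[) (h x * f x)) ^+ 2 < e ^+ 2.
  apply: (le_lt_trans CS); rewrite -/F.
  rewrite ltr_pdivlMr in H; last by lra.
  set Q := \int[mu]_(x in _) (h x ^+ 2) in H H0 *; nra.
by move=> K; rewrite ltr_norml; apply/andP; split; nra.
Qed.

(** The projection of f converges to f in L^2, hence weakly. The second limit is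
    the imaginary part of the same pairing, which is zero because f and g are
    real. *)
Lemma pairing_sym f g : L2 0 l f -> L2 0 l g ->
  ((fun N => \sum_(n <- zrange N) (cos_coef f n * cos_coef g n + sin_coef f n * sin_coef g n)) @ \oo --> (l * \int[mu]_(x in `]0, l[) (f x * g x) : R)) /\
  ((fun N => \sum_(n <- zrange N) (sin_coef f n * cos_coef g n - cos_coef f n * sin_coef g n)) @ \oo --> (0 : R)).
Proof.
move=> Lf Lg.
have Cv N : \sum_(n <- zrange N) (cos_coef f n * cos_coef g n + sin_coef f n * sin_coef g n) =
    l * \int[mu]_(x in `]0, l[) (f x * g x) - l * \int[mu]_(x in `]0, l[) ((f x - trig_re l th (zrange N) (opt_re l th f) (opt_im l th f) x) * g x).
  rewrite -mulrBr -IntB; [|exact: L2_mul|by apply: L2_mul => //; apply: L2B => //; exact: trig_re_L2].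
  transitivity (l * \int[mu]_(x in `]0, l[) (g x * trig_re l th (zrange N) (opt_re l th f) (opt_im l th f) x)).
    rewrite Int_trig_re// mulr_sumr; apply: eq_bigr => n _; rewrite /opt_re /opt_im; field; exact: lt0r_neq0.
  by congr (_ * _); apply: eq_Int => x _; ring.
have Sv N : \sum_(n <- zrange N) (sin_coef f n * cos_coef g n - cos_coef f n * sin_coef g n) =
    - (l * \int[mu]_(x in `]0, l[) (trig_im l th (zrange N) (opt_re l th f) (opt_im l th f) x * g x)).
  transitivity (- (l * \int[mu]_(x in `]0, l[) (g x * trig_im l th (zrange N) (opt_re l th f) (opt_im l th f) x))).
    rewrite Int_trig_im// mulr_sumr -sumrN; apply: eq_bigr => n _; rewrite /opt_re /opt_im; field; exact: lt0r_neq0.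
  by congr (- (_ * _)); apply: eq_Int => x _; rewrite mulrC.
have L1 N := L2B Lf (trig_re_L2 l th (zrange N) (opt_re l th f) (opt_im l th f)).
have L2' N := trig_im_L2 l th (zrange N) (opt_re l th f) (opt_im l th f).
have small (d : R) : 0 < d -> exists N0, forall N, (N0 <= N)%N ->
   \int[mu]_(x in `]0, l[) ((f x - trig_re l th (zrange N) (opt_re l th f) (opt_im l th f) x) ^+ 2) < d /\
   \int[mu]_(x in `]0, l[) (trig_im l th (zrange N) (opt_re l th f) (opt_im l th f) x ^+ 2) < d.
  move=> d0; have [r0 u0 H] := parseval_lim Lf d0.
  have [N0 HN] := zrange_sub r0; exists N0 => N NN.
  have := H _ (zrange_uniq N) (HN _ NN); rewrite /defect IntD; [|exact: L2_sqr (L1 N)|exact: L2_sqr].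
  have : 0 <= \int[mu]_(x in `]0, l[) ((f x - trig_re l th (zrange N) (opt_re l th f) (opt_im l th f) x) ^+ 2).
    by apply: Int_ge0 => x _; exact: sqr_ge0.
  have : 0 <= \int[mu]_(x in `]0, l[) (trig_im l th (zrange N) (opt_re l th f) (opt_im l th f) x ^+ 2).
    by apply: Int_ge0 => x _; exact: sqr_ge0.
  by move=> *; split; lra.
split; apply/cvgrPdist_lt => /= e e0.
  have el : 0 < e / l by rewrite divr_gt0.
  have [d d0 Hd] := cauchy_schwarz_small g el.
  have [N0 HN] := small d d0; exists N0 => // N /= /HN[h1 _].
  rewrite Cv opprB addrC subrK normrM (gtr0_norm l0) mulrC -ltr_pdivlMr//.
  exact: Hd.
have el : 0 < e / l by rewrite divr_gt0.
have [d d0 Hd] := cauchy_schwarz_small g el.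
have [N0 HN] := small d d0; exists N0 => // N /= /HN[_ h1].
rewrite Sv sub0r opprK normrM (gtr0_norm l0) mulrC -ltr_pdivlMr//.
exact: Hd.
Qed.

Lemma pairing_bd (x y z w : R) : `|x * y + z * w| <= (x ^+ 2 + z ^+ 2 + (y ^+ 2 + w ^+ 2)).
Proof.
have := sqr_ge0 (x + y); have := sqr_ge0 (x - y); have := sqr_ge0 (z + w); have := sqr_ge0 (z - w).
have := sqr_ge0 x; have := sqr_ge0 y; have := sqr_ge0 z; have := sqr_ge0 w.
by move=> *; rewrite ler_norml; apply/andP; split; nra.
Qed.

(** Products of square-summable coefficients are absolutely summable, so that the
    two halves of the symmetric sums converge separately. *)
Lemma pairing f g : L2 0 l f -> L2 0 l g ->
  (exists l1 l2 : R, [/\ series (fun k => cos_coef f (Posz k) * cos_coef g (Posz k) + sin_coef f (Posz k) * sin_coef g (Posz k)) @ \oo --> l1,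
    series (fun k => cos_coef f (Negz k) * cos_coef g (Negz k) + sin_coef f (Negz k) * sin_coef g (Negz k)) @ \oo --> l2 &
    l1 + l2 = l * \int[mu]_(x in `]0, l[) (f x * g x)]) /\
  (exists l1 l2 : R, [/\ series (fun k => sin_coef f (Posz k) * cos_coef g (Posz k) - cos_coef f (Posz k) * sin_coef g (Posz k)) @ \oo --> l1,
    series (fun k => sin_coef f (Negz k) * cos_coef g (Negz k) - cos_coef f (Negz k) * sin_coef g (Negz k)) @ \oo --> l2 &
    l1 + l2 = 0]).
Proof.
move=> Lf Lg; have [P1 P2] := pairing_sym Lf Lg.
have K (u : int -> R) : (forall n, `|u n| <= coef_sqr f n + coef_sqr g n) ->
    cvgn (series (fun k => u (Posz k))) /\ cvgn (series (fun k => u (Negz k))).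
  move=> Hu; split; apply: (@bounded_series_cvg _ (l * \int[mu]_(x in `]0, l[) (f x ^+ 2) + l * \int[mu]_(x in `]0, l[) (g x ^+ 2))) => N.
    apply: (le_trans (ler_sum _ (fun k _ => Hu (Posz k)))); rewrite big_split /=.
    by apply: lerD; [have [] := half_bessel N Lf|have [] := half_bessel N Lg].
  apply: (le_trans (ler_sum _ (fun k _ => Hu (Negz k)))); rewrite big_split /=.
  by apply: lerD; [have [] := half_bessel N Lf|have [] := half_bessel N Lg].
have K2 (u : int -> R) (a : R) : (forall n, `|u n| <= coef_sqr f n + coef_sqr g n) ->
    (fun N => \sum_(n <- zrange N) u n) @ \oo --> a ->
    exists l1 l2 : R, [/\ series (fun k => u (Posz k)) @ \oo --> l1, series (fun k => u (Negz k)) @ \oo --> l2 & l1 + l2 = a].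
  move=> Hu; rewrite (_ : (fun N => _) = (fun N => series (fun k => u (Posz k)) N + series (fun k => u (Negz k)) N)); last first.
    by apply/funext => N; rewrite sum_zrange.
  move=> Ha; have [c1 c2] := K u Hu.
  exists (limn (series (fun k => u (Posz k)))), (limn (series (fun k => u (Negz k)))); split => //.
  apply: (cvg_unique _ _ Ha) => //; exact: cvgD.
split.
  apply: (K2 (fun n => cos_coef f n * cos_coef g n + sin_coef f n * sin_coef g n)) => // n.
  exact: pairing_bd.
apply: (K2 (fun n => sin_coef f n * cos_coef g n - cos_coef f n * sin_coef g n)) => // n.
have := pairing_bd (sin_coef f n) (cos_coef g n) (cos_coef f n) (- sin_coef g n); rewrite mulrN sqrrN => /le_trans; apply.
by rewrite /coef_sqr; lra.
Qed.

End Parseval.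

(** * Fubini, primitives and weak derivatives *)

Section Fubini.
Variable R : realType.
Local Notation mu := (@lebesgue_measure R).
Implicit Types (f g h : R -> R).

(** Both intervals are absorbed into the integrand as indicator functions, and
    Fubini's theorem is applied on the whole plane. *)
Lemma Int_Fubini (a b c d C : R) h (K : R -> R -> R) : intg a b h ->
  measurable_fun [set: (measurableTypeR R * measurableTypeR R)%type] (fun z => K z.1 z.2) ->
  (forall x y, c < x < d -> a < y < b -> `|K x y| <= C) ->
  \int[mu]_(x in `]c, d[) (\int[mu]_(y in `]a, b[) (h y * K x y)) =
  \int[mu]_(y in `]a, b[) (h y * \int[mu]_(x in `]c, d[) (K x y)).
Proof.
move=> Ih mK bK.
have [cd|dc] := ltP c d; last first.
  rewrite set_itv_ge ?bnd_simp -?leNgt// Rintegral_set0.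
  rewrite (@eq_Int _ _ _ _ (fun=> 0)) ?Int0// => y _.
  by rewrite Rintegral_set0 mulr0.
(* the integrand, extended by 0 outside the rectangle *)
pose G (z : measurableTypeR R * measurableTypeR R) : \bar R :=
  ((h \_ `]a, b[) z.2 * (K z.1 z.2 * \1_`]c, d[ z.1))%:E.
have mh : measurable_fun setT (h \_ `]a, b[).
  by apply/(measurable_restrictT _ _).1 => //; case/integrableP : Ih => /measurable_EFinP.
have mG : measurable_fun setT G.
  apply/measurable_EFinP; apply: measurable_funM; first by apply: measurableT_comp => //; exact: measurable_snd.
  apply: measurable_funM => //; apply: measurableT_comp; last exact: measurable_fst.
  exact: measurable_indic.
have Gxy x y : `]c, d[%classic x -> `]a, b[%classic y -> G (x, y) = (h y * K x y)%:E.
  by move=> cx ay; rewrite /G /patch /= mem_set// indicE mem_set// mulr1.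
have Gx0 x y : ~ `]c, d[%classic x -> G (x, y) = 0%E.
  by move=> cx; rewrite /G /= indicE memNset// !mulr0.
have Gy0 x y : ~ `]a, b[%classic y -> G (x, y) = 0%E.
  by move=> cx; rewrite /G /patch /= memNset// mul0r.
have E1 x : `]c, d[%classic x -> (\int[mu]_y G (x, y) = \int[mu]_(y in `]a, b[) (h y * K x y)%:E)%E.
  move=> cx; rewrite [RHS]integral_mkcond; apply: eq_integral => y _; rewrite patchE.
  case: ifPn => [/set_mem ay|/negP ay]; first by rewrite Gxy.
  by rewrite Gy0// => /mem_set.
have E2 y : `]a, b[%classic y -> (\int[mu]_x G (x, y) = \int[mu]_(x in `]c, d[) (h y * K x y)%:E)%E.
  move=> ay; rewrite [RHS]integral_mkcond; apply: eq_integral => x _; rewrite patchE.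
  case: ifPn => [/set_mem cx|/negP cx]; first by rewrite Gxy.
  by rewrite Gx0// => /mem_set.
have mK1 x D : measurable_fun D (K x).
  apply: measurable_funTS; rewrite (_ : K x = (fun z : measurableTypeR R * measurableTypeR R => K z.1 z.2) \o (fun y => (x, y)))//.
  by apply: measurableT_comp => //; exact: pair1_measurable.
have mK2 y D : measurable_fun D (K ^~ y).
  apply: measurable_funTS; rewrite (_ : K ^~ y = (fun z : measurableTypeR R * measurableTypeR R => K z.1 z.2) \o (fun x => (x, y)))//.
  by apply: measurableT_comp => //; exact: pair2_measurable.
have I1 x : c < x < d -> intg a b (fun y => h y * K x y).
  move=> cx; apply: (intgM_bd Ih (k := C)); last by move=> y; exact: bK.
  exact: mK1.
have I2 y : a < y < b -> intg c d (fun x => K x y).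
  move=> ay; have i1 : intg c d (fun=> 1) by apply: intg_cont; exact: cst_continuous.
  apply: (@eq_intg _ _ _ (fun x => 1 * K x y)); first by move=> x _; rewrite mul1r.
  apply: (intgM_bd i1 (k := C)); last by move=> x cx; exact: bK.
  exact: mK2.
have iG : (mu \x mu)%E.-integrable setT G.
  apply/integrable12ltyP => //=.
  apply: (@le_lt_trans _ _ (\int[mu]_(x in `]c, d[) ((C * \int[mu]_(y in `]a, b[) `|h y|)%:E))%E); last first.
    have -> : (\int[mu]_(x in `]c, d[) (C * \int[mu]_(y in `]a, b[) `|h y|)%:E)%E = ((\int[mu]_(x in `]c, d[) (C * \int[mu]_(y in `]a, b[) `|h y|))%:E)%E.
      rewrite /Rintegral fineK//; apply: integrable_fin_num => //.
      by apply: (@intg_cont _ c d (fun=> C * \int[mu]_(y in `]a, b[) `|h y|)); exact: cst_continuous.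
    by rewrite ltry.
  have -> : (\int[mu]_x \int[mu]_y `|G (x, y)| = \int[mu]_(x in `]c, d[) \int[mu]_y `|G (x, y)|)%E.
    rewrite [RHS]integral_mkcond; apply: eq_integral => x _; rewrite patchE.
    case: ifPn => // /negP cx.
    by apply: integral0_eq => y _; rewrite Gx0 ?abse0// => /mem_set.
  apply: ge0_le_integral => //=.
  - by move=> x _; apply: integral_ge0.
  - apply: measurable_funTS.
    by apply: (@measurable_fun_fubini_tonelli_F _ _ _ _ _ mu (fun z => `|G z|%E)) => //; exact: measurableT_comp.
  move=> x cx.
  have cx' : c < x < d by move: cx; rewrite in_itv.
  have -> : (\int[mu]_y `|G (x, y)| = \int[mu]_(y in `]a, b[) `|(h y * K x y)%:E|)%E.
    rewrite [RHS]integral_mkcond; apply: eq_integral => y _; rewrite patchE.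
    case: ifPn => [/set_mem ay|/negP ay]; first by rewrite Gxy.
    by rewrite Gy0 ?abse0// => /mem_set.
  have -> : (\int[mu]_(y in `]a, b[) `|(h y * K x y)%:E|)%E = (\int[mu]_(y in `]a, b[) `|h y * K x y|)%:E.
    rewrite /Rintegral fineK//; apply: integrable_fin_num => //.
    exact: (intg_norm (I1 x cx')).
  rewrite lee_fin -IntZ; last exact: intg_norm.
  apply: le_Int; [exact/intg_norm/I1|exact/intgZ/intg_norm|].
  by move=> y ay; rewrite normrM mulrC ler_wpM2r//; exact: bK.
have J1 x : c < x < d -> (\int[mu]_y G (x, y) = (\int[mu]_(y in `]a, b[) (h y * K x y))%:E)%E.
  move=> cx; rewrite E1 /= ?in_itv// /Rintegral fineK//; apply: integrable_fin_num => //; exact: I1.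
have J2 y : a < y < b -> (\int[mu]_x G (x, y) = (h y * \int[mu]_(x in `]c, d[) K x y)%:E)%E.
  move=> ay; rewrite E2 /= ?in_itv// -IntZ; last exact: I2.
  by rewrite /Rintegral fineK//; apply: integrable_fin_num => //; exact/intgZ/I2.
have F := Fubini iG.
transitivity (fine (\int[mu]_x \int[mu]_y G (x, y))%E).
  congr fine; rewrite [LHS]integral_mkcond; apply: eq_integral => x _; rewrite patchE.
  case: ifPn => [/set_mem|/negP cx]; first by rewrite /= in_itv /= => /J1 ->.
  by apply/esym; apply: integral0_eq => y _; apply: Gx0 => /mem_set /cx.
rewrite F; congr fine; rewrite [RHS]integral_mkcond; apply: eq_integral => y _; rewrite patchE.
case: ifPn => [/set_mem|/negP cx]; first by rewrite /= in_itv /= => /J2 ->.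
by apply: integral0_eq => x _; apply: Gy0 => /mem_set /cx.
Qed.

End Fubini.

Section Primitive.
Variable R : realType.
Local Notation mu := (@lebesgue_measure R).
Implicit Types (f g h k : R -> R).

Definition prim f x := \int[mu]_(s in `]0, x[) f s - \int[mu]_(s in `]x, 0[) f s.

Lemma primB f x y : (forall a b, intg a b f) -> x <= y -> prim f y - prim f x = \int[mu]_(s in `]x, y[) f s.
Proof.
move=> If xy.
have Z (u v : R) : v <= u -> \int[mu]_(s in `]u, v[) f s = 0.
  by move=> vu; rewrite set_itv_ge ?Rintegral_set0// bnd_simp -leNgt.
rewrite /prim; have [x0|x0] := leP 0 x.
  rewrite (Z y 0) ?(Z x 0)// ?(le_trans x0)// !subr0.
  by rewrite (Int_cat x0 xy)//; ring.
have [y0|y0] := leP 0 y.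
  rewrite (Z y 0)// (Z 0 x) ?(ltW x0)// sub0r opprK subr0 addrC.
  by rewrite -(Int_cat (ltW x0) y0).
rewrite (Z 0 x) ?(ltW x0)// (Z 0 y) ?(ltW y0)// !sub0r opprK addrC.
by rewrite (Int_cat xy (ltW y0))//; ring.
Qed.

Lemma is_derive_prim f (x : R) : continuous f -> is_derive x 1 (prim f) (f x).
Proof.
move=> cf; have If a b : intg a b f by exact: intg_cont.
pose A := x - 1.
have I' a b : mu.-integrable `[a, b] (EFin \o f).
  apply: continuous_compact_integrable; first exact: segment_compact.
  by apply: continuous_subspaceT.
have Ax : A < x by rewrite /A; lra.
have xx : x < x + 1 by lra.
have [D1 D2] := @continuous_FTC1 R f (BLeft A) x (x + 1) xx (I' _ _) Ax (cf x).
have D : is_derive x 1 (fun y => \int[mu]_(t in `[A, y]) f t) (f x).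
  by apply: DeriveDef; [exact: D1|rewrite -derive1E; exact: D2].
have D' : is_derive x 1 (fun y => prim f A + \int[mu]_(t in `[A, y]) f t) (f x).
  by have := is_deriveD (is_derive_cst (prim f A) x 1) D; rewrite add0r.
apply: near_eq_is_derive D'; near=> y.
have Ay : A < y.
  near: y; apply/nbhs_ballP; exists 1 => //= z; rewrite /ball /= ltr_norml /A => /andP[_ ?]; lra.
have -> : \int[mu]_(t in `[A, y]) f t = \int[mu]_(t in `]A, y[) f t.
  rewrite Rintegral_itv_obnd_cbnd; last exact: If.
  rewrite Rintegral_itv_bndo_bndc//.
  by apply: integrableS (I' A y) => //=; apply: subset_itvl; rewrite bnd_simp.
by rewrite -(primB If (ltW Ay)) addrC subrK.
Unshelve. all: by end_near. Qed.

Lemma Int_eq0_cont f a b : continuous f -> (forall x, a < x < b -> 0 <= f x) ->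
  \int[mu]_(x in `]a, b[) f x = 0 -> forall x, a < x < b -> f x = 0.
Proof.
move=> cf f0 I0 x /andP[ax xb]; apply/eqP; rewrite eq_le f0 ?ax// andbT leNgt; apply/negP => fx.
have If c d : intg c d f by exact: intg_cont.
have fx2 : 0 < f x / 2 by lra.
move/cvgrPdist_lt : (cf x) => /(_ _ fx2)/nbhs_ballP[e /= e0 He].
pose d := Num.min e (Num.min (x - a) (b - x)).
have d0 : 0 < d by rewrite !lt_min e0 !subr_gt0 ax.
have de : d <= e by rewrite ge_min lexx.
have da : d <= x - a by rewrite !ge_min lexx orbT.
have db : d <= b - x by rewrite !ge_min lexx !orbT.
have h1 : a <= x - d / 2 by lra.
have h2 : x - d / 2 <= x by lra.
have h3 : x <= b by exact: ltW.
move: I0; rewrite (Int_cat (le_trans h1 h2) h3)// (Int_cat h1 h2)//.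
have p1 : 0 <= \int[mu]_(y in `]a, x - d / 2[) f y.
  by apply: Int_ge0 => y /andP[? ?]; apply: f0; apply/andP; split; lra.
have p2 : 0 <= \int[mu]_(y in `]x, b[) f y.
  by apply: Int_ge0 => y /andP[? ?]; apply: f0; apply/andP; split; lra.
have p3 : (f x / 2) * (x - (x - d / 2)) <= \int[mu]_(y in `]x - d / 2, x[) f y.
  rewrite -(Int_cst _ h2); apply: le_Int => //; first by apply: intg_cont; exact: cst_continuous.
  move=> y /andP[? ?]; have : ball x e y.
    by rewrite /ball /= ger0_norm; lra.
  by move/He => /=; rewrite ltr_norml => /andP[? ?]; lra.
have : 0 < f x / 2 * (x - (x - d / 2)) by apply: mulr_gt0 => //; lra.
lra.
Qed.

(** Fubini on the triangle y < x: the primitive of the integrable g need not be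
    differentiable. *)
Lemma Int_by_parts (a b : R) g (k k' : R -> R) : a <= b -> intg a b g ->
  (forall x : R, is_derive x 1 k (k' x)) -> continuous k' ->
  \int[mu]_(x in `]a, b[) ((\int[mu]_(y in `]a, x[) g y) * k' x) =
  (\int[mu]_(y in `]a, b[) g y) * k b - \int[mu]_(x in `]a, b[) (g x * k x).
Proof.
move=> ab Ig dk ck'.
have ck := is_derive_cont dk.
have [C HC] := cont_bd a b ck'.
pose K x y := k' x * (if y < x then 1 else 0).
have E1 (x : R) : a < x < b -> (\int[mu]_(y in `]a, x[) g y) * k' x = \int[mu]_(y in `]a, b[) (g y * K x y).
  move=> /andP[ax xb]; rewrite (Int_cat (ltW ax) (ltW xb)); last first.
    apply: (intgM_bd Ig (k := C)).
      apply: measurable_funTS; apply: measurable_funM; first exact: measurable_cst.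
      by apply: measurable_fun_ifT => //; exact: measurable_fun_ltr.
    move=> y _; rewrite /K; case: ifP => _; rewrite ?mulr1 ?mulr0 ?normr0; first by apply: HC; rewrite !ltW.
    apply: (le_trans (normr_ge0 (k' x))); apply: HC; by rewrite !ltW.
  rewrite [X in _ = _ + X](@eq_Int _ _ _ _ (fun=> 0)); last first.
    by move=> y /andP[xy _]; rewrite /K ltNge (ltW xy) mulr0 mulr0.
  rewrite Int0 addr0 mulrC -IntZ; last exact: intgS (lexx _) (ltW xb) Ig.
  by apply: eq_Int => y /andP[_ yx]; rewrite /K yx mulr1 mulrC.
rewrite (eq_Int E1) (@Int_Fubini _ _ _ _ _ C)//; last 2 first.
- apply: measurable_funM.
    apply: measurableT_comp; last exact: measurable_fst.
    exact: continuous_measurable_fun.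
  apply: measurable_fun_ifT => //; apply: measurable_fun_ltr; [exact: measurable_snd|exact: measurable_fst].
- move=> x y /andP[ax xb] _; rewrite /K; case: ifP => _; rewrite ?mulr1 ?mulr0 ?normr0; first by apply: HC; rewrite !ltW.
  apply: (le_trans (normr_ge0 (k' x))); apply: HC; by rewrite !ltW.
rewrite [in RHS]mulrC -IntZ// -IntB; [|exact: intgZ|exact: intgM_cont].
apply: eq_Int => y /andP[ay yb].
have ic : intg a b (fun x => K x y).
  apply: (intgM_bd (intg_cont a b ck') (k := 1)).
    apply: measurable_funTS; apply: measurable_fun_ifT => //; exact: measurable_fun_ltr.
  by move=> x _; case: ifP => _; rewrite ?normr1 ?normr0.
rewrite (Int_cat (ltW ay) (ltW yb) ic) [X in X + _](@eq_Int _ _ _ _ (fun=> 0)); last first.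
  by move=> x /andP[_ xy]; rewrite /K ltNge (ltW xy) mulr0.
rewrite Int0 add0r (@eq_Int _ _ _ _ k'); last by move=> x /andP[yx _]; rewrite /K yx mulr1.
by rewrite (Int_FTC (ltW yb) dk ck'); ring.
Qed.

End Primitive.

Section Weak.
Variable R : realType.
Local Notation mu := (@lebesgue_measure R).
Implicit Types (f g h k w wx psi : R -> R).

(** Let om be a bump that vanishes outside ]c, d[ and m the mean of G with weight
    om. The primitive of eta = (G - m) om is a test function, and testing with it
    gives int (G - m)^2 om = 0. Clamping to [c, d] makes G continuous on the
    line. *)
Lemma du_bois_reymond_sub (a b c d : R) (G : R -> R) : a < c -> c < d -> d < b ->
  (forall x, a < x < b -> {for x, continuous G}) ->
  (forall psi, test1 a b psi -> \int[mu]_(x in `]a, b[) (G x * derive1 psi x) = 0) ->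
  exists m : R, forall x, c < x < d -> G x = m.
Proof.
move=> ac cd db cG HG.
pose cl := clamp c d.
have ccl : continuous cl := clamp_cont (ltW cd).
have clcd x : c <= cl x <= d := clamp_bd x (ltW cd).
have cl_id x : c <= x <= d -> cl x = x by exact: clamp_id.
pose Gt x := G (cl x).
have cGt : continuous Gt.
  move=> x; apply: (@continuous_comp _ _ _ cl G); first exact: ccl.
  by apply: cG; have /andP[? ?] := clcd x; apply/andP; split; lra.
pose om x := (cl x - c) * (d - cl x).
have com : continuous om.
  move=> x; apply: cvgM; apply: cvgB; [exact: ccl|exact: cvg_cst|exact: cvg_cst|exact: ccl].
have om0 x : ~~ (c < x < d) -> om x = 0.
  rewrite negb_and -!leNgt /om /cl /clamp => H.
  case: (ltP x c) => h1; first by rewrite subrr mul0r.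
  case: (ltP d x) => h2; first by rewrite subrr mulr0.
  case/orP: H => H; first by rewrite (_ : x - c = 0) ?mul0r//; lra.
  by rewrite (_ : d - x = 0) ?mulr0//; lra.
have omp x : c < x < d -> 0 < om x.
  move=> /andP[? ?]; rewrite /om cl_id; last by apply/andP; split; lra.
  by apply: mulr_gt0; lra.
have om_ge0 x : 0 <= om x.
  by have [/omp/ltW//|/om0 ->] := boolP (c < x < d).
have io : intg c d om by exact: intg_cont.
have cGo : continuous (fun x => Gt x * om x) by move=> x; apply: cvgM; [exact: cGt|exact: com].
have iGo : intg c d (fun x => Gt x * om x) by exact: intg_cont.
set I := \int[mu]_(x in `]c, d[) om x.
have Ip : I != 0.
  apply/eqP => I0.
  have hm : c < (c + d) / 2 < d by apply/andP; split; lra.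
  have := Int_eq0_cont com (fun x _ => om_ge0 x) I0 hm; by move/eqP; rewrite gt_eqF// omp.
pose m := (\int[mu]_(x in `]c, d[) (Gt x * om x)) / I.
pose eta x := (Gt x - m) * om x.
have ceta : continuous eta.
  by move=> x; apply: cvgM; [apply: cvgB; [exact: cGt|exact: cvg_cst]|exact: com].
have ie u v : intg u v eta by exact: intg_cont.
have eta0 x : ~~ (c < x < d) -> eta x = 0 by move=> /om0; rewrite /eta => ->; rewrite mulr0.
have Ieta : \int[mu]_(x in `]c, d[) eta x = 0.
  transitivity (\int[mu]_(x in `]c, d[) (Gt x * om x - m * om x)); first by apply: eq_Int => x _; rewrite /eta mulrBl.
  rewrite IntB//; last exact: intgZ.
  by rewrite IntZ// /m divfK// subrr.
pose psi x := prim eta x - prim eta c.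
have dpsi (x : R) : is_derive x 1 psi (eta x).
  by have := is_deriveB (is_derive_prim x ceta) (is_derive_cst (prim eta c) x 1); rewrite subr0.
have tpsi : test1 a b psi.
  split.
  - by move=> x; have [] := dpsi x.
  - by rewrite (_ : derive1 psi = eta)//; apply/funext => x; rewrite derive1E; apply: derive_val.
  - exists c, d; split => // x; rewrite negb_and -!ltNge => /orP[xc|dx].
      rewrite /psi -opprB (primB ie (ltW xc)) (@eq_Int _ _ _ _ (fun=> 0)) ?Int0 ?oppr0// => y /andP[_ yc].
      by apply: eta0; rewrite negb_and -leNgt (ltW yc).
    rewrite /psi (primB ie (ltW (lt_trans cd dx))) (Int_cat (ltW cd) (ltW dx))// Ieta add0r.
    rewrite (@eq_Int _ _ _ _ (fun=> 0)) ?Int0// => y /andP[dy _].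
    by apply: eta0; rewrite negb_and -!leNgt (ltW dy) orbT.
have := HG _ tpsi.
rewrite (@eq_Int _ _ _ _ (fun x => Gt x * eta x)); last first.
  move=> x _; rewrite derive1E derive_val.
  have [/andP[? ?]|xcd] := boolP (c < x < d); last by rewrite eta0// !mulr0.
  by rewrite /Gt cl_id//; apply/andP; split; lra.
have cGe : continuous (fun x => Gt x * eta x) by move=> x; apply: cvgM; [exact: cGt|exact: ceta].
rewrite (Int_cat (ltW ac) (ltW (lt_trans cd db))); last exact: intg_cont.
rewrite (Int_cat (ltW cd) (ltW db)); last exact: intg_cont.
rewrite [X in X + _](@eq_Int _ _ _ _ (fun=> 0)); last first.
  by move=> x /andP[_ xc]; rewrite eta0 ?mulr0// negb_and -leNgt (ltW xc).
rewrite [X in _ + (_ + X)](@eq_Int _ _ _ _ (fun=> 0)); last first.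
  by move=> x /andP[dx _]; rewrite eta0 ?mulr0// negb_and -!leNgt (ltW dx) orbT.
rewrite !Int0 add0r addr0 => IG.
have cS : continuous (fun x => (Gt x - m) * eta x).
  by move=> x; apply: cvgM; [apply: cvgB; [exact: cGt|exact: cvg_cst]|exact: ceta].
have IS : \int[mu]_(x in `]c, d[) ((Gt x - m) * eta x) = 0.
  transitivity (\int[mu]_(x in `]c, d[) (Gt x * eta x - m * eta x)); first by apply: eq_Int => x _; rewrite mulrBl.
  rewrite IntB; [|exact: intg_cont|exact: intgZ].
  by rewrite IG IntZ// Ieta mulr0 subrr.
have S0 x : c < x < d -> 0 <= (Gt x - m) * eta x.
  by move=> _; rewrite /eta mulrA -expr2 mulr_ge0// sqr_ge0.
exists m => x xcd; have := Int_eq0_cont cS S0 IS xcd.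
have /andP[cx xd] := xcd.
move/eqP; rewrite /eta mulrA -expr2 mulf_eq0 sqrf_eq0 subr_eq0 /Gt cl_id ?ltW//.
by move/orP => [/eqP//|]; rewrite gt_eqF// omp.
Qed.

Lemma du_bois_reymond (a b : R) (G : R -> R) :
  (forall x, a < x < b -> {for x, continuous G}) ->
  (forall psi, test1 a b psi -> \int[mu]_(x in `]a, b[) (G x * derive1 psi x) = 0) ->
  forall x y, a < x < b -> a < y < b -> G x = G y.
Proof.
move=> cG HG x y /andP[ax xb] /andP[ay yb].
pose c := (a + Num.min x y) / 2; pose d := (b + Num.max x y) / 2.
have m1 : Num.min x y <= x by rewrite ge_min lexx.
have m2 : Num.min x y <= y by rewrite ge_min lexx orbT.
have m3 : a < Num.min x y by rewrite lt_min ax.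
have m4 : x <= Num.max x y by rewrite le_max lexx.
have m5 : y <= Num.max x y by rewrite le_max lexx orbT.
have m6 : Num.max x y < b by rewrite gt_max xb.
have [m Hm] := @du_bois_reymond_sub a b c d G ltac:(rewrite /c; lra) ltac:(rewrite /c /d; lra) ltac:(rewrite /d; lra) cG HG.
by rewrite !Hm// /c /d; apply/andP; split; lra.
Qed.

Lemma Int_prim_cont (a b : R) g : a <= b -> intg a b g -> {within `[a, b], continuous (fun x => \int[mu]_(y in `]a, x[) g y)}.
Proof.
move=> ab Ig.
pose g1 := g \_ `]a, b[.
have I1 : mu.-integrable setT (EFin \o g1).
  by rewrite -restrict_EFin; apply/(integrable_mkcond _ _).1.
have I : mu.-integrable `[a, b] (EFin \o g1) by apply: integrableS I1.
have := parameterized_integral_continuous ab I.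
apply: subspace_eq_continuous => x /set_mem; rewrite /= in_itv /= => /andP[ax xb].
change (\int[mu]_(y in `[a, x]) g1 y = \int[mu]_(y in `]a, x[) g y).
rewrite -Rintegral_itv_bndo_bndc; last by apply: integrableS I1.
rewrite -Rintegral_itv_obnd_cbnd; last by apply: integrableS I1.
apply: eq_Int => y /andP[ay yx]; rewrite /g1 patchE mem_set//= in_itv /= ay; exact: lt_le_trans xb.
Qed.

(** The difference of w and the primitive of wx has a zero weak derivative. *)
Lemma weak_derivative_AC (a b : R) w wx : a < b ->
  (forall x, a < x < b -> {for x, continuous w}) -> intg a b w -> intg a b wx ->
  weak_derivative a b w wx ->
  exists m, forall x, a < x < b -> w x = m + \int[mu]_(y in `]a, x[) wx y.
Proof.
move=> ab cw Iw Iwx H.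
pose W x := \int[mu]_(y in `]a, x[) wx y.
have /(continuous_within_itvP _ ab)[cW _ _] := Int_prim_cont (ltW ab) Iwx.
have iW psi' : continuous psi' -> intg a b (fun x => W x * psi' x).
  move=> cp; apply: intgM_cont => //.
  have : mu.-integrable `[a, b] (EFin \o W).
    apply: continuous_compact_integrable; [exact: segment_compact|exact: Int_prim_cont (ltW ab) Iwx].
  by apply: integrableS => //=; apply: subset_itvW.
have E x y : a < x < b -> a < y < b -> w x - W x = w y - W y.
  apply: (@du_bois_reymond a b (fun x => w x - W x)).
    by move=> z zab; apply: cvgB; [exact: cw|apply: cW; rewrite in_itv].
  move=> psi tpsi; have [dpsi cpsi [c [d [ac db psi0]]]] := tpsi.
  transitivity (\int[mu]_(x in `]a, b[) (w x * derive1 psi x - W x * derive1 psi x)).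
    by apply: eq_Int => z _; rewrite mulrBl.
  rewrite IntB; [|exact: intgM_cont|exact: iW].
  have dp (z : R) : is_derive z 1 psi (derive1 psi z).
    by rewrite derive1E; apply: DeriveDef; first exact: dpsi.
  rewrite H// (Int_by_parts (ltW ab) Iwx dp cpsi) psi0; last by rewrite negb_and -!ltNge db orbT.
  by rewrite mulr0 sub0r subrr.
pose z := (a + b) / 2.
have zab : a < z < b by rewrite /z; apply/andP; split; lra.
by exists (w z - W z) => x xab; rewrite -(E x z)// subrK.
Qed.

(** The identity inside the interval reaches the end points by continuity. *)
Lemma H1_AC (a b : R) w wx : a < b -> H1 a b w wx ->
  forall x, a <= x <= b -> w x = w a + \int[mu]_(y in `]a, x[) wx y.
Proof.
move=> ab [cw Lw Lwx H].
have /(continuous_within_itvP _ ab)[cwi cwa cwb] := cw.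
have Iwx := L2_intg Lwx.
have [|m Hm] := @weak_derivative_AC a b w wx ab _ (L2_intg Lw) Iwx H.
  by move=> x xab; apply: cwi; rewrite in_itv.
have /(continuous_within_itvP _ ab)[cWi cWa cWb] := Int_prim_cont (ltW ab) Iwx.
set W := (fun x => \int[mu]_(y in `]a, x[) wx y) in cWi cWa cWb *.
have Ea : w a = m + W a.
  apply: (@cvg_unique _ _ (w x @[x --> a^'+])) => //.
  have : m + W x @[x --> a^'+] --> m + W a by apply: cvgD => //; exact: cvg_cst.
  apply: cvg_trans; apply: near_eq_cvg; near=> x; rewrite Hm//.
  by apply/andP; split; near: x; [exact: nbhs_right_gt|exact: nbhs_right_lt].
have Eb : w b = m + W b.
  apply: (@cvg_unique _ _ (w x @[x --> b^'-])) => //.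
  have : m + W x @[x --> b^'-] --> m + W b by apply: cvgD => //; exact: cvg_cst.
  apply: cvg_trans; apply: near_eq_cvg; near=> x; rewrite Hm//.
  by apply/andP; split; near: x; [exact: nbhs_left_gt|exact: nbhs_left_lt].
have Wa0 : W a = 0 by rewrite /W Int_point.
move=> x; rewrite !le_eqVlt => /andP[/orP[/eqP <-|ax] xb]; first by rewrite Int_point addr0.
by case/orP: xb => [/eqP ->|xb]; [rewrite Eb Ea Wa0 addr0|rewrite Hm ?ax// Ea Wa0 addr0].
Unshelve. all: by end_near. Qed.

Lemma H1_by_parts (a b : R) w wx (k k' : R -> R) : a < b -> H1 a b w wx ->
  (forall x : R, is_derive x 1 k (k' x)) -> continuous k' ->
  \int[mu]_(x in `]a, b[) (wx x * k x) = w b * k b - w a * k a - \int[mu]_(x in `]a, b[) (w x * k' x).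
Proof.
move=> ab H dk ck'; have AC := H1_AC ab H.
have [cw Lw Lwx _] := H; have Iwx := L2_intg Lwx.
have P := Int_by_parts (ltW ab) Iwx dk ck'.
have E : \int[mu]_(x in `]a, b[) (w x * k' x) =
    w a * (k b - k a) + \int[mu]_(x in `]a, b[) ((\int[mu]_(y in `]a, x[) wx y) * k' x).
  rewrite -(Int_FTC (ltW ab) dk ck') -IntZ; last exact: intg_cont.
  rewrite -IntD; [|exact/intgZ/intg_cont|].
    by apply: eq_Int => x /andP[ax xb]; rewrite {1}(AC x (introT andP (conj (ltW ax) (ltW xb)))) mulrDl.
  apply: (@eq_intg _ a b (fun x => w x * k' x - w a * k' x)).
    move=> x /andP[ax xb]; rewrite {1}(AC x (introT andP (conj (ltW ax) (ltW xb)))); ring.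
  by apply: intgB; [exact: intgM_cont (L2_intg Lw) ck'|exact/intgZ/intg_cont].
rewrite E P [in w b * _]AC ?lexx ?ltW//; ring.
Qed.

(** The primitive starts from the right end, where the elements of H_b vanish. *)
Lemma weak_derivative_prim (a b : R) g : a <= b -> intg a b g ->
  weak_derivative a b (fun x => - \int[mu]_(y in `]x, b[) g y) g.
Proof.
move=> ab Ig psi [dpsi cpsi [c [d [ac db psi0]]]].
have dp (z : R) : is_derive z 1 psi (derive1 psi z).
  by rewrite derive1E; apply: DeriveDef; first exact: dpsi.
set I := \int[mu]_(y in `]a, b[) g y.
have E : \int[mu]_(x in `]a, b[) ((- \int[mu]_(y in `]x, b[) g y) * derive1 psi x) =
  \int[mu]_(x in `]a, b[) ((\int[mu]_(y in `]a, x[) g y) * derive1 psi x) - I * \int[mu]_(x in `]a, b[) derive1 psi x.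
  rewrite -IntZ; last exact: intg_cont.
  rewrite -IntB; [| |exact/intgZ/intg_cont].
    by apply: eq_Int => x /andP[ax xb]; rewrite /I (Int_cat (ltW ax) (ltW xb) Ig); ring.
  apply: intgM_cont => //.
  have : mu.-integrable `[a, b] (EFin \o (fun x => \int[mu]_(y in `]a, x[) g y)).
    apply: continuous_compact_integrable; [exact: segment_compact|exact: Int_prim_cont].
  by apply: integrableS => //=; apply: subset_itvW.
rewrite E (Int_by_parts ab Ig dp cpsi) (Int_FTC ab dp cpsi).
have -> : psi b = 0 by apply: psi0; rewrite negb_and -!ltNge db orbT.
have -> : psi a = 0 by apply: psi0; rewrite negb_and -!ltNge ac.
by rewrite subrr !mulr0 subr0 sub0r.
Qed.

End Weak.

(** * Reflection and unfolding *)

Section Shift.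
Variable R : realType.
Local Notation mu := (@lebesgue_measure R).
Implicit Types (f g : R -> R).

Lemma affl1 (d a b : R) : affl 1 d a b = a + d.
Proof. by rewrite /affl ltr01 mul1r. Qed.
Lemma affr1 (d a b : R) : affr 1 d a b = b + d.
Proof. by rewrite /affr ltr01 mul1r. Qed.

Lemma intg_shift (a b d : R) f : intg (a + d) (b + d) f -> intg a b (fun y => f (y + d)).
Proof.
move=> If; have := @intg_affine R a b 1 d f (oner_neq0 _).
by rewrite affl1 affr1 => /(_ If); apply: eq_intg => x _; rewrite mul1r.
Qed.

Lemma L2_shift (a b d : R) f : L2 (a + d) (b + d) f -> L2 a b (fun y => f (y + d)).
Proof.
move=> If; have := @L2_affine R a b 1 d f (oner_neq0 _).
by rewrite affl1 affr1 => /(_ If); apply: eq_L2 => x _; rewrite mul1r.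
Qed.

Lemma Int_shift (a b d : R) f : intg (a + d) (b + d) f ->
  \int[mu]_(x in `]a + d, b + d[) f x = \int[mu]_(y in `]a, b[) f (y + d).
Proof.
move=> If; have := @Int_affine R a b 1 d f (oner_neq0 _).
rewrite affl1 affr1 => /(_ If) ->; rewrite normr1 mul1r.
by apply: eq_Int => x _; rewrite mul1r.
Qed.

Lemma scale_ends (c b : R) : 0 < c -> affl c 0 0 b = 0 /\ affr c 0 0 b = c * b.
Proof. by move=> c0; rewrite /affl /affr c0 mulr0 !addr0. Qed.

Lemma intg_scale (c b : R) f : 0 < c -> intg 0 (c * b) f -> intg 0 b (fun y => f (c * y)).
Proof.
move=> c0 If; have [E1 E2] := scale_ends b c0.
have := @intg_affine R 0 b c 0 f (lt0r_neq0 c0).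
by rewrite E1 E2 => /(_ If); apply: eq_intg => x _; rewrite addr0.
Qed.

Lemma Int_scale (c b : R) f : 0 < c -> intg 0 (c * b) f ->
  \int[mu]_(x in `]0, c * b[) f x = c * \int[mu]_(y in `]0, b[) f (c * y).
Proof.
move=> c0 If; have [E1 E2] := scale_ends b c0.
have := @Int_affine R 0 b c 0 f (lt0r_neq0 c0).
rewrite E1 E2 => /(_ If) ->; rewrite gtr0_norm//.
by congr (_ * _); apply: eq_Int => x _; rewrite addr0.
Qed.

Lemma affl_neg (g e a b : R) : 0 < g -> affl (- g) e a b = e - g * b.
Proof. by move=> g0; rewrite /affl oppr_gt0 ltNge (ltW g0) /= mulNr addrC. Qed.
Lemma affr_neg (g e a b : R) : 0 < g -> affr (- g) e a b = e - g * a.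
Proof. by move=> g0; rewrite /affr oppr_gt0 ltNge (ltW g0) /= mulNr addrC. Qed.

Lemma intg_refl (g e a b : R) f : 0 < g -> intg (e - g * b) (e - g * a) f ->
  intg a b (fun y => f (e - g * y)).
Proof.
move=> g0 If; have gn : - g != 0 by rewrite oppr_eq0 gt_eqF.
have := @intg_affine R a b (- g) e f gn.
rewrite affl_neg// affr_neg// => /(_ If); apply: eq_intg => x _; by rewrite mulNr addrC.
Qed.

Lemma L2_refl (g e a b : R) f : 0 < g -> L2 (e - g * b) (e - g * a) f ->
  L2 a b (fun y => f (e - g * y)).
Proof.
move=> g0 If; have gn : - g != 0 by rewrite oppr_eq0 gt_eqF.
have := @L2_affine R a b (- g) e f gn.
rewrite affl_neg// affr_neg// => /(_ If); apply: eq_L2 => x _; by rewrite mulNr addrC.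
Qed.

Lemma Int_refl (g e a b : R) f : 0 < g -> intg (e - g * b) (e - g * a) f ->
  \int[mu]_(x in `]e - g * b, e - g * a[) f x = g * \int[mu]_(y in `]a, b[) f (e - g * y).
Proof.
move=> g0 If; have gn : - g != 0 by rewrite oppr_eq0 gt_eqF.
have := @Int_affine R a b (- g) e f gn.
rewrite affl_neg// affr_neg// => /(_ If) ->; rewrite normrN (gtr0_norm g0); congr (_ * _).
by apply: eq_Int => x _; rewrite mulNr addrC.
Qed.

End Shift.

Section Unfold.
Variable R : realType.
Local Notation mu := (@lebesgue_measure R).
Variables (L v : R).
Hypotheses (L0 : 0 < L) (v0 : 0 <= v) (v1 : v < 1).
Implicit Types (f g a b q : R -> R).
Local Notation g := (gamma_v v).
Local Notation M := (L_2 L v).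

Lemma gamma_v_gt0 : 0 < g. Proof. by rewrite divr_gt0 ?subr_gt0 ?ltr_wpDr. Qed.
Lemma gamma_vM : g * (1 - v) = 1 + v.
Proof. by rewrite /gamma_v divfK// subr_eq0 eq_sym lt_eqF. Qed.
Lemma L_2_gt0 : 0 < M. Proof. by rewrite divr_gt0 ?subr_gt0 ?mulr_gt0. Qed.
Lemma L_2E : M - g * L = L.
Proof. by rewrite /L_2 /gamma_v; field; rewrite subr_eq0 eq_sym lt_eqF. Qed.
Lemma L_2_gtL : L < M.
Proof. by have := L_2E; have := mulr_gt0 gamma_v_gt0 L0; lra. Qed.

(** The reflection z = M - g y maps ]0, L[ onto ]L, M[. Across L the function a is
    continued evenly and b oddly, with the Jacobian factor 1 / g. *)
Definition unfold a b (z : R) := if z < L then a z + b z else (a ((M - z) / g) - b ((M - z) / g)) / g.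

Lemma unfold_right a b y : 0 < y < L -> unfold a b (M - g * y) = (a y - b y) / g.
Proof.
move=> /andP[y0 yL]; rewrite /unfold.
have -> : (M - g * y < L) = false.
  by apply/negbTE; rewrite -leNgt -[leLHS]L_2E lerD2l lerN2 ler_pM2l ?gamma_v_gt0// ltW.
have -> : (M - (M - g * y)) / g = y by field; rewrite gt_eqF ?gamma_v_gt0.
by [].
Qed.

Lemma unfold_left a b y : y < L -> unfold a b y = a y + b y.
Proof. by rewrite /unfold => ->. Qed.

Lemma unfold_L2 a b : L2 0 L a -> L2 0 L b -> L2 0 M (unfold a b).
Proof.
move=> La Lb; have g0 := gamma_v_gt0.
apply: (@L2_cat _ 0 L M).
  by apply: eq_L2 (L2D La Lb) => x /andP[_ xL]; rewrite unfold_left.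
have E1 : M / g - g^-1 * M = 0 by rewrite mulrC subrr.
have E2 : M / g - g^-1 * L = L.
  have -> : M = L + g * L by have := L_2E; lra.
  by field; rewrite gt_eqF.
have gi : 0 < g^-1 by rewrite invr_gt0.
have Lr f : L2 0 L f -> L2 L M (fun z => f ((M - z) / g)).
  move=> Lf; have := @L2_refl R g^-1 (M / g) L M f gi; rewrite E1 E2 => /(_ Lf).
  by apply: eq_L2 => x _; congr f; rewrite mulrBl mulrC [x / g]mulrC mulrC.
apply: (eq_L2 (f := fun z => g^-1 * (a ((M - z) / g) - b ((M - z) / g)))).
  by move=> x /andP[Lx _]; rewrite /unfold ltNge (ltW Lx) /= mulrC.
by apply: L2Z; apply: L2B; exact: Lr.
Qed.

Lemma Int_unfold a b q : L2 0 L a -> L2 0 L b -> continuous q ->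
  \int[mu]_(z in `]0, M[) (unfold a b z * q z) =
  \int[mu]_(y in `]0, L[) (a y * (q y + q (M - g * y))) + \int[mu]_(y in `]0, L[) (b y * (q y - q (M - g * y))).
Proof.
move=> La Lb cq; have g0 := gamma_v_gt0.
have Iu : intg 0 M (fun z => unfold a b z * q z) by apply: intgM_cont => //; exact: L2_intg (unfold_L2 La Lb).
have cr : continuous (fun y : R => q (M - g * y)).
  move=> y; apply: (@continuous_comp _ _ _ (fun y : R => M - g * y) q); last exact: cq.
  by apply: cvgB; [exact: cvg_cst|exact: mulrl_continuous].
rewrite (Int_cat (ltW L0) (ltW L_2_gtL) Iu).
have -> : \int[mu]_(z in `]L, M[) (unfold a b z * q z) = \int[mu]_(y in `]0, L[) ((a y - b y) * q (M - g * y)).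
  have E0 : M - g * 0 = M by rewrite mulr0 subr0.
  have := @Int_refl R g M 0 L (fun z => unfold a b z * q z) g0; rewrite L_2E E0 => ->; last first.
    exact: intgS (ltW L0) (lexx _) Iu.
  have I1 : intg 0 L (fun y => unfold a b (M - g * y) * q (M - g * y)).
    apply: (@intg_refl R g M 0 L (fun z => unfold a b z * q z)) => //.
    by rewrite L_2E E0; apply: intgS (ltW L0) (lexx _) Iu.
  rewrite -IntZ//; apply: eq_Int => y y0L; rewrite unfold_right//; field; by rewrite gt_eqF.
have Ia := L2_intg La; have Ib := L2_intg Lb.
have j1 f k : intg 0 L f -> continuous k -> intg 0 L (fun y => f y * k y) by exact: intgM_cont.
rewrite [X in X + _ = _](@eq_Int _ _ _ _ (fun y => (a y + b y) * q y)); last first.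
  by move=> y /andP[_ yL]; rewrite unfold_left.
rewrite -IntD; [|apply: intgM_cont => //; exact: intgD|apply: intgM_cont => //; exact: intgB].
rewrite -IntD; last 2 first.
- by apply: intgM_cont => // y; apply: cvgD; [exact: cq|exact: cr].
- by apply: intgM_cont => // y; apply: cvgB; [exact: cq|exact: cr].
by apply: eq_Int => y _; ring.
Qed.

(** The reflection exchanges the two halves of this interval, and the odd part
    cancels. *)
Lemma Int_unfold_mid a b y : L2 0 L a -> L2 0 L b -> 0 <= y <= L ->
  \int[mu]_(z in `]y, M - g * y[) unfold a b z = 2 * \int[mu]_(s in `]y, L[) a s.
Proof.
move=> La Lb /andP[y0 yL]; have g0 := gamma_v_gt0.
have yM : L <= M - g * y by rewrite -[leLHS]L_2E lerD2l lerN2 ler_pM2l.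
have MM : M - g * y <= M by rewrite gerBl mulr_ge0// ltW.
have Iu := L2_intg (unfold_L2 La Lb).
rewrite (Int_cat yL yM (intgS y0 MM Iu)).
have -> : \int[mu]_(z in `]L, M - g * y[) unfold a b z = \int[mu]_(s in `]y, L[) (a s - b s).
  have := @Int_refl R g M y L (unfold a b) g0; rewrite L_2E => ->; last first.
    exact: intgS (ltW L0) MM Iu.
  have I1 : intg y L (fun y => unfold a b (M - g * y)).
    apply: (@intg_refl R g M y L (unfold a b)) => //.
    by rewrite L_2E; apply: intgS (ltW L0) MM Iu.
  rewrite -IntZ//; apply: eq_Int => s /andP[ys sL]; rewrite unfold_right ?(le_lt_trans y0 ys)//; field; by rewrite gt_eqF.
rewrite [X in X + _ = _](@eq_Int _ _ _ _ (fun y => a y + b y)); last first.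
  by move=> s /andP[_ sL]; rewrite unfold_left.
have Ia := intgS y0 (lexx _) (L2_intg La); have Ib := intgS y0 (lexx _) (L2_intg Lb).
rewrite IntD// IntB//; ring.
Qed.

End Unfold.

(** * Curves in L^2 and their moments *)

Section EpsDelta.
Variable R : realType.
Local Notation mu := (@lebesgue_measure R).
Implicit Types (f g k : R -> R).

(** Functions of time are controlled for t >= 0 only; composing them with pos
    makes them continuous on the line. *)
Definition pos (x : R) : R := if x < 0 then 0 else x.

Lemma pos_id x : 0 <= x -> pos x = x.
Proof. by move=> x0; rewrite /pos ltNge x0. Qed.

Lemma pos_ge0 x : 0 <= pos x.
Proof. by rewrite /pos; case: ltP. Qed.

Lemma pos_lip x y : `|pos x - pos y| <= 1 * `|x - y|.
Proof.
have h1 := ler_norm (x - y); have h2 := ler_norm (y - x); rewrite distrC in h2.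
rewrite mul1r /pos ler_norml; set e := `|_| in h1 h2 *.
by case: (ltP x 0) => ?; case: (ltP y 0) => ?; apply/andP; split; lra.
Qed.

Lemma is_derive_eps f (t l : R) :
  (forall e : R, 0 < e -> exists2 d : R, 0 < d & forall s, s != t -> `|t - s| < d ->
     `|(f s - f t) / (s - t) - l| < e) -> is_derive t 1 f l.
Proof.
move=> H.
have C : (fun h : R => h^-1 *: (f (h *: (1 : R) + t) - f t)) @ 0^' --> l.
  apply/cvgrPdist_lt => /= e e0; have [d d0 Hd] := H e e0.
  apply/nbhs_ballP; exists d => //= h; rewrite /ball /= sub0r normrN => hd h0.
  have := Hd (h + t); rewrite -subr_eq0 addrK => /(_ h0).
  rewrite opprD addrCA subrr addr0 normrN => /(_ hd).
  by rewrite distrC /GRing.scale /= mulr1 mulrC.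
by apply: DeriveDef; [apply/cvg_ex; exists l|apply: cvg_lim].
Qed.

Lemma cont_eps f : (forall t : R, 0 <= t -> forall e : R, 0 < e -> exists2 d : R, 0 < d &
   forall s, 0 <= s -> `|t - s| < d -> `|f t - f s| < e) -> continuous (fun s => f (pos s)).
Proof.
move=> H t; apply/cvgrPdist_lt => /= e e0; have [d d0 Hd] := H (pos t) (pos_ge0 t) e e0.
apply/nbhs_ballP; exists d => //= s; rewrite /ball /= => ts.
by apply: Hd; [exact: pos_ge0|apply: le_lt_trans ts; rewrite -[leRHS]mul1r; exact: pos_lip].
Qed.

Lemma is_derive_pos f (t l : R) : 0 < t -> is_derive t 1 f l -> is_derive t 1 (fun s => f (pos s)) l.
Proof.
move=> t0; apply: near_eq_is_derive; apply/nbhs_ballP; exists t => //= s.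
rewrite /ball /= ltr_norml => /andP[_ h]; rewrite pos_id//; lra.
Qed.

Lemma const_of_derive0 f : continuous (fun s => f (pos s)) ->
  (forall t : R, 0 < t -> is_derive t 1 f 0) -> forall t : R, 0 <= t -> f t = f 0.
Proof.
move=> cf df t; rewrite le_eqVlt => /orP[/eqP <-//|t0].
have D : forall x : R, x \in `]0, t[ -> is_derive x 1 (fun s => f (pos s)) ((fun=> 0) x).
  by move=> x; rewrite in_itv /= => /andP[x0 _]; apply: is_derive_pos => //; exact: df.
have [c _] := MVT t0 D (continuous_subspaceT cf).
by rewrite mul0r !pos_id ?(ltW t0)// => /eqP; rewrite subr_eq0 => /eqP.
Qed.

Lemma normL2_small (L : R) (D : R -> R -> R) (A : set R) (t : R) :
  normL2sq 0 L (D s) @[s --> within A (nbhs t)] --> 0%E ->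
  forall e : R, 0 < e -> exists2 d : R, 0 < d & forall s, A s -> `|t - s| < d -> (normL2sq 0 L (D s) < e%:E)%E.
Proof.
move=> H e e0.
have /nbhs_ballP[d /= d0 Hd] : nbhs t (fun s => A s -> (normL2sq 0 L (D s) < e%:E)%E).
  apply: (H [set y | (y < e%:E)%E]).
  by apply: open_nbhs_nbhs; split; [exact: open_ereal_lt_ereal|rewrite /= lte_fin].
by exists d => // s As ts; exact: Hd.
Qed.

Lemma normL2_small' (L : R) (D : R -> R -> R) (A : set R) (t : R) :
  normL2sq 0 L (D s) @[s --> within A t^'] --> 0%E ->
  forall e : R, 0 < e -> exists2 d : R, 0 < d & forall s, A s -> s != t -> `|t - s| < d -> (normL2sq 0 L (D s) < e%:E)%E.
Proof.
move=> H e e0.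
have /nbhs_ballP[d /= d0 Hd] : nbhs t (fun s => s != t -> A s -> (normL2sq 0 L (D s) < e%:E)%E).
  apply: (H [set y | (y < e%:E)%E]).
  by apply: open_nbhs_nbhs; split; [exact: open_ereal_lt_ereal|rewrite /= lte_fin].
by exists d => // s As st ts; exact: Hd.
Qed.

End EpsDelta.

Section Moments.
Variable R : realType.
Local Notation mu := (@lebesgue_measure R).
Variables (L v : R).
Hypotheses (L0 : 0 < L).
Implicit Types (w : R -> R -> R) (k : R -> R).

(** The pulled back w is a continuous curve in L^2(0, L) on the half line, stated
    without the horizon T. *)
Definition ctsL2 w := (forall t, 0 <= t -> L2 0 L (pull v w t)) /\
  (forall t, 0 <= t -> forall e, 0 < e -> exists2 d, 0 < d & forall s, 0 <= s -> `|t - s| < d ->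
     \int[mu]_(y in `]0, L[) ((pull v w s y - pull v w t y) ^+ 2) < e).

Lemma L2_pull w (t : R) : L2 (v * t) (L + v * t) (w^~ t) -> L2 0 L (pull v w t).
Proof. by move=> H; apply: (@L2_shift R 0 L (v * t) (w^~ t)); rewrite add0r. Qed.

Lemma normL2sq_ge0 (a b : R) f : (0 <= normL2sq a b f)%E.
Proof. by apply: integral_ge0 => x _; rewrite lee_fin sqr_ge0. Qed.

Lemma near_itv (t : R) : 0 <= t -> forall s, 0 <= s -> `|t - s| < 1 -> 0 <= s <= t + 1.
Proof. by move=> t0 s s0; rewrite ltr_norml => /andP[? ?]; apply/andP; split; lra. Qed.

Lemma C_L2_ctsL2 w : (forall T, 0 < T -> C_L2 L v T w) -> ctsL2 w.
Proof.
move=> H.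
have HL t : 0 <= t -> L2 0 L (pull v w t).
  move=> t0; apply: L2_pull; have T0 : 0 < t + 1 by lra.
  have tT : 0 <= t <= t + 1 by apply/andP; split; lra.
  by have [] := H _ T0 t tT.
split => // t t0 e e0; have T0 : 0 < t + 1 by lra.
have tT : 0 <= t <= t + 1 by apply/andP; split; lra.
have [_ /normL2_small/(_ e e0)[d d0 Hd]] := H _ T0 t tT.
exists (Num.min d 1); first by rewrite lt_min d0 ltr01.
move=> s s0; rewrite lt_min => /andP[sd s1].
have := Hd s _ sd; rewrite /= in_itv /= => /(_ (near_itv t0 s0 s1)).
by rewrite normL2sqE ?lte_fin//; apply: L2B; exact: HL.
Qed.

Lemma C_H1r_ctsL2 phi phix : (forall T, 0 < T -> C_H1r L v T phi phix) -> ctsL2 phix.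
Proof.
move=> H.
have HL t : 0 <= t -> L2 0 L (pull v phix t).
  move=> t0; apply: L2_pull; have T0 : 0 < t + 1 by lra.
  have tT : 0 <= t <= t + 1 by apply/andP; split; lra.
  by have [[[_ _ ? _] _] _] := H _ T0 t tT.
split => // t t0 e e0; have T0 : 0 < t + 1 by lra.
have tT : 0 <= t <= t + 1 by apply/andP; split; lra.
have [_ Hc] := H _ T0 t tT.
have /nbhs_ballP[d /= d0 Hd] : nbhs t (fun s => `[0, t + 1]%classic s -> (normL2sq 0 L (fun y => pull v phi s y - pull v phi t y)%R +
     normL2sq 0 L (fun y => pull v phix s y - pull v phix t y)%R < e%:E)%E).
  apply: (Hc [set y | (y < e%:E)%E]).
  by apply: open_nbhs_nbhs; split; [exact: open_ereal_lt_ereal|rewrite /= lte_fin].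
exists (Num.min d 1); first by rewrite lt_min d0 ltr01.
move=> s s0; rewrite lt_min => /andP[sd s1].
have := Hd s sd; rewrite /= in_itv /= => /(_ (near_itv t0 s0 s1)).
move=> K; have : (normL2sq 0 L (fun y => pull v phix s y - pull v phix t y)%R < e%:E)%E.
  by apply: le_lt_trans K; rewrite leeDr// normL2sq_ge0.
by rewrite normL2sqE ?lte_fin//; apply: L2B; exact: HL.
Qed.

Definition moment w k t := \int[mu]_(y in `]0, L[) (pull v w t y * k y).

Lemma moment_cont w k : ctsL2 w -> continuous k -> continuous (fun t => moment w k (pos t)).
Proof.
move=> [HL Hs] ck; apply: cont_eps => t t0 e e0.
have [d d0 Hd] := @cauchy_schwarz_small R L k e e0.
have [d' d'0 Hd'] := Hs t t0 d d0; exists d' => // s s0 ts.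
have Lk : L2 0 L k by exact: L2_cont.
rewrite /moment distrC -IntB; [|by apply: L2_mul => //; exact: HL|by apply: L2_mul => //; exact: HL].
rewrite (@eq_Int _ _ _ _ (fun y => (pull v w s y - pull v w t y) * k y)); last by move=> y _; rewrite mulrBl.
by apply: Hd => //; [apply: L2B; exact: HL|exact: Hd'].
Qed.

Lemma momentD w k1 k2 t : ctsL2 w -> 0 <= t -> continuous k1 -> continuous k2 ->
  moment w (fun y => k1 y + k2 y) t = moment w k1 t + moment w k2 t.
Proof.
move=> [HL _] t0 c1 c2; have I := L2_intg (HL t t0).
by rewrite /moment -IntD; [apply: eq_Int => y _; ring|exact: intgM_cont|exact: intgM_cont].
Qed.

Lemma momentZ w k c t : ctsL2 w -> 0 <= t -> continuous k ->
  moment w (fun y => c * k y) t = c * moment w k t.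
Proof.
move=> [HL _] t0 c1; have I := L2_intg (HL t t0).
by rewrite /moment -IntZ; [apply: eq_Int => y _; ring|exact: intgM_cont].
Qed.

(** The derivative of the curve t |-> phi(. + v t, t) in L^2 is paired with k. *)
Lemma moment_deriv phi phix phit k (t : R) : ctsL2 phi -> ctsL2 phix -> ctsL2 phit ->
  (forall T, 0 < T -> C1_L2 L v T phi phix phit) -> continuous k -> 0 < t ->
  is_derive t 1 (moment phi k) (moment phit k t + v * moment phix k t).
Proof.
move=> [H1 _] [H2 _] [H3 _] HC ck t0; have t0' := ltW t0.
have Lk : L2 0 L k by exact: L2_cont.
apply: is_derive_eps => e e0.
have [d d0 Hd] := @cauchy_schwarz_small R L k e e0.
have T0 : 0 < t + 1 by lra.
have tT : 0 <= t <= t + 1 by apply/andP; split; lra.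
have [_ _ /(_ t tT)/normL2_small'/(_ d d0)[d' d'0 Hd']] := HC _ T0.
exists (Num.min d' (Num.min 1 t)); first by rewrite !lt_min d'0 ltr01.
move=> s st; rewrite !lt_min => /and3P[sd s1 s2].
have s0 : 0 <= s by move: s2; rewrite ltr_norml => /andP[? ?]; lra.
have := Hd' s _ st sd; rewrite /= in_itv /= => /(_ (near_itv t0' s0 s1)).
have Lq : L2 0 L (fun y => (s - t)^-1 * (pull v phi s y - pull v phi t y)).
  by apply: L2Z; apply: L2B; exact: H1.
have Lr : L2 0 L (fun y => pull v phit t y + v * pull v phix t y).
  by apply: L2D; [exact: H3|apply: L2Z; exact: H2].
have Ld : L2 0 L (fun y => (pull v phi s y - pull v phi t y) / (s - t) - (pull v phit t y + v * pull v phix t y)).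
  by apply: L2B => //; apply: eq_L2 Lq => y _; rewrite mulrC.
rewrite normL2sqE// lte_fin => /(Hd _ Ld Lk).
congr (`|_| < _).
have I1 := L2_mul (H1 s s0) Lk; have I2 := L2_mul (H1 t t0') Lk.
have I3 := L2_mul (H2 t t0') Lk; have I4 := L2_mul (H3 t t0') Lk.
rewrite /moment -IntB// mulrC -IntZ; last exact: intgB.
rewrite -IntZ// -IntD//; last exact: intgZ.
rewrite -IntB; [|by apply: intgZ; exact: intgB|by apply: intgD => //; exact: intgZ].
by apply: eq_Int => y _; ring.
Qed.

End Moments.

(** * The conservation law of a weak solution *)

Section Support.
Variable R : realType.

Lemma derive_cast (f : R -> R) (x l l' : R) : is_derive x 1 f l -> l = l' -> is_derive x 1 f l'.
Proof. by move=> D <-. Qed.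

Local Notation mu := (@lebesgue_measure R).

Lemma Int_support (p q : R) (f : R -> R) : 0 <= p ->
  (forall t, ~~ (p < t < q) -> f t = 0) ->
  \int[mu]_(t in `]0, +oo[) f t = \int[mu]_(t in `]p, q[) f t.
Proof.
move=> p0 f0; rewrite Rintegral_mkcond [RHS]Rintegral_mkcond; congr Rintegral; apply/funext => t.
rewrite !patchE; case: ifPn => [tin|tout]; case: ifPn => [tin2|tout2] //.
  apply: f0; move: tout2; apply: contra; move=> h; rewrite mem_set//= in_itv //.
apply/esym/f0; move: tout; apply: contra => /andP[pt _]; rewrite mem_set//= in_itv /= andbT.
exact: le_lt_trans pt.
Qed.
End Support.

Section Conservation.
Variable R : realType.
Local Notation mu := (@lebesgue_measure R).
Variables (L v eta : R).
Hypotheses (L0 : 0 < L) (v0 : 0 <= v) (v1 : v < 1).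
Variables (phi phix phit : R -> R -> R).
Hypothesis regular : forall T, 0 < T -> C_H1r L v T phi phix /\ C1_L2 L v T phi phix phit.
Hypothesis weak : weak_WP L v eta phi phix phit.

Local Notation moment := (moment L v).
Local Notation g := (gamma_v v).
Local Notation M := (L_2 L v).
Definition trace (t : R) : R := phi (v * t) t.

Lemma phi_ctsL2 : ctsL2 L v phi.
Proof. by apply: C_L2_ctsL2 => T T0; have [_ []] := regular T0. Qed.
Lemma phit_ctsL2 : ctsL2 L v phit.
Proof. by apply: C_L2_ctsL2 => T T0; have [_ []] := regular T0. Qed.
Lemma phix_ctsL2 : ctsL2 L v phix.
Proof. by apply: (@C_H1r_ctsL2 R L v phi phix) => T T0; have [] := regular T0. Qed.

Lemma phi_H1r (t : R) : 0 <= t -> H1r (v * t) (L + v * t) (phi^~ t) (phix^~ t).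
Proof.
move=> t0; have T0 : 0 < t + 1 by lra.
have tT : 0 <= t <= t + 1 by apply/andP; split; lra.
by have [/(_ t tT)[]] := regular T0.
Qed.

Lemma lt_L t : v * t < L + v * t. Proof. by rewrite ltrDr. Qed.

(** Only the damped end contributes a boundary term, since phi vanishes at the
    other one. *)
Lemma moment_x_by_parts (k k' : R -> R) (t : R) : 0 <= t -> (forall x : R, is_derive x 1 k (k' x)) -> continuous k' ->
  moment phix k t = - (trace t * k 0) - moment phi k' t.
Proof.
move=> t0 dk ck'; have [H w0] := phi_H1r t0.
have ck := is_derive_cont dk.
have dks (x : R) : is_derive x 1 (fun x => k (x - v * t)) (k' (x - v * t)).
  have D : is_derive x 1 (fun x => x - v * t) (1 : R).
    by have := is_deriveB (is_derive_id x 1) (is_derive_cst (v * t) x 1); rewrite subr0.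
  by have := is_derive1_comp (f := k) (g := fun x => x - v * t) (dk _) D; rewrite mulr1.
have cs : continuous (fun x : R => x - v * t) by move=> x; apply: cvgB; [exact: cvg_id|exact: cvg_cst].
have cks : continuous (fun x => k' (x - v * t)).
  by move=> x; apply: continuous_comp; [exact: cs|exact: ck'].
have := H1_by_parts (lt_L t) H dks cks.
rewrite w0 mul0r sub0r subrr => E.
have [_ Lw Lwx _] := H.
have S (w : R -> R -> R) (q : R -> R) : L2 (v * t) (L + v * t) (w^~ t) -> continuous q ->
    \int[mu]_(x in `]v * t, L + v * t[) (w x t * q (x - v * t)) = moment w q t.
  move=> Lw' cq; have := @Int_shift R 0 L (v * t) (fun x => w x t * q (x - v * t)).
  rewrite add0r => ->.
    by rewrite /moment; apply: eq_Int => y _; rewrite addrK.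
  apply: intgM_cont; first exact: L2_intg.
  by move=> x; apply: continuous_comp; [exact: cs|exact: cq].
by rewrite -(S phix)// -(S phi)// E.
Qed.

Lemma trace_cont : continuous (fun t => trace (pos t)).
Proof.
have E t : 0 <= t -> trace t = - moment phix (fun=> 1) t.
  move=> t0; rewrite (@moment_x_by_parts (fun=> 1) (fun=> 0) t t0); last exact: cst_continuous.
  rewrite mulr1 /moment (@eq_Int _ _ _ _ (fun=> 0)); last by move=> y _; rewrite mulr0.
  by rewrite Int0 subr0 opprK.
have -> : (fun t => trace (pos t)) = (fun t => - moment phix (fun=> 1) (pos t)).
  by apply/funext => t; rewrite E ?pos_ge0.
by move=> t; apply: cvgN; apply: moment_cont; [exact: phix_ctsL2|exact: cst_continuous].
Qed.

(** The variational equation is tested with psi(x, t) = chi(t) k(x - v t). *)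
Lemma weak_moment (k k' : R -> R) (p q : R) : 0 <= p -> p < q -> (forall x : R, is_derive x 1 k (k' x)) ->
  continuous k' -> k L = 0 ->
  weak_derivative p q (fun t => moment phit k t + eta * k 0 * trace t)
    (fun t => - (v * moment phit k' t + moment phix k' t)).
Proof.
move=> p0 pq dk ck' kL chi [dchi cchi [c [d [pc dq chi0]]]].
have ck := is_derive_cont dk.
have dc (t : R) : is_derive t 1 chi (derive1 chi t).
  by rewrite derive1E; apply: DeriveDef; first exact: dchi.
have cc := is_derive_cont dc.
pose psi x t := chi t * k (x - v * t).
have Dlx (c0 x : R) : is_derive x 1 (fun x => x - c0) (1 : R).
  by have := is_deriveB (is_derive_id x 1) (is_derive_cst c0 x 1); rewrite subr0.
have Dlt (x t : R) : is_derive t 1 (fun t => x - v * t) (- v).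
  have := is_deriveB (is_derive_cst x t 1) (is_deriveZ v (is_derive_id t 1)).
  by rewrite sub0r /GRing.scale /= mulr1.
have Dx (x t : R) : is_derive x 1 (psi^~ t) (chi t * k' (x - v * t)).
  have D := is_derive1_comp (f := k) (g := fun x => x - v * t) (dk _) (Dlx (v * t) x).
  by have := is_deriveZ (chi t) D; rewrite mulr1.
have Dt (x t : R) : is_derive t 1 (psi x) (derive1 chi t * k (x - v * t) - v * chi t * k' (x - v * t)).
  have D := is_derive1_comp (f := k) (g := fun t => x - v * t) (dk _) (Dlt x t).
  by apply: (derive_cast (is_deriveM (dc t) D)); rewrite /GRing.scale /=; ring.
have dxE x t : dx psi x t = chi t * k' (x - v * t) by rewrite /dx derive1E; apply: derive_val.
have dtE x t : dt psi x t = derive1 chi t * k (x - v * t) - v * chi t * k' (x - v * t).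
  by rewrite /dt derive1E; apply: derive_val.
have c2 (f : R -> R) : continuous f -> continuous (fun z : R * R => f z.2).
  by move=> cf z; apply: (@continuous_comp _ _ _ (fun z : R * R => z.2) f); [exact: cvg_snd|exact: cf].
have c12 (f : R -> R) : continuous f -> continuous (fun z : R * R => f (z.1 - v * z.2)).
  move=> cf z; apply: (@continuous_comp _ _ _ (fun z : R * R => z.1 - v * z.2) f); last exact: cf.
  by apply: cvgB; [exact: cvg_fst|apply: cvgM; [exact: cvg_cst|exact: cvg_snd]].
have tpsi : test2 L v psi.
  split.
  - by move=> x t; split; [have [] := Dx x t|have [] := Dt x t].
  - rewrite (_ : (fun z => _) = (fun z : R * R => chi z.2 * k' (z.1 - v * z.2))); last by apply/funext => z; rewrite dxE.
    by move=> z; apply: cvgM; [exact: (c2 chi)|exact: c12].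
  - rewrite (_ : (fun z => _) = (fun z : R * R => derive1 chi z.2 * k (z.1 - v * z.2) - v * chi z.2 * k' (z.1 - v * z.2))); last by apply/funext => z; rewrite dtE.
    move=> z; apply: cvgB; first by apply: cvgM; [exact: (c2 (derive1 chi))|exact: c12].
    apply: cvgM; [apply: cvgM; [exact: cvg_cst|exact: (c2 chi)]|exact: c12].
  - exists c, d; split; first exact: le_lt_trans pc.
    by move=> x t /chi0; rewrite /psi => ->; rewrite mul0r.
  - by move=> t _; rewrite /psi addrK kL mulr0.
have chi'0 t : ~~ (p < t < q) -> derive1 chi t = 0.
  move=> tpq; rewrite derive1E.
  have tcd : t < c \/ d < t.
    by move: tpq; rewrite negb_and -!leNgt => /orP[h|h]; [left; exact: le_lt_trans pc|right; exact: lt_le_trans h].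
  have <- : 'D_1 (fun=> 0 : R) t = 0 by apply: derive_val.
  apply: near_eq_derive; case: tcd => h.
    apply/nbhs_ballP; exists (c - t) => /=; first by rewrite subr_gt0.
    move=> s; rewrite /ball /= ltr_norml => /andP[h1 h2]; apply: chi0; rewrite negb_and -ltNge; apply/orP; left; lra.
  apply/nbhs_ballP; exists (t - d) => /=; first by rewrite subr_gt0.
  move=> s; rewrite /ball /= ltr_norml => /andP[h1 h2]; apply: chi0; rewrite negb_and -!ltNge; apply/orP; right; lra.
have chi0' t : ~~ (p < t < q) -> chi t = 0.
  move=> tpq; apply: chi0; move: tpq; apply: contra => /andP[h1 h2].
  by rewrite (lt_le_trans pc h1) (le_lt_trans h2 dq).
have inner t : 0 <= t -> \int[mu]_(x in `](v * t), (L + v * t)[) (phit x t * dt psi x t - phix x t * dx psi x t) =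
    derive1 chi t * moment phit k t - chi t * (v * moment phit k' t + moment phix k' t).
  move=> t0; have Ht := phit_ctsL2.1 t t0; have Hx := phix_ctsL2.1 t t0.
  have T0 : 0 < t + 1 by lra.
  have tT : 0 <= t <= t + 1 by apply/andP; split; lra.
  have [_ [_ /(_ t tT)[Lt _] _]] := regular T0.
  have [[_ _ Lx _] _] := phi_H1r t0.
  have It := L2_intg Lt; have Ix := L2_intg Lx.
  have cs (f : R -> R) : continuous f -> continuous (fun x => f (x - v * t)).
    move=> cf x; apply: (@continuous_comp _ _ _ (fun x => x - v * t) f); last exact: cf.
    by apply: cvgB; [exact: cvg_id|exact: cvg_cst].
  have I1 f (w : R -> R -> R) : continuous f -> intg (v * t) (L + v * t) (w^~ t) ->
    intg (v * t) (L + v * t) (fun x => w x t * f (x - v * t)).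
    by move=> cf Iw; apply: intgM_cont => //; exact: cs.
  have S f (w : R -> R -> R) : continuous f -> intg (v * t) (L + v * t) (w^~ t) ->
    moment w f t = \int[mu]_(x in `]v * t, L + v * t[) (w x t * f (x - v * t)).
    move=> cf Iw; have := @Int_shift R 0 L (v * t) (fun x => w x t * f (x - v * t)).
    rewrite add0r => ->; last exact: I1.
    by rewrite /moment; apply: eq_Int => y _; rewrite addrK.
  rewrite (S k phit)// (S k' phit)// (S k' phix)//.
  rewrite -!IntZ; try by [exact: I1].
  rewrite -IntD; [|apply: intgZ; exact: I1|exact: I1].
  rewrite -IntZ; last by apply: intgD; [apply: intgZ; exact: I1|exact: I1].
  rewrite -IntB; [|apply: intgZ; exact: I1|apply: intgZ; apply: intgD; [apply: intgZ; exact: I1|exact: I1]].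
  by apply: eq_Int => x _; rewrite dtE dxE; ring.
have := weak tpsi.
rewrite (@Int_support R p q _ p0); last first.
  move=> t tpq; rewrite (@eq_Int _ _ _ _ (fun=> 0)) ?Int0// => x _.
  by rewrite dtE dxE chi'0// chi0'//; ring.
rewrite (@Int_support R p q _ p0); last first.
  by move=> t tpq; rewrite dtE dxE chi'0// chi0'//; ring.
rewrite (@eq_Int _ p q _ (fun t => derive1 chi t * moment phit k (pos t) - chi t * (v * moment phit k' (pos t) + moment phix k' (pos t)))); last first.
  move=> t /andP[pt _]; have t0 : 0 <= t by apply: le_trans p0 _; exact: ltW.
  by rewrite inner// !pos_id.
have cT f : continuous f -> continuous (fun t => moment phit f (pos t)) by apply: moment_cont; exact: phit_ctsL2.
have cX f : continuous f -> continuous (fun t => moment phix f (pos t)) by apply: moment_cont; exact: phix_ctsL2.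
rewrite [X in _ + eta * X](@eq_Int _ p q _ (fun t => k 0 * trace (pos t) * derive1 chi t)); last first.
  move=> t /andP[pt _]; have t0 : 0 <= t by apply: le_trans p0 _; exact: ltW.
  by rewrite dtE dxE pos_id// /trace subrr; ring.
have i1 : intg p q (fun t => derive1 chi t * moment phit k (pos t)).
  by apply: intg_cont => t; apply: cvgM; [exact: cchi|exact: cT].
have i2 : intg p q (fun t => chi t * (v * moment phit k' (pos t) + moment phix k' (pos t))).
  apply: intg_cont => t; apply: cvgM; [exact: cc|apply: cvgD; [apply: cvgM; [exact: cvg_cst|exact: cT]|exact: cX]].
have i3 : intg p q (fun t => k 0 * trace (pos t) * derive1 chi t).
  by apply: intg_cont => t; apply: cvgM; [apply: cvgM; [exact: cvg_cst|exact: trace_cont]|exact: cchi].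
rewrite IntB// -addrA addrC -IntZ// => E.
rewrite (@eq_Int _ p q _ (fun t => derive1 chi t * moment phit k (pos t) + eta * (k 0 * trace (pos t) * derive1 chi t))); last first.
  by move=> t /andP[pt _]; rewrite pos_id ?(le_trans p0 (ltW pt))//; ring.
rewrite IntD//; last exact: intgZ.
rewrite [X in _ = - X](@eq_Int _ p q _ (fun t => - (chi t * (v * moment phit k' (pos t) + moment phix k' (pos t))))); last first.
  by move=> t /andP[pt _]; rewrite pos_id ?(le_trans p0 (ltW pt))//; ring.
rewrite IntN// opprK; lra.
Qed.

(** A continuous function with a continuous weak derivative is differentiable. *)
Lemma weak_moment_deriv (k k' : R -> R) (t : R) : 0 < t -> (forall x : R, is_derive x 1 k (k' x)) ->
  continuous k' -> k L = 0 ->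
  is_derive t 1 (fun t => moment phit k t + eta * k 0 * trace t) (- (v * moment phit k' t + moment phix k' t)).
Proof.
move=> t0 dk ck' kL; have ck := is_derive_cont dk.
have cT f : continuous f -> continuous (fun t => moment phit f (pos t)) by apply: moment_cont; exact: phit_ctsL2.
have cX f : continuous f -> continuous (fun t => moment phix f (pos t)) by apply: moment_cont; exact: phix_ctsL2.
pose p := t / 2; pose q := t + 1.
have p0 : 0 < p by rewrite /p; lra.
have pt : p < t by rewrite /p; lra.
have tq : t < q by rewrite /q; lra.
have pq : p < q := lt_trans pt tq.
pose G s := moment phit k (pos s) + eta * k 0 * trace (pos s).
have cG : continuous G.
  move=> s; apply: cvgD; first exact: cT.
  by apply: cvgM; [exact: cvg_cst|exact: trace_cont].
pose H s := - (v * moment phit k' (pos s) + moment phix k' (pos s)).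
have cH : continuous H.
  by move=> s; apply: cvgN; apply: cvgD; [apply: cvgM; [exact: cvg_cst|exact: cT]|exact: cX].
have W : weak_derivative p q G H.
  move=> chi tchi; have := weak_moment (ltW p0) pq dk ck' kL tchi.
  rewrite (@eq_Int _ p q _ (fun s => G s * derive1 chi s)); last first.
    by move=> s /andP[ps _]; rewrite /G pos_id// ltW// (lt_trans p0).
  move=> ->; congr (- _); apply: eq_Int => s /andP[ps _].
  by congr (- (v * _ + _) * _); rewrite pos_id// (ltW (lt_trans p0 ps)).
have [m Hm] := weak_derivative_AC pq (fun x _ => cG x) (intg_cont p q cG) (intg_cont p q cH) W.
have -> : - (v * moment phit k' t + moment phix k' t) = H t by rewrite /H pos_id// ltW.
have D : is_derive t 1 (fun s => (m - prim H p) + prim H s) (H t).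
  by have := is_deriveD (is_derive_cst (m - prim H p) t 1) (is_derive_prim t cH); rewrite add0r.
apply: near_eq_is_derive D; apply/nbhs_ballP; exists (Num.min (t - p) (q - t)) => /=.
  by rewrite lt_min !subr_gt0 pt.
move=> s; rewrite /ball /= lt_min !ltr_norml => /andP[/andP[h1 h2] /andP[h3 h4]].
have ps : p < s by lra.
have := Hm s; rewrite ps /= => /(_ ltac:(lra)).
rewrite -(primB (fun a b => intg_cont a b cH) (ltW ps)) /G pos_id; last by apply: ltW; exact: lt_trans p0 ps.
by move=> ->; ring.
Qed.

Variables (C S C' S' : R -> R) (al be : R).
Hypothesis dC : forall x : R, is_derive x 1 C (C' x).
Hypothesis dS : forall x : R, is_derive x 1 S (S' x).
Hypothesis C'E : forall x, C' x = - al * C x - be * S x.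
Hypothesis S'E : forall x, S' x = - al * S x + be * C x.
Hypotheses (C0 : C 0 = 1) (S0 : S 0 = 0).
Hypotheses (CM : (1 - eta) * C M = - (1 + eta)) (SM : S M = 0).

(** Folding the reflection into the test function: by [Int_unfold],
    [fold_moment q t] is the integral of q against the unfolding of phi_x and
    phi_t. *)
Definition refl_diff (q : R -> R) y := q y - q (M - g * y).
Definition refl_sum (q : R -> R) y := q y + q (M - g * y).
Definition fold_moment q t := moment phit (refl_diff q) t + moment phix (refl_sum q) t.

Lemma refl_deriv (q q' : R -> R) (y : R) : (forall x : R, is_derive x 1 q (q' x)) ->
  is_derive y 1 (fun y => q (M - g * y)) (- g * q' (M - g * y)).
Proof.
move=> dq; have D : is_derive y 1 (fun y => M - g * y) (- g).
  by apply: (derive_cast (is_deriveB (is_derive_cst M y 1) (is_deriveZ g (is_derive_id y 1)))); rewrite sub0r /GRing.scale /= mulr1.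
by have := is_derive1_comp (f := q) (g := fun y => M - g * y) (dq _) D; rewrite mulrC.
Qed.

Lemma refl_cont (q : R -> R) : continuous q -> continuous (fun y => q (M - g * y)).
Proof.
move=> cq y; apply: (@continuous_comp _ _ _ (fun y : R => M - g * y) q); last exact: cq.
by apply: cvgB; [exact: cvg_cst|exact: mulrl_continuous].
Qed.

Lemma refl_diff_cont q : continuous q -> continuous (refl_diff q).
Proof. by move=> cq y; apply: cvgB; [exact: cq|exact: refl_cont]. Qed.
Lemma refl_sum_cont q : continuous q -> continuous (refl_sum q).
Proof. by move=> cq y; apply: cvgD; [exact: cq|exact: refl_cont]. Qed.

Lemma fold_moment_cont q : continuous q -> continuous (fun t => fold_moment q (pos t)).
Proof.
move=> cq t; apply: cvgD; apply: moment_cont; [exact: phit_ctsL2|exact: refl_diff_cont|exact: phix_ctsL2|exact: refl_sum_cont].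
Qed.

Lemma fold_moment_comb (q q1 q2 : R -> R) (a b t : R) : 0 <= t -> continuous q1 -> continuous q2 ->
  (forall x, q x = a * q1 x + b * q2 x) -> fold_moment q t = a * fold_moment q1 t + b * fold_moment q2 t.
Proof.
move=> t0 c1 c2 qE; rewrite /fold_moment.
have K1 : moment phit (refl_diff q) t = a * moment phit (refl_diff q1) t + b * moment phit (refl_diff q2) t.
  rewrite -!(momentZ _ phit_ctsL2)//; [|exact: refl_diff_cont|exact: refl_diff_cont].
  rewrite -(momentD phit_ctsL2)//; [|by move=> y; apply: cvgM; [exact: cvg_cst|exact: refl_diff_cont]..].
  by apply: eq_Int => y _; congr (_ * _); rewrite /refl_diff !qE; ring.
have K2 : moment phix (refl_sum q) t = a * moment phix (refl_sum q1) t + b * moment phix (refl_sum q2) t.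
  rewrite -!(momentZ _ phix_ctsL2)//; [|exact: refl_sum_cont|exact: refl_sum_cont].
  rewrite -(momentD phix_ctsL2)//; [|by move=> y; apply: cvgM; [exact: cvg_cst|exact: refl_sum_cont]..].
  by apply: eq_Int => y _; congr (_ * _); rewrite /refl_sum !qE; ring.
rewrite K1 K2; ring.
Qed.

(** The moment of phi_t is differentiated by the weak equation, which applies
    because q(y) - q(M - g y) vanishes at y = L, and the moment of phi_x is, up
    to a boundary term, a moment of phi, which [moment_deriv] differentiates. The
    condition on q is what cancels the values of phi at the damped end. *)
Lemma fold_moment_deriv (q q' : R -> R) (t : R) : 0 < t -> (forall x : R, is_derive x 1 q (q' x)) -> continuous q' ->
  (1 + eta) * q 0 + (1 - eta) * q M = 0 ->
  is_derive t 1 (fold_moment q) (- (1 + v) * fold_moment q' t).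
Proof.
move=> t0 dq cq' q0.
have cq := is_derive_cont dq.
pose k' y := q' y + g * q' (M - g * y).
pose th' y := q' y - g * q' (M - g * y).
have dk (y : R) : is_derive y 1 (refl_diff q) (k' y).
  by apply: (derive_cast (is_deriveB (dq y) (refl_deriv y dq))); rewrite /k'; ring.
have dt' (y : R) : is_derive y 1 (refl_sum q) (th' y).
  by apply: (derive_cast (is_deriveD (dq y) (refl_deriv y dq))); rewrite /th'; ring.
have cr : continuous (fun y => g * q' (M - g * y)).
  by move=> y; apply: cvgM; [exact: cvg_cst|exact: refl_cont].
have ck' : continuous k' by move=> y; apply: cvgD; [exact: cq'|exact: cr].
have ct' : continuous th' by move=> y; apply: cvgB; [exact: cq'|exact: cr].
have kL : refl_diff q L = 0 by rewrite /refl_diff (L_2E L v1) subrr.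
have D1 := weak_moment_deriv t0 dk ck' kL.
have cT : continuous (refl_sum q) := refl_sum_cont cq.
have D2 := moment_deriv phi_ctsL2 phix_ctsL2 phit_ctsL2 (fun T T0 => (regular T0).2) ct' t0.
have D := is_deriveB D1 D2.
have E : - (v * moment phit k' t + moment phix k' t) - (moment phit th' t + v * moment phix th' t) = - (1 + v) * fold_moment q' t.
  have t0' := ltW t0.
  have K1 : v * moment phit k' t + moment phit th' t = (1 + v) * moment phit (refl_diff q') t.
    rewrite -!(momentZ _ phit_ctsL2)//; last exact: refl_diff_cont.
    rewrite -(momentD phit_ctsL2)//; last by move=> y; apply: cvgM; [exact: cvg_cst|exact: ck'].
    apply: eq_Int => y _; congr (_ * _); rewrite /k' /th' /refl_diff.
    have := gamma_vM v1; set qq := q' (M - _); move=> G.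
    by rewrite mulrBr -{2}G; ring.
  have K2 : moment phix k' t + v * moment phix th' t = (1 + v) * moment phix (refl_sum q') t.
    rewrite -!(momentZ _ phix_ctsL2)//; last exact: refl_sum_cont.
    rewrite -(momentD phix_ctsL2)//; last by move=> y; apply: cvgM; [exact: cvg_cst|exact: ct'].
    apply: eq_Int => y _; congr (_ * _); rewrite /k' /th' /refl_sum.
    have := gamma_vM v1; set qq := q' (M - _); move=> G.
    by transitivity ((1 + v) * q' y + g * (1 - v) * qq); [|rewrite G]; ring.
  rewrite /fold_moment mulrDr !mulNr -K1 -K2; ring.
rewrite E in D; apply: near_eq_is_derive D; apply/nbhs_ballP; exists t => //= s.
rewrite /ball /= ltr_norml => /andP[_ h]; have s0 : 0 <= s by lra.
rewrite /fold_moment (moment_x_by_parts s0 dt' ct').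
have : eta * refl_diff q 0 + refl_sum q 0 = 0 by rewrite /refl_diff /refl_sum mulr0 subr0 -[RHS]q0; ring.
move=> Z; have -> : refl_sum q 0 = - (eta * refl_diff q 0) by lra.
change (moment phit (refl_diff q) s + eta * refl_diff q 0 * trace s - moment phi th' s = moment phit (refl_diff q) s + (- (trace s * - (eta * refl_diff q 0)) - moment phi th' s)).
ring.
Qed.

(** The function q = C + i S solves q' = (- al + i be) q, so its moment j satisfies
    j' = - (1 + v) (- al + i be) j, and q((1 + v) t) j(t) is constant. The two
    identities are the real and imaginary parts of this. *)
Lemma conservation (t : R) : 0 <= t ->
  C ((1 + v) * t) * fold_moment C t - S ((1 + v) * t) * fold_moment S t = fold_moment C 0 /\
  S ((1 + v) * t) * fold_moment C t + C ((1 + v) * t) * fold_moment S t = fold_moment S 0.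
Proof.
have cC := is_derive_cont dC; have cS := is_derive_cont dS.
have cC' : continuous C'.
  rewrite (_ : C' = fun x => - al * C x - be * S x); last exact/funext.
  by move=> x; apply: cvgB; apply: cvgM; [exact: cvg_cst|exact: cC|exact: cvg_cst|exact: cS].
have cS' : continuous S'.
  rewrite (_ : S' = fun x => - al * S x + be * C x); last exact/funext.
  by move=> x; apply: cvgD; apply: cvgM; [exact: cvg_cst|exact: cS|exact: cvg_cst|exact: cC].
have jC' s : 0 <= s -> fold_moment C' s = - al * fold_moment C s - be * fold_moment S s.
  by move=> s0; rewrite -mulNr; apply: fold_moment_comb => // x; rewrite C'E !mulNr.
have jS' s : 0 <= s -> fold_moment S' s = - al * fold_moment S s + be * fold_moment C s.
  by move=> s0; exact: fold_moment_comb.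
have bC : (1 + eta) * C 0 + (1 - eta) * C M = 0 by rewrite C0 CM; ring.
have bS : (1 + eta) * S 0 + (1 - eta) * S M = 0 by rewrite S0 SM; ring.
have tau (q q' : R -> R) (s : R) : (forall x : R, is_derive x 1 q (q' x)) ->
   is_derive s 1 (fun s => q ((1 + v) * s)) ((1 + v) * q' ((1 + v) * s)).
  move=> dq; have D : is_derive s 1 (fun s => (1 + v) * s) (1 + v).
    by apply: (derive_cast (is_deriveZ (1 + v) (is_derive_id s 1))); rewrite /GRing.scale /= mulr1.
  by have := is_derive1_comp (f := q) (g := fun s => (1 + v) * s) (dq _) D; rewrite mulrC.
have ctau (q : R -> R) : continuous q -> continuous (fun s => q ((1 + v) * pos s)).
  move=> cq s; apply: (@continuous_comp _ _ _ (fun s => (1 + v) * pos s) q); last exact: cq.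
  by apply: cvgM; [exact: cvg_cst|exact: lip_cont (@pos_lip R) _].
move=> t0; split.
  pose J s := C ((1 + v) * s) * fold_moment C s - S ((1 + v) * s) * fold_moment S s.
  have -> : fold_moment C 0 = J 0 by rewrite /J mulr0 C0 S0 mul1r mul0r subr0.
  apply: (const_of_derive0 (f := J)); [| |exact: t0].
    by move=> s; apply: cvgB; apply: cvgM; [exact: ctau|exact: fold_moment_cont|exact: ctau|exact: fold_moment_cont].
  move=> s s0; apply: (derive_cast (is_deriveB (is_deriveM (tau C C' s dC) (fold_moment_deriv s0 dC cC' bC))
    (is_deriveM (tau S S' s dS) (fold_moment_deriv s0 dS cS' bS)))).
  rewrite /GRing.scale /= jC' ?jS' ?(ltW s0)// C'E S'E; ring.
pose J s := S ((1 + v) * s) * fold_moment C s + C ((1 + v) * s) * fold_moment S s.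
have -> : fold_moment S 0 = J 0 by rewrite /J mulr0 C0 S0 mul1r mul0r add0r.
apply: (const_of_derive0 (f := J)); [| |exact: t0].
  by move=> s; apply: cvgD; apply: cvgM; [exact: ctau|exact: fold_moment_cont|exact: ctau|exact: fold_moment_cont].
move=> s s0; apply: (derive_cast (is_deriveD (is_deriveM (tau S S' s dS) (fold_moment_deriv s0 dC cC' bC))
    (is_deriveM (tau C C' s dC) (fold_moment_deriv s0 dS cS' bS)))).
rewrite /GRing.scale /= jC' ?jS' ?(ltW s0)// C'E S'E; ring.
Qed.

End Conservation.

(** * Spectrum, coefficients and the energy identity *)

Section ComplexAux.
Variable R : realType.

Lemma complex_eq (x y : R[i]) : complex.Re x = complex.Re y -> complex.Im x = complex.Im y -> x = y.
Proof. by case: x y => [a b] [c d] /= -> ->. Qed.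

Lemma norm_complex_le (a b : R) : `|a +i* b| <= (`|a| + `|b|)%:C.
Proof.
rewrite normc_def lecR -[leRHS]ger0_norm ?addr_ge0// -sqrtr_sqr ler_sqrt ?sqr_ge0//=.
have := normr_ge0 a; have := normr_ge0 b.
rewrite -(real_normK (num_real a)) -(real_normK (num_real b)); nra.
Qed.

Lemma cvg_complex (x y : nat -> R) (a b : R) : x @ \oo --> a -> y @ \oo --> b ->
  (fun n => x n +i* y n : R[i]^o) @ \oo --> (a +i* b : R[i]^o).
Proof.
move=> xa yb; apply/cvgrPdist_lt => /= e.
rewrite ltcE /= => /andP[/eqP ei e0].
have e2 : 0 < complex.Re e / 2 by rewrite divr_gt0.
move/cvgrPdist_lt : xa => /(_ _ e2) xa; move/cvgrPdist_lt : yb => /(_ _ e2) yb.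
near=> n.
have -> : (a +i* b) - (x n +i* y n) = (a - x n) +i* (b - y n) by [].
apply: (le_lt_trans (norm_complex_le _ _)).
have -> : e = (complex.Re e)%:C by apply: complex_eq.
rewrite ltcR [ltRHS]splitr; apply: ltrD; near: n; [exact: xa|exact: yb].
Unshelve. all: by end_near. Qed.

Lemma series_complex (x y : nat -> R) n : series (fun k => x k +i* y k) n = series x n +i* series y n :> R[i].
Proof.
rewrite /series /=; elim: n => [|n IH]; first by rewrite !big_geq.
by rewrite !big_nat_recr //= IH.
Qed.

End ComplexAux.

Section Spectrum.
Variable R : realType.
Local Notation mu := (@lebesgue_measure R).
Variables (L v eta : R).
Hypotheses (L0 : 0 < L) (v0 : 0 <= v) (v1 : v < 1) (e0 : 0 <= eta) (e1 : eta != 1).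
Local Notation g := (gamma_v v).
Local Notation M := (L_2 L v).
Local Notation ge := (gamma_eta eta).

(** For eta < 1 the number gamma_eta is positive and the imaginary part of omega_n
    is a half-integer multiple of pi; for eta > 1 it is negative and the multiple
    is an integer. *)
Definition theta : R := if eta < 1 then 2^-1 else 0.
(** The real part of (1 - v) / L omega_n, the same for all n. *)
Definition alpha : R := (1 - v) / L * (- (ln `|ge| / 2)).
Local Notation nu := (nu M theta).
(** Real and imaginary parts of the exponential e^(- (1 - v) / L omega_n x) that
    defines the coefficients. *)
Definition adj_cos n x : R := expR (- alpha * x) * cos (nu n * x).
Definition adj_sin n x : R := - (expR (- alpha * x) * sin (nu n * x)).

Lemma e1' : 1 - eta != 0. Proof. by rewrite subr_eq0 eq_sym. Qed.

Lemma ge_neq0 : ge != 0.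
Proof. by rewrite mulf_neq0 ?invr_eq0 ?e1'// gt_eqF// ltr_wpDr. Qed.

Lemma norm_ge_gt0 : 0 < `|ge|. Proof. by rewrite normr_gt0 ge_neq0. Qed.

Lemma normge : `|ge| = (if eta < 1 then ge else - ge).
Proof.
case: ltP => h.
  by rewrite ger0_norm//; apply: divr_ge0; [rewrite addr_ge0|rewrite subr_ge0 ltW].
by rewrite ler0_norm// mulr_ge0_le0 ?addr_ge0// invr_le0 subr_le0.
Qed.

Lemma nz_v : 1 - v != 0. Proof. by rewrite subr_eq0 eq_sym lt_eqF. Qed.

Lemma omegaE n : omega eta n = (- (ln `|ge| / 2)) +i* (pi * (n%:~R + theta)).
Proof.
rewrite /omega /theta normge; case: ifP => h; rewrite ?h.
  by congr (_ +i* _); field.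
by congr (_ +i* _); rewrite addr0 mulrC.
Qed.

Lemma M_neq0 : M != 0. Proof. by rewrite gt_eqF// L_2_gt0. Qed.

Lemma nuE n : nu n = (1 - v) / L * (pi * (n%:~R + theta)).
Proof.
rewrite /nu /L_2; field.
by rewrite ?nz_v ?(lt0r_neq0 L0).
Qed.

Lemma lambdaE n (s : R) : ((1 - v) / L * s)%:C * omega eta n = (alpha * s) +i* (nu n * s).
Proof.
rewrite omegaE nuE /alpha; apply: complex_eq => /=; ring.
Qed.

Lemma alphaM : alpha * M = - ln `|ge|.
Proof.
rewrite /alpha /L_2; field.
by rewrite ?nz_v ?(lt0r_neq0 L0).
Qed.

Lemma nuM n : nu n * M = 2 * pi * (n%:~R + theta).
Proof. by rewrite /nu divfK// M_neq0. Qed.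

Lemma cos_nuM n : cos (nu n * M) = if eta < 1 then -1 else 1.
Proof.
rewrite nuM /theta; case: ifP => _; last by rewrite addr0 cos_int2pi.
have -> : 2 * pi * (n%:~R + 2^-1) = 2 * pi * n%:~R + pi :> R by field.
by rewrite cosD cospi sinpi cos_int2pi mulr0 subr0 mul1r.
Qed.

Lemma sin_nuM n : sin (nu n * M) = 0.
Proof.
rewrite nuM /theta; case: ifP => _; last by rewrite addr0 sin_int2pi.
have -> : 2 * pi * (n%:~R + 2^-1) = 2 * pi * n%:~R + pi :> R by field.
by rewrite sinD cospi sinpi sin_int2pi mulr0 mul0r addr0.
Qed.

Lemma exp_alphaM : expR (- alpha * M) = `|ge|.
Proof. by rewrite mulNr alphaM opprK lnK// posrE norm_ge_gt0. Qed.

Lemma adj_cos_M n : adj_cos n M = - ge.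
Proof.
rewrite /adj_cos exp_alphaM cos_nuM normge; by case: ifP => _; rewrite ?mulrN1 ?mulr1.
Qed.

Lemma adj_sin_M n : adj_sin n M = 0. Proof. by rewrite /adj_sin sin_nuM mulr0 oppr0. Qed.
Lemma adj_cos_0 n : adj_cos n 0 = 1. Proof. by rewrite /adj_cos !mulr0 expR0 cos0 mulr1. Qed.
Lemma adj_sin_0 n : adj_sin n 0 = 0. Proof. by rewrite /adj_sin !mulr0 sin0 mulr0 oppr0. Qed.

Lemma exp_deriv (c x : R) : is_derive x 1 (fun x => expR (c * x)) (c * expR (c * x)).
Proof.
have D : is_derive x 1 (fun x => c * x) c.
  by apply: (derive_cast (is_deriveZ c (is_derive_id x 1))); rewrite /GRing.scale /= mulr1.
by have := is_derive1_comp (f := @expR R) (g := fun x => c * x) (is_derive_expR _) D; rewrite mulrC.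
Qed.
Lemma cosm_deriv (c x : R) : is_derive x 1 (fun x => cos (c * x)) (- c * sin (c * x)).
Proof.
have D : is_derive x 1 (fun x => c * x) c.
  by apply: (derive_cast (is_deriveZ c (is_derive_id x 1))); rewrite /GRing.scale /= mulr1.
by apply: (derive_cast (is_derive1_comp (f := @cos R) (g := fun x => c * x) (is_derive_cos _) D)); ring.
Qed.
Lemma sinm_deriv (c x : R) : is_derive x 1 (fun x => sin (c * x)) (c * cos (c * x)).
Proof.
have D : is_derive x 1 (fun x => c * x) c.
  by apply: (derive_cast (is_deriveZ c (is_derive_id x 1))); rewrite /GRing.scale /= mulr1.
by apply: (derive_cast (is_derive1_comp (f := @sin R) (g := fun x => c * x) (is_derive_sin _) D)); ring.
Qed.

Lemma expcos_deriv (a c x : R) : is_derive x 1 (fun x => expR (a * x) * cos (c * x))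
  (a * (expR (a * x) * cos (c * x)) - c * (expR (a * x) * sin (c * x))).
Proof.
by apply: (derive_cast (is_deriveM (exp_deriv a x) (cosm_deriv c x))); rewrite /GRing.scale /=; ring.
Qed.

Lemma expsin_deriv (a c x : R) : is_derive x 1 (fun x => expR (a * x) * sin (c * x))
  (a * (expR (a * x) * sin (c * x)) + c * (expR (a * x) * cos (c * x))).
Proof.
by apply: (derive_cast (is_deriveM (exp_deriv a x) (sinm_deriv c x))); rewrite /GRing.scale /=; ring.
Qed.

Lemma adj_cos_deriv n (x : R) : is_derive x 1 (adj_cos n) (- alpha * adj_cos n x - (- nu n) * adj_sin n x).
Proof. by apply: (derive_cast (expcos_deriv (- alpha) (nu n) x)); rewrite /adj_cos /adj_sin; ring. Qed.

Lemma adj_sin_deriv n (x : R) : is_derive x 1 (adj_sin n) (- alpha * adj_sin n x + (- nu n) * adj_cos n x).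
Proof. by apply: (derive_cast (is_deriveN (expsin_deriv (- alpha) (nu n) x))); rewrite /adj_cos /adj_sin; ring. Qed.

Lemma adj_cos_cont n : continuous (adj_cos n). Proof. exact: is_derive_cont (adj_cos_deriv n). Qed.
Lemma adj_sin_cont n : continuous (adj_sin n). Proof. exact: is_derive_cont (adj_sin_deriv n). Qed.

(** In the moving frame, the extensions of phi_x and phi_t across the right end
    add up to their unfolding. *)
Lemma ext_unfold (t z : R) (a b : R -> R) :
  ext_x L v t a (z + v * t) + ext_t L v t b (z + v * t) =
  unfold L v (fun y => a (y + v * t)) (fun y => b (y + v * t)) z.
Proof.
rewrite /ext_x /ext_t /unfold ltrD2r; case: ifP => // _.
have -> : reflect_pt L v t (z + v * t) = (M - z) / g + v * t.
  rewrite /reflect_pt /L_2 /gamma_v; field.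
  have -> : 1 + v != 0 by rewrite gt_eqF// ltr_wpDr.
  by rewrite ?nz_v.
by rewrite [RHS]mulrBl.
Qed.

Lemma coefE (p q : R -> R) n : L2 0 L p -> L2 0 L q ->
  coef L v eta p q n = (4 * ge%:C * omega eta n)^-1 *
    ((\int[mu]_(x in `]0, M[) (unfold L v p q x * adj_cos n x)) +i* (\int[mu]_(x in `]0, M[) (unfold L v p q x * adj_sin n x))).
Proof.
move=> Lp Lq; rewrite /coef; congr (_ * _).
have E x : (ext_x L v 0 p x + ext_t L v 0 q x)%:C * expC (- (((1 - v) / L * x)%:C * omega eta n)) =
   (unfold L v p q x * adj_cos n x) +i* (unfold L v p q x * adj_sin n x).
  have := ext_unfold 0 x p q; rewrite mulr0 addr0 => ->.
  have -> : unfold L v (fun y => p (y + 0)) (fun y => q (y + 0)) x = unfold L v p q x.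
    by rewrite /unfold !addr0.
  rewrite lambdaE /=; apply: complex_eq => /=; rewrite /adj_cos /adj_sin mulNr cosN ?sinN; ring.
by rewrite /integralC; congr (_ +i* _); apply: eq_Int => x _; rewrite E.
Qed.

(** A zero real part means |gamma_eta| = 1, hence eta = 0, and then the imaginary
    part is an odd multiple of pi / 2. *)
Lemma omega_neq0 n : omega eta n != 0.
Proof.
rewrite omegaE; apply/eqP => /(congr1 (fun z => (complex.Re z, complex.Im z))) /= [h1 h2].
have l0 : ln `|ge| = 0 by move: h1; lra.
have g1 : `|ge| = 1 by have := lnK (x := `|ge|); rewrite posrE norm_ge_gt0 l0 expR0 => /(_ isT).
move: h2 => /eqP; rewrite mulf_eq0 gt_eqF ?pi_gt0//= /theta.
move: g1; rewrite normge; case: ifP => h.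
  move=> _ /eqP h2; have : ((2 * n + 1)%:~R : R) = 0 by rewrite intrD intrM; move: h2; lra.
  move=> /eqP; rewrite intr_eq0 => /eqP H.
  have : (absz (2 * n)%R = 1)%N by rewrite (_ : (2 * n = -1)%R)// -[RHS]add0r -H; ring.
  by rewrite abszM => /eqP; rewrite -[1%N]/(1%N); case: (absz n) => [|[|k]].
move=> H; exfalso; move: H; rewrite /gamma_eta => /eqP.
move=> H; have := divfK e1' (1 + eta).
have -> : (1 + eta) / (1 - eta) = -1 by rewrite -[LHS]opprK; move/eqP: H => ->.
lra.
Qed.

End Spectrum.

Section Solution.
Variable R : realType.
Local Notation mu := (@lebesgue_measure R).
Variables (L v eta : R).
Hypotheses (L0 : 0 < L) (v0 : 0 <= v) (v1 : v < 1) (e0 : 0 <= eta) (e1 : eta != 1).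
Local Notation g := (gamma_v v).
Local Notation M := (L_2 L v).
Local Notation ge := (gamma_eta eta).
Local Notation th := (theta eta).
Local Notation al := (alpha L v eta).
Local Notation nu := (nu M th).
Local Notation adj_cos := (adj_cos L v eta).
Local Notation adj_sin := (adj_sin L v eta).
Local Notation cos_coef := (cos_coef M th).
Local Notation sin_coef := (sin_coef M th).
Local Notation coef_sqr := (coef_sqr M th).
Variables (phi0 phi0x phi1 : R -> R).
Hypotheses (phi0_H1 : H1r 0 L phi0 phi0x) (phi1_L2 : L2 0 L phi1).
Variables (phi phix phit : R -> R -> R).
Hypothesis sol : is_solution L v eta phi0 phi1 phi phix phit.

Local Notation fold_moment := (fold_moment L v phix phit).

Lemma solH : forall T, 0 < T -> C_H1r L v T phi phix /\ C1_L2 L v T phi phix phit.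
Proof. by case: sol. Qed.
Lemma solW : weak_WP L v eta phi phix phit.
Proof. by case: sol. Qed.

(** phi_t(., 0) and phi1 agree almost everywhere, whereas phi_x(., 0) and phi0x
    are both weak derivatives of phi0, which suffices after integration by
    parts. *)
Lemma fold_moment0 (q q' : R -> R) : (forall x : R, is_derive x 1 q (q' x)) -> continuous q' ->
  fold_moment q 0 = \int[mu]_(x in `]0, M[) (unfold L v phi0x phi1 x * q x).
Proof.
move=> dq cq'; have cq := is_derive_cont dq.
have [[cphi0 Lphi0 Lphi0x Wphi0] phi0L] := phi0_H1.
rewrite (Int_unfold L0 v0 v1 Lphi0x phi1_L2 cq) addrC /fold_moment; congr (_ + _).
  have [_ _ _ [N [mN N0 sN]]] := sol.
  have E : (\int[mu]_(y in `]0%R, L[) (pull v phit 0 y * (q y - q (M - g * y)))%:E =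
            \int[mu]_(y in `]0%R, L[) (phi1 y * (q y - q (M - g * y)))%:E)%E.
    have Lt := (phit_ctsL2 solH).1 0 (lexx _).
    apply: ae_eq_integral => //.
    - apply/measurable_EFinP; have := intgM_cont (L2_intg Lt) (refl_diff_cont (L := L) (v := v) cq).
      by case/integrableP => /measurable_EFinP.
    - apply/measurable_EFinP; have := intgM_cont (L2_intg phi1_L2) (refl_diff_cont (L := L) (v := v) cq).
      by case/integrableP => /measurable_EFinP.
    - exists N; split => // y /=; rewrite -[X in _ -> X]not_notP => H; apply: contra_not H => /= yN.
      move=> y0L; congr (EFin (_ * _)); rewrite /pull mulr0 addr0.
      apply: contrapT => H; apply: yN; apply: sN => /= /(_ _); move: y0L; rewrite in_itv /= => -> /(_ isT).
      exact: H.
  by rewrite /moment /Rintegral E.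
have H0 : H1 0 L (phi^~ 0) (phix^~ 0).
  by have [] := phi_H1r solH (lexx 0); rewrite mulr0 addr0.
have dt' (y : R) : is_derive y 1 (refl_sum L v q) (q' y - g * q' (M - g * y)).
  by apply: (derive_cast (is_deriveD (dq y) (refl_deriv L v y dq))); ring.
have ct' : continuous (fun y => q' y - g * q' (M - g * y)).
  move=> y; apply: cvgB; first exact: cq'.
  by apply: cvgM; [exact: cvg_cst|exact: refl_cont].
have phiE x : 0 <= x <= L -> phi x 0 = phi0 x.
  have [_ _ E _] := sol; have [cphi _ _ _] := H0.
  have /(continuous_within_itvP _ L0)[_ ca cb] := cphi.
  have /(continuous_within_itvP _ L0)[_ ca0 cb0] := cphi0.
  rewrite !le_eqVlt => /andP[/orP[/eqP <-|x0]] xL.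
    apply: (@cvg_unique _ _ (phi0 x @[x --> 0^'+])) => //.
    apply: cvg_trans ca; apply: near_eq_cvg; near=> y; rewrite E//.
    by apply/andP; split; near: y; [exact: nbhs_right_gt|exact: nbhs_right_lt].
  case/orP: xL => [/eqP ->|xL]; last by apply: E; rewrite x0.
  apply: (@cvg_unique _ _ (phi0 x @[x --> L^'-])) => //.
  apply: cvg_trans cb; apply: near_eq_cvg; near=> y; rewrite E//.
  by apply/andP; split; near: y; [exact: nbhs_left_gt|exact: nbhs_left_lt].
have P1 := H1_by_parts L0 H0 dt' ct'.
have P2 := H1_by_parts L0 (proj1 phi0_H1) dt' ct'.
transitivity (\int[mu]_(x in `]0, L[) (phix x 0 * refl_sum L v q x)).
  by rewrite /moment; apply: eq_Int => y _; rewrite /pull mulr0 addr0.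
rewrite P1 [RHS]P2 !phiE ?lexx ?(ltW L0)//; congr (_ - _ - _).
by apply: eq_Int => x /andP[x0 xL]; rewrite phiE// !ltW.
Unshelve. all: by end_near. Qed.

Variable t : R.
Hypothesis t0 : 0 <= t.
Local Notation tau := ((1 + v) * t).
Definition unfolded := unfold L v (pull v phix t) (pull v phit t).
(** The weight compensates the common modulus of the exponentials, which become
    the orthogonal family e^(i nu_n z). *)
Definition weighted z := unfolded z * expR (- al * (tau + z)).

Lemma unfolded_L2 : L2 0 M unfolded.
Proof. by apply: unfold_L2 => //; [exact: (phix_ctsL2 solH).1|exact: (phit_ctsL2 solH).1]. Qed.

Lemma expaff_cont (a b : R) : continuous (fun z : R => expR (a * (b + z))).
Proof.
move=> z; apply: (@continuous_comp _ _ _ (fun z : R => a * (b + z)) expR); last exact: continuous_expR.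
by apply: cvgM; [exact: cvg_cst|apply: cvgD; [exact: cvg_cst|exact: cvg_id]].
Qed.

Lemma weighted_L2 : L2 0 M weighted.
Proof. by apply: L2M_cont; [exact: unfolded_L2|exact: expaff_cont]. Qed.

Lemma fold_momentE q : continuous q -> fold_moment q t = \int[mu]_(z in `]0, M[) (unfolded z * q z).
Proof.
move=> cq; rewrite (Int_unfold L0 v0 v1 _ _ cq) 1?addrC//; [exact: (phix_ctsL2 solH).1|exact: (phit_ctsL2 solH).1].
Qed.

Lemma fold_moment_cos n : fold_moment (adj_cos n) t = expR (al * tau) * cos_coef weighted n.
Proof.
rewrite fold_momentE; last exact: adj_cos_cont.
rewrite -IntZ; last by apply: intgM_cont; [exact: L2_intg weighted_L2|exact: cos_mode_cont].
apply: eq_Int => z _; rewrite /weighted /adj_cos /cos_mode mulrDr expRD !mulNr expRN.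
have E0 : expR (al * tau) != 0 by rewrite gt_eqF ?expR_gt0.
have E1 : expR (al * z) != 0 by rewrite gt_eqF ?expR_gt0.
by rewrite !expRN; field; rewrite E0 E1.
Qed.

Lemma fold_moment_sin n : fold_moment (adj_sin n) t = - (expR (al * tau) * sin_coef weighted n).
Proof.
rewrite fold_momentE; last exact: adj_sin_cont.
rewrite -IntZ; last by apply: intgM_cont; [exact: L2_intg weighted_L2|exact: sin_mode_cont].
rewrite -IntN; last by apply: intgZ; apply: intgM_cont; [exact: L2_intg weighted_L2|exact: sin_mode_cont].
apply: eq_Int => z _; rewrite /weighted /adj_sin /sin_mode mulrDr expRD !mulNr expRN.
have E0 : expR (al * tau) != 0 by rewrite gt_eqF ?expR_gt0.
have E1 : expR (al * z) != 0 by rewrite gt_eqF ?expR_gt0.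
by rewrite !expRN; field; rewrite E0 E1.
Qed.

Definition data_cos n := \int[mu]_(x in `]0, M[) (unfold L v phi0x phi1 x * adj_cos n x).
Definition data_sin n := \int[mu]_(x in `]0, M[) (unfold L v phi0x phi1 x * adj_sin n x).

(** By conservation, the coefficients of the data are those of the weighted
    profile at time t, rotated by the angle nu_n tau. *)
Lemma data_coefE n : data_cos n = cos (nu n * tau) * cos_coef weighted n - sin (nu n * tau) * sin_coef weighted n /\
  data_sin n = - (sin (nu n * tau) * cos_coef weighted n + cos (nu n * tau) * sin_coef weighted n).
Proof.
have dC x := adj_cos_deriv L v eta n x; have dS x := adj_sin_deriv L v eta n x.
have cC := adj_cos_cont (L := L) (v := v) (eta := eta) (n := n).
have cS := adj_sin_cont (L := L) (v := v) (eta := eta) (n := n).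
have cC' : continuous (fun x => - al * adj_cos n x - - nu n * adj_sin n x).
  by move=> x; apply: cvgB; apply: cvgM; [exact: cvg_cst|exact: cC|exact: cvg_cst|exact: cS].
have cS' : continuous (fun x => - al * adj_sin n x + - nu n * adj_cos n x).
  by move=> x; apply: cvgD; apply: cvgM; [exact: cvg_cst|exact: cS|exact: cvg_cst|exact: cC].
have CM : (1 - eta) * adj_cos n M = - (1 + eta).
  by rewrite adj_cos_M// /gamma_eta mulrN mulrCA divff ?e1'// mulr1.
have [] := conservation L0 v1 solH solW dC dS (fun=> erefl) (fun=> erefl) (adj_cos_0 _ _ _ _) (adj_sin_0 _ _ _ _) CM (adj_sin_M eta L0 v1 n) t0.
rewrite (fold_moment0 dC cC') (fold_moment0 dS cS') -/(data_cos n) -/(data_sin n) fold_moment_cos fold_moment_sin => <- <-.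
have E : expR (- al * tau) * expR (al * tau) = 1 by rewrite -expRD mulNr addNr expR0.
by rewrite /adj_cos /adj_sin; split; ring: E.
Qed.

Lemma coef_data n : coef L v eta phi0x phi1 n = (4 * ge%:C * omega eta n)^-1 * (data_cos n +i* data_sin n).
Proof. by have [[_ _ ? _] _] := phi0_H1; rewrite coefE. Qed.

Lemma sqnormC_M (z w : R[i]) : sqnormC (z * w) = sqnormC z * sqnormC w.
Proof. by case: z w => [a b] [c d]; rewrite /sqnormC /=; ring. Qed.

Lemma sqnorm_coef n : sqnormC (omega eta n * coef L v eta phi0x phi1 n) = (16 * ge ^+ 2)^-1 * coef_sqr weighted n.
Proof.
have w0 := omega_neq0 e0 e1 n; have g0 := ge_neq0 e0 e1.
have -> : omega eta n * coef L v eta phi0x phi1 n = ((4 * ge)^-1)%:C * (data_cos n +i* data_sin n).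
  rewrite coef_data mulrA; congr (_ * _).
  have gC : ge%:C != 0 by rewrite (fmorph_eq0 (@real_complex R)).
  have -> : ((4 * ge)^-1)%:C = (4 * ge%:C)^-1 by rewrite fmorphV rmorphM rmorph_nat.
  by field; rewrite gC w0.
rewrite sqnormC_M /sqnormC /=; have [-> ->] := data_coefE n.
have := cos2Dsin2 (nu n * tau).
set c := cos _; set s := sin _; move=> H.
transitivity ((16 * ge ^+ 2)^-1 * ((c ^+ 2 + s ^+ 2) * coef_sqr weighted n)); last by rewrite H mul1r.
by rewrite /coef_sqr; field; exact: g0.
Qed.

(** The rotation does not affect the moduli, so that Parseval's identity for the
    weighted profile at time t is the claim. *)
Lemma energy : let E := (\int[@lebesgue_measure R]_(x in `](v * t)%R, (M + v * t)%R[)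
            (expR ((1 - v) / L * ln `|ge| * (t + x)) *
             (ext_x L v t (phix^~ t) x + ext_t L v t (phit^~ t) x) ^+ 2)%:E)%E in
        (\esum_(n in [set: int])
            (sqnormC (omega eta n * coef L v eta phi0x phi1 n))%:E
         = (L / (8 * (1 - v) * ge ^+ 2))%:E * E)%E
        /\ (E < +oo)%E.
Proof.
move=> E.
have g0 := ge_neq0 e0 e1.
pose H x := expR ((1 - v) / L * ln `|ge| * (t + x)) *
             (ext_x L v t (phix^~ t) x + ext_t L v t (phit^~ t) x) ^+ 2.
have HE z : H (z + v * t) = weighted z ^+ 2.
  rewrite /H ext_unfold// -/(pull v phix t) -/(pull v phit t) -/unfolded /weighted exprMn mulrC; congr (_ * _).
  rewrite expr2 -expRD; congr expR; rewrite /alpha; field; exact: lt0r_neq0.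
have LF : L2 (v * t) (M + v * t) (fun x => weighted (x - v * t)).
  apply: (@L2_shift R (v * t) (M + v * t) (- (v * t)) weighted); rewrite subrr addrK; exact: weighted_L2.
have IH : intg (v * t) (M + v * t) H.
  by apply: eq_intg (L2_sqr LF) => x _; rewrite -HE subrK.
have EE : E = (\int[mu]_(z in `]0, M[) (weighted z ^+ 2))%:E.
  transitivity ((\int[mu]_(x in `](v * t), (M + v * t)[) H x)%:E).
    by rewrite /Rintegral fineK//; exact: integrable_fin_num.
  congr EFin; have := @Int_shift R 0 M (v * t) H; rewrite add0r => ->//.
  by apply: eq_Int => z _; rewrite HE.
rewrite EE; split; last exact: ltry.
have g16 : 0 <= (16 * ge ^+ 2)^-1 by rewrite invr_ge0 mulr_ge0// sqr_ge0.
(* rescaling the profile absorbs the factor 1 / (4 gamma_eta) of the coefficients *)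
pose c := (4 * ge)^-1.
have Lc : L2 0 M (fun z => c * weighted z) := L2Z c weighted_L2.
have := parseval th (L_2_gt0 L0 v1) Lc.
rewrite (eq_esum (b := fun n => (sqnormC (omega eta n * coef L v eta phi0x phi1 n))%:E)); last first.
  move=> n _; congr EFin; rewrite sqnorm_coef.
  have EA : cos_coef (fun z => c * weighted z) n = c * cos_coef weighted n.
    rewrite /cos_coef -IntZ; first by apply: eq_Int => x _; rewrite mulrA.
    by apply: intgM_cont; [exact: L2_intg weighted_L2|exact: cos_mode_cont].
  have EB : sin_coef (fun z => c * weighted z) n = c * sin_coef weighted n.
    rewrite /sin_coef -IntZ; first by apply: eq_Int => x _; rewrite mulrA.
    by apply: intgM_cont; [exact: L2_intg weighted_L2|exact: sin_mode_cont].
  by rewrite /coef_sqr -/(cos_coef _ _) -/(sin_coef _ _) EA EB /c; field.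
move=> ->; rewrite -EFinM; congr EFin.
rewrite (@eq_Int _ _ _ _ (fun x => c ^+ 2 * weighted x ^+ 2)); last by move=> x _; rewrite exprMn.
rewrite IntZ; last exact: L2_sqr weighted_L2.
by rewrite /c /L_2; field; rewrite g0 nz_v.
Qed.

End Solution.

(** * The pointwise series *)

Section Restrict.
Variable R : realType.
Local Notation mu := (@lebesgue_measure R).
Implicit Types (a b c d : R) (f : R -> R).

Definition restr c d f z := if c < z < d then f z else 0.

Lemma restr_in c d f z : c < z < d -> restr c d f z = f z.
Proof. by rewrite /restr => ->. Qed.
Lemma restr_le c d f z : z <= c -> restr c d f z = 0.
Proof. by move=> zc; rewrite /restr ltNge zc. Qed.
Lemma restr_ge c d f z : d <= z -> restr c d f z = 0.
Proof. by move=> zc; rewrite /restr andbC ltNge zc. Qed.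

Lemma L2_restr a b c d f : L2 c d f -> L2 a b (restr c d f).
Proof.
move=> Lf; have L0 p q : L2 p q (fun=> 0 : R) by apply: L2_cont; exact: cst_continuous.
apply: (@L2S _ (Num.min a c) (Num.max b d)); rewrite ?ge_min ?le_max ?lexx//.
apply: (@L2_cat _ _ c); first by apply: eq_L2 (L0 _ _) => x /andP[_ xc]; rewrite restr_le// ltW.
apply: (@L2_cat _ _ d); last by apply: eq_L2 (L0 _ _) => x /andP[dx _]; rewrite restr_ge// ltW.
by apply: eq_L2 Lf => x xcd; rewrite restr_in.
Qed.

Lemma Int_restr a b c d f : a <= c -> c <= d -> d <= b -> intg a b (restr c d f) ->
  \int[mu]_(x in `]a, b[) restr c d f x = \int[mu]_(x in `]c, d[) f x.
Proof.
move=> ac cd db I.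
rewrite (Int_cat ac (le_trans cd db) I) (Int_cat cd db (intgS ac (lexx _) I)).
rewrite (@eq_Int _ a c _ (fun=> 0)); last by move=> x /andP[_ xc]; rewrite restr_le// ltW.
rewrite (@eq_Int _ d b _ (fun=> 0)); last by move=> x /andP[dx _]; rewrite restr_ge// ltW.
rewrite Int0 Int0 add0r addr0; apply: eq_Int => x; exact: restr_in.
Qed.

End Restrict.

Section Pointwise.
Variable R : realType.
Local Notation mu := (@lebesgue_measure R).
Variables (L v eta : R).
Hypotheses (L0 : 0 < L) (v0 : 0 <= v) (v1 : v < 1) (e0 : 0 <= eta) (e1 : eta != 1).
Local Notation g := (gamma_v v).
Local Notation M := (L_2 L v).
Local Notation ge := (gamma_eta eta).
Local Notation th := (theta eta).
Local Notation al := (alpha L v eta).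
Local Notation nu := (nu M th).
Local Notation cos_coef := (cos_coef M th).
Local Notation sin_coef := (sin_coef M th).
Variables (phi0 phi0x phi1 : R -> R).
Hypotheses (phi0_H1 : H1r 0 L phi0 phi0x) (phi1_L2 : L2 0 L phi1).
Variables (phi phix phit : R -> R -> R).
Hypothesis sol : is_solution L v eta phi0 phi1 phi phix phit.
Variables (t x : R).
Hypotheses (t0 : 0 <= t) (xI : v * t < x < L + v * t).
Local Notation tau := ((1 + v) * t).
Local Notation y := (x - v * t).
Local Notation unfolded := (unfolded L v phix phit t).
Local Notation weighted := (weighted L v eta phix phit t).

Let y0L : 0 < y < L.
Proof. by move: xI; rewrite subr_gt0 ltrBlDr. Qed.
Let yL : y < L. Proof. by case/andP: y0L. Qed.
Let y0 : 0 < y. Proof. by case/andP: y0L. Qed.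
Let g0 : 0 < g. Proof. exact: gamma_v_gt0. Qed.
Let yq : y <= M - g * y.
Proof.
have := L_2E L v1; have : g * y <= g * L by rewrite ler_pM2l// ltW.
have := yL; lra.
Qed.
Let qM : M - g * y <= M. Proof. by rewrite lerBlDr lerDl mulr_ge0// ltW. Qed.

(** phi vanishes at the right end, and phi_t, continued oddly, does not contribute
    to the integral over the symmetric interval. *)
Lemma phi_unfolded : phi x t = - 2^-1 * \int[mu]_(z in `]y, M - g * y[) unfolded z.
Proof.
have [H phiL] := phi_H1r (solH sol) t0.
have [_ _ Lx _] := H.
have vL : v * t < L + v * t by rewrite ltrDr.
have [/ltW x0 /ltW xL] := andP xI.
have Lp := (phix_ctsL2 (solH sol)).1 t t0; have Lq := (phit_ctsL2 (solH sol)).1 t t0.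
rewrite /unfolded Int_unfold_mid ?(ltW y0) ?(ltW yL)// mulrA mulNr mulVf ?pnatr_eq0// mulN1r.
have A := H1_AC vL H.
have := A (L + v * t); rewrite lexx (ltW vL) phiL => /(_ isT).
rewrite (Int_cat x0 xL (L2_intg Lx)) addrA -(A x) ?x0// => /eqP; rewrite eq_sym addr_eq0 => /eqP ->.
congr (- _); have := @Int_shift R y L (v * t) (phix^~ t); rewrite subrK => <-//.
exact: intgS x0 (lexx _) (L2_intg Lx).
Qed.

(** The weight of [weighted] is undone here: the pairing with the window is the
    integral of the unfolded profile over ]y, M - g y[. *)
Definition window := restr y (M - g * y) (fun z => expR (al * (tau + z))).

Lemma window_L2 : L2 0 M window.
Proof. by apply: L2_restr; apply: L2_cont; exact: expaff_cont. Qed.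

Lemma Int_restr0 f : L2 0 M (restr y (M - g * y) f) ->
  \int[mu]_(z in `]0, M[) restr y (M - g * y) f z = \int[mu]_(z in `]y, M - g * y[) f z.
Proof. by move=> Lf; apply: Int_restr => //; [exact: ltW|exact: L2_intg]. Qed.

Lemma Int_weighted_window : \int[mu]_(z in `]0, M[) (weighted z * window z) = \int[mu]_(z in `]y, M - g * y[) unfolded z.
Proof.
rewrite -Int_restr0; last by apply: L2_restr; apply: (L2S (ltW y0) qM); exact: (unfolded_L2 v0 v1 sol t0).
apply: eq_Int => z _; rewrite /window /restr; case: ifP => _; last by rewrite mulr0.
by rewrite /weighted -mulrA -expRD mulNr addNr expR0 mulr1.
Qed.

Definition win_cos n := \int[mu]_(z in `]y, M - g * y[) (expR (al * (tau + z)) * cos (nu n * (tau + z))).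
Definition win_sin n := \int[mu]_(z in `]y, M - g * y[) (expR (al * (tau + z)) * sin (nu n * (tau + z))).

Lemma cosaff_cont (a b : R) : continuous (fun z : R => cos (a * (b + z))).
Proof.
move=> z; apply: (@continuous_comp _ _ _ (fun z : R => a * (b + z)) cos); last exact: continuous_cos.
by apply: cvgM; [exact: cvg_cst|apply: cvgD; [exact: cvg_cst|exact: cvg_id]].
Qed.
Lemma sinaff_cont (a b : R) : continuous (fun z : R => sin (a * (b + z))).
Proof.
move=> z; apply: (@continuous_comp _ _ _ (fun z : R => a * (b + z)) sin); last exact: continuous_sin.
by apply: cvgM; [exact: cvg_cst|apply: cvgD; [exact: cvg_cst|exact: cvg_id]].
Qed.

Lemma cos_coef_window n : cos_coef window n = \int[mu]_(z in `]y, M - g * y[) (expR (al * (tau + z)) * cos_mode M th n z).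
Proof.
rewrite -Int_restr0; last by apply: L2_restr; apply: L2M_cont; [apply: L2_cont; exact: expaff_cont|exact: cos_mode_cont].
by apply: eq_Int => z _; rewrite /window /restr; case: ifP => _; rewrite ?mul0r.
Qed.
Lemma sin_coef_window n : sin_coef window n = \int[mu]_(z in `]y, M - g * y[) (expR (al * (tau + z)) * sin_mode M th n z).
Proof.
rewrite -Int_restr0; last by apply: L2_restr; apply: L2M_cont; [apply: L2_cont; exact: expaff_cont|exact: sin_mode_cont].
by apply: eq_Int => z _; rewrite /window /restr; case: ifP => _; rewrite ?mul0r.
Qed.

Lemma win_coefE n : win_cos n = cos (nu n * tau) * cos_coef window n - sin (nu n * tau) * sin_coef window n /\
  win_sin n = sin (nu n * tau) * cos_coef window n + cos (nu n * tau) * sin_coef window n.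
Proof.
have IA : intg y (M - g * y) (fun z => expR (al * (tau + z)) * cos_mode M th n z).
  by apply: intgM_cont; [apply: intg_cont; exact: expaff_cont|exact: cos_mode_cont].
have IB : intg y (M - g * y) (fun z => expR (al * (tau + z)) * sin_mode M th n z).
  by apply: intgM_cont; [apply: intg_cont; exact: expaff_cont|exact: sin_mode_cont].
rewrite cos_coef_window sin_coef_window; split; rewrite -!IntZ// -?IntB -?IntD; try exact: intgZ.
  by apply: eq_Int => z _; rewrite [nu n * _]mulrDr cosD /cos_mode /sin_mode; ring.
by apply: eq_Int => z _; rewrite [nu n * _]mulrDr sinD /cos_mode /sin_mode; ring.
Qed.

Definition exp_cos n s : R := expR (al * s) * cos (nu n * s).
Definition exp_sin n s : R := expR (al * s) * sin (nu n * s).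

Lemma shift_deriv (f f' : R -> R) (b z : R) : (forall x : R, is_derive x 1 f (f' x)) ->
  is_derive z 1 (fun z => f (b + z)) (f' (b + z)).
Proof.
move=> df; have D : is_derive z 1 (fun z => b + z) (1 : R).
  by apply: (derive_cast (is_deriveD (is_derive_cst b z 1) (is_derive_id z 1))); rewrite add0r.
by have := is_derive1_comp (f := f) (g := fun z => b + z) (df _) D; rewrite mulr1.
Qed.

Lemma win_FTC n : al * win_cos n - nu n * win_sin n = exp_cos n (tau + (M - g * y)) - exp_cos n (tau + y) /\
  nu n * win_cos n + al * win_sin n = exp_sin n (tau + (M - g * y)) - exp_sin n (tau + y).
Proof.
have IC : intg y (M - g * y) (fun z => expR (al * (tau + z)) * cos (nu n * (tau + z))).
  by apply: intgM_cont; [apply: intg_cont; exact: expaff_cont|exact: cosaff_cont].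
have IS : intg y (M - g * y) (fun z => expR (al * (tau + z)) * sin (nu n * (tau + z))).
  by apply: intgM_cont; [apply: intg_cont; exact: expaff_cont|exact: sinaff_cont].
have cC : continuous (fun z => expR (al * (tau + z)) * cos (nu n * (tau + z))).
  by move=> z; apply: cvgM; [exact: expaff_cont|exact: cosaff_cont].
have cS : continuous (fun z => expR (al * (tau + z)) * sin (nu n * (tau + z))).
  by move=> z; apply: cvgM; [exact: expaff_cont|exact: sinaff_cont].
split.
- rewrite -!IntZ// -IntB; try exact: intgZ.
  rewrite -(@Int_FTC _ _ _ (fun z => exp_cos n (tau + z)) _ yq (fun z => shift_deriv tau z (expcos_deriv al (nu n))))//.
  by move=> z; apply: cvgB; apply: cvgM; [exact: cvg_cst|exact: cC|exact: cvg_cst|exact: cS].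
- rewrite -!IntZ// addrC -IntD; try exact: intgZ.
  rewrite -(@Int_FTC _ _ _ (fun z => exp_sin n (tau + z)) _ yq (fun z => shift_deriv tau z (expsin_deriv al (nu n))))//.
  by move=> z; apply: cvgD; apply: cvgM; [exact: cvg_cst|exact: cS|exact: cvg_cst|exact: cC].
Qed.

Let gE : g * (1 - v) = 1 + v. Proof. exact: gamma_vM. Qed.

Lemma exp_alM : expR (al * M) = `|ge|^-1.
Proof.
by rewrite -(exp_alphaM L0 v1 e0 e1) mulNr expRN invrK.
Qed.

Lemma exp_mode_M n s : exp_cos n (s + M) = - (ge^-1 * exp_cos n s) /\ exp_sin n (s + M) = - (ge^-1 * exp_sin n s).
Proof.
rewrite /exp_cos /exp_sin !mulrDr expRD exp_alM cosD sinD cos_nuM// sin_nuM// normge//.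
have gn := ge_neq0 e0 e1.
by case: ifP => _; split; field.
Qed.

Lemma modeE n : mode L v eta n x t =
  (ge * exp_cos n (tau + y) + exp_cos n (g * (t - x))) +i* (ge * exp_sin n (tau + y) + exp_sin n (g * (t - x))).
Proof.
have ty : tau + y = t + x by ring.
rewrite /mode; have -> : (1 + v) / L * (t - x) = (1 - v) / L * (g * (t - x)) by rewrite -gE; ring.
by rewrite !lambdaE// ty; apply: complex_eq => /=; rewrite /exp_cos /exp_sin; ring.
Qed.

(** The integral of e^(lambda (tau + z)) over the window, for
    lambda = (1 - v) / L omega_n, is a difference of two exponentials, and
    e^(lambda M) = - 1 / gamma_eta turns it into the two terms of the mode. *)
Lemma mode_win n : mode L v eta n x t =
  - (ge * ((1 - v) / L))%:C * omega eta n * (win_cos n +i* win_sin n).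
Proof.
have [A B] := win_FTC n.
have E : tau + (M - g * y) = g * (t - x) + M by rewrite -gE; ring.
move: A B; rewrite E; have [-> ->] := exp_mode_M n (g * (t - x)) => A B.
have gn := ge_neq0 e0 e1.
have W : ((1 - v) / L)%:C * omega eta n = al +i* nu n.
  by have := lambdaE L0 v1 e0 n 1; rewrite !mulr1.
have -> : - (ge * ((1 - v) / L))%:C * omega eta n = - ge%:C * (al +i* nu n).
  by rewrite -W rmorphM; ring.
rewrite modeE; apply: complex_eq => /=.
  transitivity (- ge * (al * win_cos n - nu n * win_sin n)); last by ring.
  by rewrite A; field.
transitivity (- ge * (nu n * win_cos n + al * win_sin n)); last by ring.
by rewrite B; field.
Qed.

(** The rotations of the two factors are inverse to each other. *)
Lemma coef_mode n : coef L v eta phi0x phi1 n * mode L v eta n x t =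
  (- ((1 - v) / (4 * L)) * (cos_coef weighted n * cos_coef window n + sin_coef weighted n * sin_coef window n)) +i*
  (((1 - v) / (4 * L)) * (sin_coef weighted n * cos_coef window n - cos_coef weighted n * sin_coef window n)).
Proof.
rewrite (coef_data L0 v0 v1 e0 phi0_H1 phi1_L2) mode_win.
have w0 := omega_neq0 e0 e1 n; have gn := ge_neq0 e0 e1.
have gC : ge%:C != 0 by rewrite (fmorph_eq0 (@real_complex R)).
have [cE sE] := data_coefE L0 v0 v1 e0 e1 phi0_H1 phi1_L2 sol t0 n.
have [iE jE] := win_coefE n.
transitivity (- ((1 - v) / (4 * L))%:C * ((data_cos L v eta phi0x phi1 n +i* data_sin L v eta phi0x phi1 n) * (win_cos n +i* win_sin n))).
  have -> : ((1 - v) / (4 * L))%:C = 4^-1 * ((1 - v) / L)%:C.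
    have -> : (1 - v) / (4 * L) = 4^-1 * ((1 - v) / L) by field; exact: lt0r_neq0.
    by rewrite rmorphM fmorphV rmorph_nat.
  set K := (1 - v) / L; rewrite (rmorphM _ ge K) /=; set KC := K%:C; set G := ge%:C in gC *.
  set C1 := (_ +i* _); set C2 := (win_cos n +i* _).
  by field; rewrite gC w0.
have := cos2Dsin2 (nu n * tau); rewrite cE sE iE jE.
set c := cos _; set s := sin _ => H.
set k := (1 - v) / (4 * L).
apply: complex_eq => /=.
  transitivity (- k * ((c ^+ 2 + s ^+ 2) * (cos_coef weighted n * cos_coef window n + sin_coef weighted n * sin_coef window n))); first by ring.
  by rewrite H mul1r.
transitivity (k * ((c ^+ 2 + s ^+ 2) * (sin_coef weighted n * cos_coef window n - cos_coef weighted n * sin_coef window n))); first by ring.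
by rewrite H mul1r.
Qed.

Lemma seriesZ (k : R) (u : nat -> R) (l : R) : series u @ \oo --> l -> series (fun n => k * u n) @ \oo --> k * l.
Proof.
move=> ul; rewrite (_ : series _ = (fun n => k * series u n)); first by apply: cvgM => //; exact: cvg_cst.
by apply/funext => n; rewrite /series /= mulr_sumr.
Qed.

(** The polarised Parseval identity for the weighted profile and the window. *)
Lemma pointwise_series :
  sumZ_to (fun n => coef L v eta phi0x phi1 n * mode L v eta n x t) (phi x t)%:C.
Proof.
have [[l1 [l2 [c1 c2 l12]]] [m1 [m2 [d1 d2 m12]]]] :=
  pairing th (L_2_gt0 L0 v1) (weighted_L2 v0 v1 sol t0) window_L2.
pose k := (1 - v) / (4 * L).
exists ((- k * l1) +i* (k * m1)), ((- k * l2) +i* (k * m2)); split.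
- rewrite (_ : series _ = fun N => series (fun k' : nat => - k * (cos_coef weighted k' * cos_coef window k' + sin_coef weighted k' * sin_coef window k')) N +i*
     series (fun k' : nat => k * (sin_coef weighted k' * cos_coef window k' - cos_coef weighted k' * sin_coef window k')) N).
    by apply: cvg_complex; exact: seriesZ.
  by apply/funext => N; rewrite -series_complex /series /=; apply: eq_bigr => i _; rewrite coef_mode.
- rewrite (_ : series _ = fun N => series (fun k' : nat => - k * (cos_coef weighted (Negz k') * cos_coef window (Negz k') + sin_coef weighted (Negz k') * sin_coef window (Negz k'))) N +i*
     series (fun k' : nat => k * (sin_coef weighted (Negz k') * cos_coef window (Negz k') - cos_coef weighted (Negz k') * sin_coef window (Negz k'))) N).
    by apply: cvg_complex; exact: seriesZ.
  by apply/funext => N; rewrite -series_complex /series /=; apply: eq_bigr => i _; rewrite coef_mode.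
apply: complex_eq => /=; last by rewrite -mulrDr m12 mulr0.
rewrite -mulrDr l12 Int_weighted_window phi_unfolded /k /L_2; field.
by rewrite nz_v// lt0r_neq0.
Qed.

End Pointwise.

(** * Translations in L^2 *)

Section Translation.
Variable R : realType.
Local Notation mu := (@lebesgue_measure R).
Implicit Types (h p G : R -> R).

Lemma Int_mono (a b c d : R) p : a <= c -> c <= d -> d <= b -> (forall x, 0 <= p x) -> intg a b p ->
  \int[mu]_(x in `]c, d[) p x <= \int[mu]_(x in `]a, b[) p x.
Proof.
move=> ac cd db p0 Ip.
rewrite (Int_cat ac (le_trans cd db) Ip) (Int_cat cd db (intgS ac (lexx _) Ip)).
by rewrite addrCA lerDl addr_ge0//; apply: Int_ge0.
Qed.

Lemma prim_cont p : (forall a b, intg a b p) -> continuous (prim p).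
Proof.
move=> Ip x.
have I := Ip (x - 1) (x + 1).
have xx : x - 1 <= x + 1 by lra.
have := Int_prim_cont xx I.
have xl : x - 1 < x + 1 by lra.
move=> /(continuous_within_itvP _ xl)[C _ _].
rewrite /continuous_at (_ : prim p x = prim p (x - 1) + \int[mu]_(y in `]x - 1, x[) p y); last first.
  by rewrite -primB//; [rewrite addrC subrK|lra].
have E : {near x, (fun y => prim p (x - 1) + \int[mu]_(z in `]x - 1, y[) p z) =1 prim p}.
  apply/nbhs_ballP; exists 1 => //= y; rewrite /ball /= ltr_norml => /andP[y1 y2].
  by rewrite -primB//; [rewrite addrC subrK|lra].
apply: cvg_trans; first exact: (near_eq_cvg E).
apply: cvgD; first exact: cvg_cst.
by apply: C; rewrite in_itv /=; apply/andP; split; lra.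
Qed.

Lemma sliding_cont p (a b : R) : (forall a b, intg a b p) -> a <= b ->
  continuous (fun z => \int[mu]_(u in `]z + a, z + b[) p u).
Proof.
move=> Ip ab; have cp := prim_cont Ip.
have cs (c : R) : continuous (fun z => prim p (z + c)) by exact: shift_cont.
rewrite (_ : (fun z => _) = (fun z => prim p (z + b) - prim p (z + a))).
  by move=> z; apply: cvgB; exact: cs.
by apply/funext => z; rewrite primB// lerD2l.
Qed.

(** The compactness of [A, B] is used in its covering form, with neighbourhoods
    in z and s jointly. *)
Lemma unif_transl G (A B t e : R) : continuous G -> 0 < e ->
  exists2 d, 0 < d & forall s z, `|t - s| < d -> A <= z <= B -> `|G (z + s) - G (z + t)| < e.
Proof.
move=> cG e0.
have K := @segment_compact R A B.
move/compact_near_coveringP : K => K.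
have := K _ (nbhs t) (fun s z => `|G (z + s) - G (z + t)| < e) (nbhs_filter t).
case.
  move=> z _.
  have e2 : 0 < e / 2 by rewrite divr_gt0.
  have /cvgrPdist_lt /(_ _ e2) /nbhs_ballP[d /= d0 Hd] := cG (z + t).
  have d2 : 0 < d / 2 by rewrite divr_gt0.
  exists (ball z (d / 2), ball t (d / 2)); first by split; exact: nbhsx_ballx.
  move=> [z' s] [/= zz ts]; rewrite /ball /= in zz ts.
  have H1 : `|G (z + t) - G (z' + s)| < e / 2.
    apply: Hd; rewrite /ball /= opprD addrACA.
    by apply: le_lt_trans (ler_normD _ _) _; rewrite [ltRHS]splitr ltrD.
  have H2 : `|G (z + t) - G (z' + t)| < e / 2.
    apply: Hd; rewrite /ball /= opprD addrACA subrr addr0.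
    by apply: lt_le_trans zz _; rewrite ler_pdivrMr// ler_pMr// ler1n.
  have -> : G (z' + s) - G (z' + t) = - (G (z + t) - G (z' + s)) + (G (z + t) - G (z' + t)) by ring.
  by apply: le_lt_trans (ler_normD _ _) _; rewrite normrN [ltRHS]splitr ltrD.
move=> d /= d0 Hd; exists d => // s z ts zAB; apply: Hd => //=.
Qed.

Lemma L2_approx h (a b e : R) : a < b -> L2 a b h -> 0 < e ->
  exists2 G, continuous G & \int[mu]_(x in `]a, b[) ((h x - G x) ^+ 2) < e.
Proof.
move=> ab Lh e0.
have l0 : 0 < b - a by rewrite subr_gt0.
have Ls : L2 0 (b - a) (fun x => h (x + a)) by apply: L2_shift; rewrite add0r subrK.
have [g [C [cg gC Hg]]] := cont_dense Ls e0.
have cs : continuous (fun x => g (x - a)) by exact: (shift_cont (c := - a) cg).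
exists (fun x => g (x - a)) => //.
have L' : L2 a b (fun x => g (x - a)) by exact: L2_cont.
have := @Int_shift R 0 (b - a) a (fun x => (h x - g (x - a)) ^+ 2).
rewrite add0r subrK => ->; last by apply: L2_sqr; exact: L2B.
by apply: le_lt_trans Hg; rewrite le_eqVlt; apply/orP; left; apply/eqP; apply: eq_Int => x _; rewrite addrK.
Qed.

Lemma small_sq (w e : R) : 0 <= w -> 0 < e -> exists2 e1, 0 < e1 & e1 ^+ 2 * w < e.
Proof.
move=> w0 e0; exists (Num.min 1 (e / (w + 1))).
  by rewrite lt_min ltr01 divr_gt0// ltr_wpDl.
set m := Num.min _ _; have m1 : m <= 1 by rewrite ge_min lexx.
have m2 : m <= e / (w + 1) by rewrite ge_min lexx orbT.
have m0 : 0 < m by rewrite lt_min ltr01 divr_gt0// ltr_wpDl.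
have h : m * (w + 1) <= e by rewrite -ler_pdivlMr// ltr_wpDl.
apply: lt_le_trans h; rewrite expr2 -mulrA ltr_pM2l//.
by apply: le_lt_trans (_ : w < w + 1); [rewrite ler_piMl|rewrite ltrDl].
Qed.

Lemma sqr3 (x y z : R) : (x + y + z) ^+ 2 <= 3 * x ^+ 2 + (3 * y ^+ 2 + 3 * z ^+ 2).
Proof. have := sqr_ge0 (x - y); have := sqr_ge0 (x - z); have := sqr_ge0 (y - z); nra. Qed.

Lemma Int_window (A B c d : R) : A <= B -> c <= d ->
  \int[mu]_(z in `]A, B[) restr c d (fun=> 1) z = clamp A B d - clamp A B c.
Proof.
move=> AB cd.
have /andP[h1 _] := clamp_bd c AB; have /andP[_ h3] := clamp_bd d AB.
have h2 : clamp A B c <= clamp A B d.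
  by rewrite /clamp; case: (ltP c A) => ?; case: (ltP d A) => ?; do ?case: (ltP B) => ?; lra.
rewrite (@eq_Int _ _ _ _ (restr (clamp A B c) (clamp A B d) (fun=> 1))).
  rewrite Int_restr// ?Int_cst ?mul1r//.
  apply: L2_intg; apply: L2_restr; apply: L2_cont; exact: cst_continuous.
move=> z /andP[Az zB]; rewrite /restr; congr (if _ && _ then _ else _).
  by rewrite /clamp; case: (ltP c A) => ?; [rewrite Az; lra|case: (ltP B c) => ?//; lra].
by rewrite /clamp; case: (ltP d A) => ?; [lra|case: (ltP B d) => ?//; lra].
Qed.

Lemma restr_intg (a b c d : R) p : (forall a b, intg a b p) -> intg a b (restr c d p).
Proof.
move=> Ip; have I0 r q : intg r q (fun=> 0 : R) by apply: intg_cont; exact: cst_continuous.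
apply: (@intgS _ (Num.min a c) (Num.max b d)); rewrite ?ge_min ?le_max ?lexx//.
apply: (@intg_cat _ _ c); first by apply: eq_intg (I0 _ _) => x /andP[_ xc]; rewrite restr_le// ltW.
apply: (@intg_cat _ _ d); last by apply: eq_intg (I0 _ _) => x /andP[dx _]; rewrite restr_ge// ltW.
by apply: eq_intg (Ip c d) => x xcd; rewrite restr_in.
Qed.

(** When z varies, a given u lies in ]z + a, z + b[ for a set of z of length at
    most b - a. *)
Lemma sliding p (A B a b : R) : (forall x, 0 <= p x) -> (forall a b, intg a b p) -> A <= B -> a <= b ->
  \int[mu]_(z in `]A, B[) (\int[mu]_(u in `]z + a, z + b[) p u) <= (b - a) * \int[mu]_(u in `]A + a, B + b[) p u.
Proof.
move=> p0 Ip AB ab.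
pose i (x : R) : R := \1_`]0, +oo[ x.
pose K (z u : R) : R := i (u - a - z) * i (z + b - u).
have iE (x : R) : i x = ((0 < x)%R)%:R.
  by rewrite /i indicE mem_setE /= in_itv /= andbT.
have KE z u : K z u = restr (z + a) (z + b) (fun=> 1) u.
  have E : u - a - z = u - (z + a) by ring.
  rewrite /K !iE /restr E subr_gt0 subr_gt0.
  by case: (z + a < u); case: (u < z + b); rewrite ?mulr0 ?mul0r ?mulr1.
have KE' z u : K z u = restr (u - b) (u - a) (fun=> 1) z.
  rewrite KE /restr; congr (if _ then _ else _).
  by rewrite andbC ltrBlDr ltrBrDr.
have E1 : \int[mu]_(z in `]A, B[) (\int[mu]_(u in `]z + a, z + b[) p u) =
          \int[mu]_(z in `]A, B[) (\int[mu]_(u in `]A + a, B + b[) (p u * K z u)).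
  apply: eq_Int => z /andP[Az zB].
  rewrite -(@Int_restr R (A + a) (B + b) (z + a) (z + b)); [|lra|lra|lra|exact: restr_intg].
  by apply: eq_Int => u _; rewrite KE /restr; case: ifP; rewrite ?mulr1 ?mulr0.
rewrite E1 (@Int_Fubini R (A + a) (B + b) A B 1 p K)//.
- rewrite -IntZ//; apply: le_Int; last 1 first.
  + move=> u _; rewrite mulrC ler_wpM2r//.
    rewrite (eq_Int (g := restr (u - b) (u - a) (fun=> 1))); last by move=> z _; rewrite KE'.
    rewrite Int_window ?lerD2l ?lerN2//.
    apply: le_trans (ler_norm _) _; apply: le_trans (clamp_lip _ _ AB) _.
    by rewrite ger0_norm ?subr_ge0 ?lerD2l ?lerN2//; lra.
  + have C : continuous (fun u => clamp A B (u - a) - clamp A B (u - b)).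
      have cc := clamp_cont AB.
      by move=> u; apply: cvgB; apply: (@continuous_comp _ _ _ (fun u => u - _) (clamp A B)); try exact: cc; apply: cvgB; [exact: cvg_id|exact: cvg_cst|exact: cvg_id|exact: cvg_cst].
    apply: eq_intg (intgM_cont (Ip _ _) C) => u _; congr (_ * _).
    rewrite (eq_Int (g := restr (u - b) (u - a) (fun=> 1))); last by move=> z _; rewrite KE'.
    by rewrite Int_window ?lerD2l ?lerN2.
  + exact: intgZ.
- have mi : measurable_fun setT i by exact: measurable_indic.
  apply: measurable_funM; apply: measurableT_comp => //.
    by apply: measurable_funB; [apply: measurable_funB; [exact: measurable_snd|exact: measurable_cst]|exact: measurable_fst].
  by apply: measurable_funB; [apply: measurable_funD; [exact: measurable_fst|exact: measurable_cst]|exact: measurable_snd].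
- move=> z u _ _; rewrite KE /restr; case: ifP => _; rewrite ?normr1 ?normr0//.
Qed.

Variable h : R -> R.
Hypothesis hL : forall a b, L2 a b h.
Variables A B : R.
Hypothesis AB : A <= B.

Let hI a b : intg a b h. Proof. exact: L2_intg. Qed.

Lemma L2_locshift (p : R -> R) s a b : (forall a b, L2 a b p) -> L2 a b (fun z => p (z + s)).
Proof. by move=> Lp; exact: L2_shift. Qed.

Lemma Int_transl_le (p : R -> R) (t s : R) : (forall x, 0 <= p x) -> (forall a b, intg a b p) ->
  `|t - s| < 1 -> \int[mu]_(z in `]A, B[) p (z + s) <= \int[mu]_(z in `]A + t - 1, B + t + 1[) p z.
Proof.
move=> p0 Ip; rewrite ltr_norml => /andP[? ?]; rewrite -Int_shift//.
by apply: Int_mono => //; have := AB; lra.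
Qed.

(** This is clear for a continuous approximation G of h, and translating h - G
    preserves its norm. *)
Lemma transl_L2 (t e : R) : 0 < e -> exists2 d, 0 < d & forall s, `|t - s| < d ->
  \int[mu]_(z in `]A, B[) ((h (z + s) - h (z + t)) ^+ 2) < e.
Proof.
move=> e0.
(* e / 12: three errors are added, and squaring their sum costs a factor 3 *)
have e9 : 0 < e / 12 by rewrite divr_gt0.
have ab' : A + t - 1 < B + t + 1 by have := AB; lra.
have [G cG HG] := L2_approx ab' (hL _ _) e9.
have w0 : 0 <= B - A by rewrite subr_ge0.
have [e1 e10 He1] := small_sq w0 e9.
have [d d0 Hd] := @unif_transl G A B t e1 cG e10.
exists (Num.min d 1); first by rewrite lt_min d0 ltr01.
move=> s; rewrite lt_min => /andP[sd s1].
have LG a b : L2 a b G by exact: L2_cont.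
have Lp a b : L2 a b (fun x => h x - G x) by exact: L2B.
have Ip a b : intg a b (fun x => (h x - G x) ^+ 2) by exact: L2_sqr.
have tt : `|t - t| < 1 by rewrite subrr normr0.
have B1 := @Int_transl_le (fun x => (h x - G x) ^+ 2) t s (fun x => sqr_ge0 _) Ip s1.
have B2 := @Int_transl_le (fun x => (h x - G x) ^+ 2) t t (fun x => sqr_ge0 _) Ip tt.
have I1 : intg A B (fun z => (h (z + s) - G (z + s)) ^+ 2) by exact: (intg_shift (Ip _ _)).
have I3 : intg A B (fun z => (h (z + t) - G (z + t)) ^+ 2) by exact: (intg_shift (Ip _ _)).
have I2 : intg A B (fun=> e1 ^+ 2) by apply: intg_cont; exact: cst_continuous.
have : \int[mu]_(z in `]A, B[) ((h (z + s) - h (z + t)) ^+ 2) <=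
  \int[mu]_(z in `]A, B[) (3 * (h (z + s) - G (z + s)) ^+ 2 + (3 * e1 ^+ 2 + 3 * (h (z + t) - G (z + t)) ^+ 2)).
  apply: le_Int.
  - by apply: L2_sqr; apply: L2B; apply: L2_locshift.
  - by apply: intgD; [exact: intgZ|apply: intgD; exact: intgZ].
  move=> z /andP[Az zB].
  have -> : h (z + s) - h (z + t) = (h (z + s) - G (z + s)) + (G (z + s) - G (z + t)) + (- (h (z + t) - G (z + t))) by ring.
  apply: le_trans (sqr3 _ _ _) _; rewrite sqrrN lerD2l lerD2r ler_pM2l//.
  by rewrite -real_normK ?num_real// lerXn2r ?nnegrE ?(ltW e10)//; apply/ltW/Hd; rewrite ?sd// !ltW.
rewrite IntD; [|exact: intgZ|by apply: intgD; exact: intgZ].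
rewrite IntD; [|exact: intgZ|exact: intgZ].
rewrite (Int_cst (3 * e1 ^+ 2) AB) (IntZ 3 I1) (IntZ 3 I3); lra.
Qed.

Local Notation F := (prim h).

Lemma prim_quot (s t z : R) : s != t ->
  (F (z + s) - F (z + t)) / (s - t) =
  (Num.max s t - Num.min s t)^-1 * \int[mu]_(u in `]z + Num.min s t, z + Num.max s t[) h u.
Proof.
rewrite neq_lt => /orP[st|ts].
  have st' : t - s != 0 by rewrite subr_eq0 gt_eqF.
  have st2 : s - t != 0 by rewrite subr_eq0 lt_eqF.
  by rewrite max_r ?min_l ?(ltW st)// -primB ?lerD2l ?(ltW st)//; field; rewrite st' st2.
by rewrite max_l ?min_r ?(ltW ts)// -primB ?lerD2l ?(ltW ts)// mulrC.
Qed.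

(** The difference quotient is the mean of h over ]z + s, z + t[. For a continuous
    G these means converge uniformly, and by Cauchy-Schwarz and [sliding] the
    replacement of h by G costs no more than the distance between them. *)
Lemma quot_L2 (t e : R) : 0 < e -> exists2 d, 0 < d & forall s, s != t -> `|t - s| < d ->
  \int[mu]_(z in `]A, B[) (((F (z + s) - F (z + t)) / (s - t) - h (z + t)) ^+ 2) < e.
Proof.
move=> e0.
(* e / 12: three errors are added, and squaring their sum costs a factor 3 *)
have e9 : 0 < e / 12 by rewrite divr_gt0.
have ab' : A + t - 1 < B + t + 1 by have := AB; lra.
have [G cG HG] := L2_approx ab' (hL _ _) e9.
have w0 : 0 <= B - A by rewrite subr_ge0.
have [e1 e10 He1] := small_sq w0 e9.
have [d d0 Hd] := @unif_transl G A B t e1 cG e10.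
exists (Num.min d 1); first by rewrite lt_min d0 ltr01.
move=> s st; rewrite lt_min => /andP[sd s1].
pose a := Num.min s t; pose b := Num.max s t.
have ab : a < b by rewrite /a /b; move: st; rewrite neq_lt => /orP[] st; rewrite gt_min !lt_max st ?orbT.
have atb : a <= t <= b by rewrite /a /b ge_min le_max lexx !orbT.
have abd r : a <= r <= b -> `|t - r| <= `|t - s|.
  rewrite /a /b; move: st; rewrite neq_lt => /orP[] st.
    rewrite max_r ?min_l ?(ltW st)// => /andP[? ?]; rewrite !ger0_norm; lra.
  rewrite max_l ?min_r ?(ltW st)// => /andP[? ?]; rewrite !ler0_norm; lra.
have aE : A + t - 1 <= A + a.
  by have := @abd a; rewrite lexx (ltW ab) => /(_ isT) /le_lt_trans /(_ s1); rewrite ltr_norml => /andP[? ?]; lra.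
have bE : B + b <= B + t + 1.
  by have := @abd b; rewrite lexx (ltW ab) => /(_ isT) /le_lt_trans /(_ s1); rewrite ltr_norml => /andP[? ?]; lra.
have LG x y : L2 x y G by exact: L2_cont.
pose q x := h x - G x.
have Lq x y : L2 x y q by exact: L2B.
have Iq x y : intg x y q by exact: L2_intg.
have IG x y : intg x y G by exact: L2_intg.
pose p x := q x ^+ 2.
have p0 x : 0 <= p x by exact: sqr_ge0.
have Ip x y : intg x y p by exact: L2_sqr.
have tt : `|t - t| < 1 by rewrite subrr normr0.
have B3 := @Int_transl_le p t t p0 Ip tt.
have I3 : intg A B (fun z => p (z + t)) by exact: (intg_shift (Ip _ _)).
have I2 : intg A B (fun=> e1 ^+ 2) by apply: intg_cont; exact: cst_continuous.
have B1 : \int[mu]_(z in `]A, B[) ((b - a)^-1 * \int[mu]_(u in `]z + a, z + b[) p u) <= e / 12.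
  have ba0 : 0 < b - a by rewrite subr_gt0.
  have I : intg A B (fun z => \int[mu]_(u in `]z + a, z + b[) p u).
    by apply: intg_cont; apply: sliding_cont => //; exact: ltW.
  rewrite IntZ// mulrC ler_pdivrMr//.
  apply: le_trans (sliding p0 Ip AB (ltW ab)) _; rewrite mulrC ler_pM2r//.
  by apply: le_trans (ltW HG); apply: Int_mono => //; have := AB; lra.
have : \int[mu]_(z in `]A, B[) (((F (z + s) - F (z + t)) / (s - t) - h (z + t)) ^+ 2) <=
  \int[mu]_(z in `]A, B[) (3 * ((b - a)^-1 * \int[mu]_(u in `]z + a, z + b[) p u) + (3 * e1 ^+ 2 + 3 * p (z + t))).
  have ba0 : 0 < b - a by rewrite subr_gt0.
  have I1 : intg A B (fun z => (b - a)^-1 * \int[mu]_(u in `]z + a, z + b[) p u).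
    by apply: intgZ; apply: intg_cont; apply: sliding_cont => //; exact: ltW.
  apply: le_Int.
  - apply: L2_sqr; apply: L2B; last exact: L2_locshift.
    have cF (c : R) : continuous (fun u => F (u + c)) by apply: shift_cont; exact: prim_cont.
    by apply: L2_cont => u; apply: cvgM; [apply: cvgB; exact: cF|exact: cvg_cst].
  - by apply: intgD; [exact: intgZ|apply: intgD; exact: intgZ].
  move=> z /andP[Az zB]; rewrite prim_quot// -/a -/b.
  have zab : z + a <= z + b by rewrite lerD2l ltW.
  have bn : b - a != 0 by rewrite gt_eqF.
  have -> : (b - a)^-1 * \int[mu]_(u in `]z + a, z + b[) h u - h (z + t) =
    (b - a)^-1 * (\int[mu]_(u in `]z + a, z + b[) q u) +
    (b - a)^-1 * (\int[mu]_(u in `]z + a, z + b[) (G u - G (z + t))) + (- q (z + t)).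
    have win_cos : intg (z + a) (z + b) (fun=> G (z + t)) by apply: intg_cont; exact: cst_continuous.
    by rewrite IntB// IntB// Int_cst// /q; field.
  apply: le_trans (sqr3 _ _ _) _; rewrite sqrrN; apply: lerD; last apply: lerD => //.
    rewrite ler_pM2l// exprMn.
    have L1 : L2 (z + a) (z + b) (fun=> 1 : R) by apply: L2_cont; exact: cst_continuous.
    have := Int_CS (Lq (z + a) (z + b)) L1.
    rewrite (eq_Int (g := q)); last by move=> u _; rewrite mulr1.
    rewrite (eq_Int (f := fun=> 1 ^+ 2) (g := fun=> 1)); last by move=> u _; rewrite expr1n.
    rewrite Int_cst// mul1r => H.
    rewrite expr2 -mulrA ler_pM2l ?invr_gt0// mulrC ler_pdivrMr//.
    have E : b - a = z + b - (z + a) by ring.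
    by rewrite E; exact: H.
  rewrite ler_pM2l// -real_normK ?num_real// lerXn2r ?nnegrE ?(ltW e10)//.
  rewrite normrM gtr0_norm ?invr_gt0// mulrC ler_pdivrMr//.
  have IGc : intg (z + a) (z + b) (fun u => G u - G (z + t)).
    by apply: intgB => //; apply: intg_cont; exact: cst_continuous.
  apply: le_trans (norm_Int IGc) _.
  apply: le_trans (_ : \int[mu]_(u in `]z + a, z + b[) e1 <= _); last by rewrite Int_cst//; lra.
  apply: le_Int; [exact: intg_norm|by apply: intg_cont; exact: cst_continuous|].
  move=> u /andP[ua ub]; apply: ltW.
  have -> : u = z + (u - z) by rewrite addrC subrK.
  apply: Hd; last by rewrite !ltW.
  by apply: le_lt_trans sd; apply: abd; apply/andP; split; lra.
have I1 : intg A B (fun z => (b - a)^-1 * \int[mu]_(u in `]z + a, z + b[) p u).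
  by apply: intgZ; apply: intg_cont; apply: sliding_cont => //; exact: ltW.
rewrite IntD; [|exact: intgZ|by apply: intgD; exact: intgZ].
rewrite IntD; [|exact: intgZ|exact: intgZ].
rewrite (Int_cst (3 * e1 ^+ 2) AB) (IntZ 3 I1) (IntZ 3 I3).
move: B3 B1 HG; rewrite -/(q _) -/(p _); lra.
Qed.

End Translation.

(** * The travelling wave and its regularity *)

Section Quasiperiodic.
Variable R : realType.
Variables (M q : R) (b : R -> R).
Hypothesis M0 : 0 < M.

(** The value for s < 0 is a default: at times t >= 0 both phases of the waves below
    are nonnegative on the string. *)
Definition quasi (s : R) : R :=
  if s < 0 then 0 else let k := Num.truncn (s / M) in q ^+ k * b (s - k%:R * M).

Lemma quasi_cell k s : k%:R * M <= s < k.+1%:R * M -> quasi s = q ^+ k * b (s - k%:R * M).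
Proof.
move=> /andP[h1 h2].
have s0 : 0 <= s by apply: le_trans h1; rewrite mulr_ge0// ltW.
have -> : quasi s = let k := Num.truncn (s / M) in q ^+ k * b (s - k%:R * M) by rewrite /quasi ltNge s0.
by rewrite (_ : Num.truncn _ = k)//; apply: truncn_def; rewrite ler_pdivlMr// ltr_pdivrMr// h1.
Qed.

Lemma quasi_base s : 0 <= s < M -> quasi s = b s.
Proof. by move=> H; rewrite (@quasi_cell 0) ?mul0r ?mul1r ?subr0. Qed.

Lemma quasi_period s : 0 <= s -> quasi (s + M) = q * quasi s.
Proof.
move=> s0; have sM : 0 <= s / M by rewrite divr_ge0// ltW.
have := truncn_itv sM; set k := Num.truncn _ => /andP[h1 h2].
rewrite ler_pdivlMr// in h1; rewrite ltr_pdivrMr// in h2.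
rewrite (@quasi_cell k s) ?h1// (@quasi_cell k.+1).
  by rewrite exprS -mulrA; congr (_ * (_ * b _)); rewrite -natr1; ring.
rewrite -[k.+2%:R]natr1 -[k.+1%:R in X in X && _]natr1 !mulrDl !mul1r.
by rewrite lerD2r h1 ltrD2r.
Qed.

Hypothesis bL : L2 0 M b.

Lemma quasi_L2 x y : L2 x y quasi.
Proof.
have P k : L2 0 (k%:R * M) quasi.
  elim: k => [|k IH].
    by apply: (@eq_L2 R _ _ (fun=> 0)); [move=> z; rewrite mul0r => /andP[? ?]; lra|apply: L2_cont; exact: cst_continuous].
  apply: L2_cat IH _.
  have : L2 (k%:R * M) (k.+1%:R * M) (fun s => q ^+ k * b (s - k%:R * M)).
    apply: L2Z; apply: L2_shift; apply: L2S bL; rewrite ?subrr// -natr1; lra.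
  by apply: eq_L2 => s /andP[h1 h2]; rewrite (@quasi_cell k)// h2 ltW.
pose k := (Num.truncn (y / M)).+1.
have yk : y <= k%:R * M.
  by rewrite -ler_pdivrMr//; apply: ltW; exact: truncnS_gt.
apply: (@L2S _ (Num.min x 0) (k%:R * M)) => //; first by rewrite ge_min lexx.
apply: L2_cat (P k).
apply: (@eq_L2 R _ _ (fun=> 0)); last by apply: L2_cont; exact: cst_continuous.
by move=> z /andP[_ z0]; rewrite /quasi z0.
Qed.

End Quasiperiodic.

Section Solution.
Variable R : realType.
Local Notation mu := (@lebesgue_measure R).
Variables (L v eta : R).
Hypotheses (L0 : 0 < L) (v0 : 0 <= v) (v1 : v < 1) (e0 : 0 <= eta) (e1 : eta != 1).
Local Notation g := (gamma_v v).
Local Notation M := (L_2 L v).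
Local Notation ge := (gamma_eta eta).

Let g0 : 0 < g. Proof. exact: gamma_v_gt0. Qed.
Let gE : g * (1 - v) = 1 + v. Proof. exact: gamma_vM. Qed.
Let M0 : 0 < M. Proof. exact: L_2_gt0. Qed.
Let MgL : M - g * L = L. Proof. exact: L_2E. Qed.

Variable h : R -> R.
Hypothesis hL : forall a b, L2 a b h.
Local Notation F := (prim h).

(** The second phase equals the first one at x = L + v t, hence the Dirichlet
    condition; at x = v t it exceeds it by M, so that the damping condition
    becomes a relation between h(s) and h(s + M). *)
Definition wave x t := F (t + x) - F (g * (t - x) + M).
Definition wave_x x t := h (t + x) + g * h (g * (t - x) + M).
Definition wave_t x t := h (t + x) - g * h (g * (t - x) + M).

Let hI a b : intg a b h. Proof. exact: L2_intg. Qed.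
Let cF : continuous F. Proof. exact: prim_cont. Qed.

Lemma pull_plus t (y : R) : t + (y + v * t) = y + (1 + v) * t. Proof. by ring. Qed.
Lemma pull_minus t (y : R) : g * (t - (y + v * t)) + M = M - g * y + (1 + v) * t.
Proof. by rewrite -gE; ring. Qed.

Lemma wave_cont t : continuous (fun x => wave x t).
Proof.
have c1 := affine_cont (c := 1) (d := t) cF.
have c2 := affine_cont (c := - g) (d := g * t + M) cF.
rewrite (_ : (fun x => _) = (fun x => F (1 * x + t) - F (- g * x + (g * t + M)))).
  by move=> x; apply: cvgB; [exact: c1|exact: c2].
by apply/funext => x; rewrite /wave; congr (F _ - F _); ring.
Qed.

Lemma wave_L2 (k : R) t a b : L2 a b (fun x => h (t + x) + k * h (g * (t - x) + M)).
Proof.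
apply: L2D; first by apply: eq_L2 (L2_shift (hL (a + t) (b + t))) => x _; rewrite addrC.
apply: L2Z; apply: eq_L2 (L2_refl g0 (hL ((g * t + M) - g * b) ((g * t + M) - g * a))) => x _.
by congr h; ring.
Qed.

Lemma wave_x_L2 t a b : L2 a b (wave_x^~ t). Proof. exact: wave_L2. Qed.
Lemma wave_t_L2 t a b : L2 a b (wave_t^~ t).
Proof. by apply: eq_L2 (wave_L2 (- g) t a b) => x _; rewrite /wave_t mulNr. Qed.

Lemma wave_prim t x : x <= L + v * t ->
  wave x t = - \int[mu]_(y in `]x, L + v * t[) wave_x y t.
Proof.
move=> xL; set b := L + v * t.
have I1 : intg x b (fun y => h (y + t)) by exact: intg_shift.
have I2 : intg x b (fun y => h ((g * t + M) - g * y)) by exact: intg_refl.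
rewrite (@eq_Int _ _ _ _ (fun y => h (y + t) + g * h ((g * t + M) - g * y))); last first.
  by move=> y _; rewrite /wave_x [t + y]addrC (_ : g * (t - y) + M = g * t + M - g * y)//; ring.
rewrite IntD//; last exact: intgZ.
rewrite IntZ// -Int_shift// -Int_refl// -!primB ?lerD2r//; last first.
  by rewrite lerD2l lerN2 ler_pM2l.
have -> : g * t + M - g * b = b + t.
  rewrite /b; have -> : g * t + M - g * (L + v * t) = M - g * L + g * (1 - v) * t by ring.
  by rewrite MgL gE; ring.
rewrite /wave [t + x]addrC (_ : g * (t - x) + M = g * t + M - g * x); ring.
Qed.

Lemma wave_H1r t : H1r (v * t) (L + v * t) (wave^~ t) (wave_x^~ t).
Proof.
have ab : v * t <= L + v * t by rewrite lerDr ltW.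
split; last by rewrite wave_prim// Int_point oppr0.
split.
- exact: continuous_subspaceT (@wave_cont t).
- by apply: L2_cont; exact: wave_cont.
- exact: wave_x_L2.
have := weak_derivative_prim ab (L2_intg (wave_x_L2 t _ _)).
move=> H psi /H <-; apply: eq_Int => x /andP[_ /ltW xb]; by rewrite wave_prim.
Qed.

(** In the moving frame every time increment of the wave has this form, with D an
    increment of F or h, or the error of a difference quotient of F. *)
Lemma fold_bound (D : R -> R) (al be : R) : L2 0 M D ->
  L2 0 L (fun y => al * D y + be * D (M - g * y)) /\
  \int[mu]_(y in `]0, L[) ((al * D y + be * D (M - g * y)) ^+ 2) <=
  (2 * al ^+ 2 + 2 * be ^+ 2 / g) * \int[mu]_(z in `]0, M[) (D z ^+ 2).
Proof.
move=> LD.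
have LM : L <= M by rewrite ltW// L_2_gtL.
have L1 : L2 0 L D by exact: L2S LD.
have LD2 : L2 (M - g * L) (M - g * 0) D by rewrite MgL mulr0 subr0; apply: L2S LD => //; exact: ltW.
have L2' : L2 0 L (fun y => D (M - g * y)) by exact: L2_refl.
split; first by apply: L2D; exact: L2Z.
set J := \int[mu]_(z in `]0, M[) _.
have J1 : \int[mu]_(y in `]0, L[) (D y ^+ 2) <= J.
  by apply: Int_mono => //; [exact: ltW|move=> x; exact: sqr_ge0|exact: L2_sqr].
have J2 : g * \int[mu]_(y in `]0, L[) (D (M - g * y) ^+ 2) <= J.
  rewrite -(@Int_refl R g M 0 L (fun z => D z ^+ 2) g0 (L2_sqr LD2)) MgL mulr0 subr0.
  by apply: Int_mono => //; [exact: ltW|move=> x; exact: sqr_ge0|exact: L2_sqr].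
apply: (@le_trans _ _ (\int[mu]_(y in `]0, L[) (2 * al ^+ 2 * D y ^+ 2 + 2 * be ^+ 2 * D (M - g * y) ^+ 2))).
  apply: le_Int.
  - by apply: L2_sqr; apply: L2D; exact: L2Z.
  - by apply: intgD; apply: intgZ; exact: L2_sqr.
  move=> y _; have := sqr_ge0 (al * D y - be * D (M - g * y)); lra.
rewrite IntD; [|by apply: intgZ; exact: L2_sqr|by apply: intgZ; exact: L2_sqr].
rewrite !IntZ; [|exact: L2_sqr|exact: L2_sqr].
rewrite [leRHS]mulrDl; apply: lerD; first by rewrite ler_wpM2l// mulr_ge0// sqr_ge0.
have k0 : 0 <= 2 * be ^+ 2 by rewrite mulr_ge0// sqr_ge0.
rewrite -[_ / g * J]mulrA; apply: ler_wpM2l => //.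
by rewrite mulrC ler_pdivlMr// mulrC.
Qed.

Lemma cvg_fold (Fi : set_system R) {FF : Filter Fi} (W D : R -> R -> R) (al be : R) :
  (forall e : R, 0 < e -> \forall s \near Fi, [/\ L2 0 M (D s),
     forall y, 0 < y < L -> W s y = al * D s y + be * D s (M - g * y) &
     \int[mu]_(z in `]0, M[) (D s z ^+ 2) < e]) ->
  normL2sq 0 L (W s) @[s --> Fi] --> 0%E.
Proof.
move=> H.
set c := 2 * al ^+ 2 + 2 * be ^+ 2 / g.
have c0 : 0 <= c by apply: addr_ge0; [|apply: divr_ge0; last exact: ltW]; apply: mulr_ge0 => //; exact: sqr_ge0.
have E : \forall s \near Fi, (\int[mu]_(y in `]0, L[) (W s y ^+ 2))%:E = normL2sq 0 L (W s).
  apply: filterS (H 1 ltr01) => s [LD weak _]; rewrite normL2sqE//.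
  by apply: eq_L2 (fold_bound al be LD).1 => y /weak ->.
apply: cvg_trans; first exact: (near_eq_cvg E).
apply: cvg_EFin; first by apply: nearW.
apply/cvgrPdist_lt => /= e ep.
have ce : 0 < e / (c + 1) by rewrite divr_gt0// ltr_wpDl.
apply: filterS (H _ ce) => s [LD weak HD].
rewrite sub0r normrN ger0_norm; last by apply: Int_ge0 => y _; exact: sqr_ge0.
rewrite (eq_Int (g := fun y => (al * D s y + be * D s (M - g * y)) ^+ 2)); last by move=> y /weak ->.
apply: le_lt_trans (fold_bound al be LD).2 _; rewrite -/c.
have D0 : 0 <= \int[mu]_(z in `]0, M[) (D s z ^+ 2) by apply: Int_ge0 => z _; exact: sqr_ge0.
have := HD; rewrite ltr_pdivlMr ?ltr_wpDl// => H2; apply: le_lt_trans H2; nra.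
Qed.

Lemma near_tau (t d : R) (A : set R) : 0 < d ->
  \forall s \near within A (nbhs t), A s /\ `|(1 + v) * t - (1 + v) * s| < d.
Proof.
move=> d0; have vp : 0 < 1 + v by rewrite ltr_wpDr.
apply/nbhs_ballP; exists (d / (1 + v)); first by rewrite /= divr_gt0.
move=> s; rewrite /ball /= ltr_pdivlMr// => H As; split => //.
by rewrite -mulrBr normrM gtr0_norm// mulrC.
Qed.

Lemma near_tau' (t d : R) (A : set R) : 0 < d ->
  \forall s \near within A t^', [/\ A s, s != t & `|(1 + v) * t - (1 + v) * s| < d].
Proof.
move=> d0; have vp : 0 < 1 + v by rewrite ltr_wpDr.
apply/nbhs_ballP; exists (d / (1 + v)); first by rewrite /= divr_gt0.
move=> s; rewrite /ball /= ltr_pdivlMr// => H st As; split => //.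
by rewrite -mulrBr normrM gtr0_norm// mulrC.
Qed.

Lemma cvg_phi t (A : set R) : normL2sq 0 L (fun y => pull v wave s y - pull v wave t y) @[s --> within A (nbhs t)] --> 0%E.
Proof.
apply: (@cvg_fold _ _ _ (fun s z => F (z + (1 + v) * s) - F (z + (1 + v) * t)) 1 (- 1)) => e ep.
have [e2 e20 He2] := small_sq (ltW M0) ep.
have [d d0 Hd] := @unif_transl R F 0 M ((1 + v) * t) e2 cF e20.
have cs (c : R) : continuous (fun z => F (z + c)) by exact: shift_cont.
apply: filterS (near_tau t A d0) => s [_ sd].
have cD : continuous (fun z => F (z + (1 + v) * s) - F (z + (1 + v) * t)).
  by move=> z; apply: cvgB; exact: cs.
split.
- exact: L2_cont.
- by move=> y _; rewrite /pull /wave !pull_plus !pull_minus; ring.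
have eI : intg 0 M (fun=> e2 ^+ 2) by apply: intg_cont; exact: cst_continuous.
apply: le_lt_trans (_ : \int[mu]_(z in `]0, M[) (e2 ^+ 2) < _); last by rewrite Int_cst ?(ltW M0)// subr0.
apply: le_Int => //; first by apply: L2_sqr; exact: L2_cont.
move=> z /andP[z0 zM]; rewrite -real_normK ?num_real// lerXn2r ?nnegrE ?(ltW e20)//.
by apply/ltW/Hd => //; rewrite !ltW.
Qed.

Lemma cvg_wave (k : R) t (A : set R) (w : R -> R -> R) : (forall x t, w x t = h (t + x) + k * h (g * (t - x) + M)) ->
  normL2sq 0 L (fun y => pull v w s y - pull v w t y) @[s --> within A (nbhs t)] --> 0%E.
Proof.
move=> wE.
apply: (@cvg_fold _ _ _ (fun s z => h (z + (1 + v) * s) - h (z + (1 + v) * t)) 1 k) => e ep.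
have [d d0 Hd] := transl_L2 hL (ltW M0) ((1 + v) * t) ep.
apply: filterS (near_tau t A d0) => s [_ sd]; split.
- by apply: L2B; exact: L2_locshift.
- by move=> y _; rewrite /pull !wE !pull_plus !pull_minus; ring.
exact: Hd.
Qed.

Lemma cvg_quot t (A : set R) :
  normL2sq 0 L (fun y => (pull v wave s y - pull v wave t y) / (s - t)
                             - (pull v wave_t t y + v * pull v wave_x t y))
        @[s --> within A t^'] --> 0%E.
Proof.
have vp : 0 < 1 + v by rewrite ltr_wpDr.
apply: (@cvg_fold _ _ _ (fun s z => (F (z + (1 + v) * s) - F (z + (1 + v) * t)) / ((1 + v) * s - (1 + v) * t) - h (z + (1 + v) * t))
   (1 + v) (- (1 + v))) => e ep.
have [d d0 Hd] := quot_L2 hL (ltW M0) ((1 + v) * t) ep.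
have cs (c : R) : continuous (fun z => F (z + c)) by exact: shift_cont.
apply: filterS (near_tau' t A d0) => s [_ st sd]; split.
- apply: L2B; last exact: L2_locshift.
  by apply: L2_cont => z; apply: cvgM; [apply: cvgB; exact: cs|exact: cvg_cst].
- move=> y _; rewrite /pull /wave /wave_t /wave_x !pull_plus !pull_minus.
  have st0 : s - t != 0 by rewrite subr_eq0.
  have E : (1 + v) * s - (1 + v) * t = (1 + v) * (s - t) by ring.
  set h2 := h (M - g * y + _).
  have -> : h (y + (1 + v) * t) - g * h2 + v * (h (y + (1 + v) * t) + g * h2) = (1 + v) * h (y + (1 + v) * t) - g * (1 - v) * h2 by ring.
  by rewrite gE E; field; rewrite st0 gt_eqF.
apply: Hd => //; apply: contra st => /eqP H; apply/eqP; apply: (mulfI _ H).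
by rewrite gt_eqF.
Qed.

Lemma wave_regular T : C_H1r L v T wave wave_x /\ C1_L2 L v T wave wave_x wave_t.
Proof.
split=> [t _|].
  split; first exact: wave_H1r.
  rewrite -[X in _ --> X]adde0; apply: cvgeD => //; first exact: cvg_phi.
  exact: (@cvg_wave g).
split=> t _.
- by split; [have [[]] := wave_H1r t|exact: cvg_phi].
- split; first exact: wave_t_L2.
  by apply: (@cvg_wave (- g)) => x s; rewrite /wave_t mulNr.
- exact: cvg_quot.
Qed.

Section Initial.
Variables (phi0 phi0x phi1 : R -> R).
Hypotheses (phi0_H1 : H1r 0 L phi0 phi0x) (phi1_L2 : L2 0 L phi1).
Hypothesis h0 : forall z, 0 <= z < M -> h z = 2^-1 * unfold L v phi0x phi1 z.

(** h is half the unfolding of phi0x and phi1, and reflection separates the two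
    functions again. *)
Lemma wave_initial x : 0 < x < L -> wave x 0 = phi0 x /\ wave_t x 0 = phi1 x.
Proof.
move=> xI; have [/ltW x0 xL] := andP xI.
have xM : x <= M - g * x.
  have : g * x <= g * L by rewrite ler_pM2l// ltW.
  move: MgL; lra.
have mM : M - g * x <= M by rewrite lerBlDr lerDl mulr_ge0// ltW.
have [H phi0L] := phi0_H1; have [_ _ Lx _] := H.
split.
  rewrite /wave add0r sub0r mulrN [_ + M]addrC.
  have -> : F x - F (M - g * x) = - (F (M - g * x) - F x) by ring.
  rewrite primB//.
  rewrite (@eq_Int _ _ _ _ (fun z => 2^-1 * unfold L v phi0x phi1 z)); last first.
    by move=> z /andP[z1 z2]; apply: h0; rewrite (le_trans x0 (ltW z1)) (lt_le_trans z2 mM).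
  have Lu := unfold_L2 v0 v1 Lx phi1_L2.
  rewrite IntZ; last exact: L2_intg (L2S x0 mM Lu).
  rewrite Int_unfold_mid ?x0 ?(ltW xL)// mulrA mulVf ?pnatr_eq0// mul1r.
  have A := H1_AC L0 H.
  have := A L; rewrite lexx (ltW L0) phi0L => /(_ isT).
  by rewrite (Int_cat x0 (ltW xL) (L2_intg Lx)) addrA -(A x) ?x0 ?(ltW xL)// => /eqP; rewrite eq_sym addr_eq0 => /eqP ->.
rewrite /wave_t add0r sub0r mulrN [_ + M]addrC !h0 ?x0 ?(lt_trans xL (L_2_gtL L0 v0 v1))//; last first.
  rewrite (le_trans x0 xM) /=; rewrite ltrBlDr ltrDl mulr_gt0//; by case/andP: xI.
rewrite unfold_right// unfold_left//; field; exact: lt0r_neq0.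
Qed.

End Initial.

End Solution.

(** * Fubini along characteristics *)

Section TwoVariables.
Variable R : realType.
Local Notation mu := (@lebesgue_measure R).
Implicit Types (k p psi : R -> R -> R).

Definition cont2 k := continuous (fun z : R * R => k z.1 z.2).

Lemma cont2_eps k (x y e : R) : cont2 k -> 0 < e -> exists2 d : R, 0 < d &
  forall x' y', `|x - x'| < d -> `|y - y'| < d -> `|k x y - k x' y'| < e.
Proof.
move=> ck ep; have /cvgrPdist_lt /(_ _ ep) /nbhs_ballP[d /= d0 Hd] := ck (x, y).
by exists d => // x' y' h1 h2; apply: (Hd (x', y')).
Qed.

Lemma cont2_aff k (a b c : R) : cont2 k -> cont2 (fun t s => k (a * t + b * s + c) t).
Proof.
move=> ck z.
apply: (@continuous_comp _ _ _ (fun z : R * R => (a * z.1 + b * z.2 + c, z.1)) (fun z => k z.1 z.2)); last exact: ck.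
have H1 : (fun z : R * R => a * z.1 + b * z.2 + c) x @[x --> z] --> a * z.1 + b * z.2 + c.
  apply: cvgD; last exact: cvg_cst.
  by apply: cvgD; apply: cvgM; [exact: cvg_cst|exact: cvg_fst|exact: cvg_cst|exact: cvg_snd].
have H2 : (fun z : R * R => z.1) x @[x --> z] --> z.1 by exact: cvg_fst.
exact: (cvg_pair H1 H2).
Qed.

Lemma cont2_section k (s : R) : cont2 k -> continuous (k^~ s).
Proof.
move=> ck t; apply/cvgrPdist_lt => /= e ep; have [d d0 Hd] := cont2_eps t s ck ep.
apply/nbhs_ballP; exists d => //= t' ht; apply: Hd => //; by rewrite subrr normr0.
Qed.

Lemma cont2_section' k (t : R) : cont2 k -> continuous (k t).
Proof.
move=> ck s; apply/cvgrPdist_lt => /= e ep; have [d d0 Hd] := cont2_eps t s ck ep.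
apply/nbhs_ballP; exists d => //= s' hs; apply: Hd => //; by rewrite subrr normr0.
Qed.

Lemma cont2_bd k (a b c d : R) : cont2 k ->
  exists C, forall x y, a <= x <= b -> c <= y <= d -> `|k x y| <= C.
Proof.
move=> ck.
have K : compact (`[a, b] `*` `[c, d]) by apply: compact_setX; exact: segment_compact.
have := continuous_compact (continuous_subspaceT ck) K.
move=> /compact_bounded[C [_ HC]]; exists (C + 1) => x y xab ycd.
apply: (HC (C + 1)); first by rewrite ltrDl.
by exists (x, y) => //; split; rewrite /= in_itv.
Qed.

(** k(t, s) is the limit of k(j / n, s), where j / n is the largest multiple of
    1 / n up to t. Since k vanishes for t <= 0, natural numbers j suffice. *)
Lemma cont2_measurable k : cont2 k -> (forall t s, t <= 0 -> k t s = 0) ->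
  measurable_fun [set: (measurableTypeR R * measurableTypeR R)%type] (fun z => k z.1 z.2).
Proof.
move=> ck k0.
pose kn (n : nat) (z : measurableTypeR R * measurableTypeR R) : R :=
  k ((Num.truncn (n.+1%:R * z.1))%:R / n.+1%:R) z.2.
apply: (@measurable_fun_cvg _ _ _ _ kn).
- move=> n _ Y mY; rewrite setTI.
  pose ci (j : nat) : set R := [set t | Num.truncn (n.+1%:R * t) = j].
  have mlt (c : R) : measurable [set t : R | n.+1%:R * t < c].
    rewrite (_ : [set t | _] = `]-oo, c / n.+1%:R[%classic)//.
    by apply/seteqP; split => t /=; rewrite in_itv /= ltr_pdivlMr// mulrC.
  have mci j : measurable (ci j).
    case: j => [|j].
      rewrite (_ : ci _ = [set t | n.+1%:R * t < 1])//.
      apply/seteqP; split => t /=; rewrite /ci /=.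
        by move=> E; have := truncn_le_nat (n.+1%:R * t) 0; rewrite E => /esym.
      by move=> E; apply/eqP; rewrite -leqn0 truncn_le_nat.
    rewrite (_ : ci _ = [set t | n.+1%:R * t < j.+2%:R] `\` [set t | n.+1%:R * t < j.+1%:R]).
      exact: measurableD.
    apply/seteqP; split => t /=; rewrite /ci /= -!truncn_le_nat.
      by move=> ->; rewrite leqnn ltnn.
    by move=> [h1 /negP]; rewrite -ltnNge => h2; apply/eqP; rewrite eqn_leq h1.
  rewrite (_ : _ @^-1` Y = \bigcup_j (ci j `*` (k (j%:R / n.+1%:R) @^-1` Y))).
    apply: bigcup_measurable => j _; apply: measurableX; first exact: mci.
    have mk : measurable_fun setT (k (j%:R / n.+1%:R)) by apply: continuous_measurable_fun; exact: cont2_section'.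
    by rewrite -[X in measurable X]setTI; exact: mk.
  apply/seteqP; split => [z zY|z [j _ [/= <-]]]//.
  by exists (Num.truncn (n.+1%:R * z.1)).
move=> z _; apply/cvgrPdist_lt => /= e ep.
have [z1|z1] := leP z.1 0.
  near=> n; rewrite /kn; have -> : Num.truncn (n.+1%:R * z.1) = 0%N.
    apply/eqP; rewrite -leqn0 truncn_le_nat; apply: le_lt_trans ltr01.
    by rewrite mulr_ge0_le0.
  by rewrite mul0r !k0// subrr normr0.
have [d d0 Hd] := cont2_eps z.1 z.2 ck ep.
near=> n; apply: Hd; last by rewrite subrr normr0.
have n0 : 0 < n.+1%:R :> R by [].
have := truncn_itv (mulr_ge0 (ltW n0) (ltW z1)); set j := Num.truncn _ => /andP[h1 h2].
have E : n.+1%:R * (z.1 - j%:R / n.+1%:R) = n.+1%:R * z.1 - j%:R by field; rewrite gt_eqF.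
have p0 : 0 <= z.1 - j%:R / n.+1%:R by rewrite subr_ge0 ler_pdivrMr// mulrC.
rewrite ger0_norm// -(ltr_pM2l n0) E.
apply: (@lt_trans _ _ 1); first by rewrite ltrBlDl natr1.
rewrite -ltr_pdivrMr// mul1r.
near: n; exists (Num.truncn d^-1) => // n /= Nn.
by apply: lt_le_trans (truncnS_gt _) _; rewrite ler_nat ltnS.
Unshelve. all: by end_near. Qed.

Lemma mvt (f f' : R -> R) (x y : R) : (forall x : R, is_derive x 1 f (f' x)) ->
  exists2 c, `|x - c| <= `|x - y| & f y - f x = f' c * (y - x).
Proof.
move=> df.
have cf := is_derive_cont df.
have [xy|yx] := leP x y.
  have D z : z \in `]x, y[ -> is_derive z 1 f (f' z) by move=> _; exact: df.
  have [c] := MVT_segment xy D (continuous_subspaceT cf).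
  rewrite in_itv /= => /andP[xc cy] E; exists c => //.
  by rewrite !ler0_norm; lra.
have D z : z \in `]y, x[ -> is_derive z 1 f (f' z) by move=> _; exact: df.
have [c] := MVT_segment (ltW yx) D (continuous_subspaceT cf).
rewrite in_itv /= => /andP[xc cy] E; exists c; first by rewrite !ger0_norm; lra.
by rewrite -[LHS]opprB E; ring.
Qed.

(** The increment is split into one in x and one in t, each given by the mean
    value theorem; the partial derivatives are jointly continuous. *)
Lemma chain_rule psi (a c t : R) :
  (forall x t, derivable (psi^~ t) x 1 /\ derivable (psi x) t 1) ->
  cont2 (dx psi) -> cont2 (dt psi) ->
  is_derive t 1 (fun r => psi (a + c * r) r) (c * dx psi (a + c * t) t + dt psi (a + c * t) t).
Proof.
move=> dpsi cx ct.
have Dx (s x : R) : is_derive x 1 (psi^~ s) (dx psi x s).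
  by rewrite /dx derive1E; apply: DeriveDef; first exact: (dpsi x s).1.
have Dt (x s : R) : is_derive s 1 (psi x) (dt psi x s).
  by rewrite /dt derive1E; apply: DeriveDef; first exact: (dpsi x s).2.
apply: is_derive_eps => e ep.
have c1 : 0 < `|c| + 1 by rewrite ltr_wpDl.
have e1 : 0 < e / (`|c| + 1) by rewrite divr_gt0.
have [d1 d10 H1] := cont2_eps (a + c * t) t cx e1.
have [d2 d20 H2] := cont2_eps (a + c * t) t ct e1.
pose d := Num.min d1 d2.
have d0 : 0 < d by rewrite lt_min d10.
exists (d / (`|c| + 1)); first by rewrite divr_gt0.
move=> s st; rewrite ltr_pdivlMr// => ts.
have tsd : `|t - s| < d by apply: le_lt_trans ts; rewrite ler_peMr// lerDr.
have ctsd : `|c * (t - s)| < d.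
  by apply: le_lt_trans ts; rewrite normrM mulrC ler_wpM2l// lerDl.
have [xi Hxi Exi] := mvt (a + c * t) (a + c * s) (Dx s).
have [ze Hze Eze] := mvt t s (Dt (a + c * t)).
have st0 : s - t != 0 by rewrite subr_eq0.
have -> : (psi (a + c * s) s - psi (a + c * t) t) / (s - t) = c * dx psi xi s + dt psi (a + c * t) ze.
  have -> : psi (a + c * s) s - psi (a + c * t) t = dx psi xi s * (a + c * s - (a + c * t)) + dt psi (a + c * t) ze * (s - t).
    by rewrite -Exi -Eze; ring.
  by field.
have -> : c * dx psi xi s + dt psi (a + c * t) ze - (c * dx psi (a + c * t) t + dt psi (a + c * t) t) =
   - (c * (dx psi (a + c * t) t - dx psi xi s)) - (dt psi (a + c * t) t - dt psi (a + c * t) ze) by ring.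
have B1 : `|dx psi (a + c * t) t - dx psi xi s| < e / (`|c| + 1).
  apply: H1; last by apply: lt_le_trans tsd _; rewrite ge_min lexx.
  apply: le_lt_trans Hxi _; rewrite (_ : a + c * t - (a + c * s) = c * (t - s)); last by ring.
  by apply: lt_le_trans ctsd _; rewrite ge_min lexx.
have B2 : `|dt psi (a + c * t) t - dt psi (a + c * t) ze| < e / (`|c| + 1).
  apply: H2; first by rewrite subrr normr0.
  by apply: le_lt_trans Hze _; apply: lt_le_trans tsd _; rewrite ge_min lexx orbT.
apply: le_lt_trans (ler_normB _ _) _; rewrite normrN normrM.
have -> : e = `|c| * (e / (`|c| + 1)) + e / (`|c| + 1) by field; rewrite gt_eqF.
by apply: ler_ltD => //; rewrite ler_wpM2l// ltW.
Qed.

End TwoVariables.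

Section Characteristic.
Variable R : realType.
Local Notation mu := (@lebesgue_measure R).
Variables (w : R).
Hypothesis w0 : 0 < w.
Let i (x : R) : R := \1_`]0, +oo[ x.

Let iE (x : R) : i x = ((0 < x)%R)%:R.
Proof. by rewrite /i indicE mem_setE /= in_itv /= andbT. Qed.

(** In the variables (t, s) the moving ends are the lines s = w t + A and
    s = w t + B. *)
Definition strip (A B : R) (k : R -> R -> R) t s : R :=
  k t s * (i (s - (w * t + A)) * i (w * t + B - s)).

Lemma stripE A B k t s : strip A B k t s = restr (w * t + A) (w * t + B) (k t) s.
Proof.
rewrite /strip !iE !subr_gt0 /restr.
by case: (w * t + A < s); case: (s < w * t + B); rewrite /= ?(mulr0, mul0r, mulr1).
Qed.

Section Piece.
Variables (A B T S t1 t2 : R) (k m : R -> R -> R) (h : R -> R).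
Hypotheses (A0 : 0 <= A) (AB : A <= B) (t10 : 0 < t1) (T0 : t2 < T) (SE : w * t2 + B <= S) (ST : S / w <= T).
Hypothesis hI : forall a b, intg a b h.
Hypothesis ck : cont2 k.
Hypothesis dm : forall s (t : R), is_derive t 1 (m^~ s) (k t s).
Hypothesis m0 : forall t s, ~~ (t1 <= t <= t2) -> m t s = 0.
Hypothesis k0 : forall t s, ~~ (t1 <= t <= t2) -> k t s = 0.

Lemma strip_measurable :
  measurable_fun [set: (measurableTypeR R * measurableTypeR R)%type] (fun z => strip A B k z.1 z.2).
Proof.
apply: measurable_funM.
  apply: cont2_measurable => // t s t0; apply: k0; rewrite negb_and -!ltNge; apply/orP; left.
  exact: le_lt_trans t0 t10.
have mi : measurable_fun setT i by exact: measurable_indic.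
have mw : measurable_fun [set: (measurableTypeR R * measurableTypeR R)%type] (fun z : measurableTypeR R * measurableTypeR R => w * z.1 : R).
  by apply: measurable_funM; [exact: measurable_cst|exact: measurable_fst].
apply: measurable_funM; apply: measurableT_comp => //.
  by apply: measurable_funB; [exact: measurable_snd|apply: measurable_funD => //; exact: measurable_cst].
by apply: measurable_funB; [apply: measurable_funD => //; exact: measurable_cst|exact: measurable_snd].
Qed.

Lemma strip_bd : exists C, forall t s, 0 < t < T -> 0 < s < S -> `|strip A B k t s| <= C.
Proof.
have [C HC] := cont2_bd 0 T 0 S ck.
have C0 : 0 <= Num.max C 0 by rewrite le_max lexx orbT.
exists (Num.max C 0) => t s /andP[t0 tT] /andP[s0 sS]; rewrite stripE /restr; case: ifP => _.
  by rewrite le_max HC// !ltW.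
by rewrite normr0.
Qed.

Lemma strip_space t : 0 < t -> intg 0 S (fun s => h s * strip A B k t s) /\
  \int[mu]_(s in `]w * t + A, w * t + B[) (h s * k t s) = \int[mu]_(s in `]0, S[) (h s * strip A B k t s).
Proof.
move=> t0.
have ct : continuous (k t) by exact: cont2_section'.
have E s : h s * strip A B k t s = restr (w * t + A) (w * t + B) (fun s => h s * k t s) s.
  by rewrite stripE /restr; case: ifP; rewrite ?mulr0.
have I a b : intg a b (restr (w * t + A) (w * t + B) (fun s => h s * k t s)).
  by apply: restr_intg => c d; exact: intgM_cont.
split; first by apply: eq_intg (I _ _) => s _.
rewrite [RHS](eq_Int (g := restr (w * t + A) (w * t + B) (fun s => h s * k t s))); last by move=> s _.
have [tt|tt] := leP t t2.
  rewrite Int_restr//; first by rewrite addr_ge0// mulr_ge0// ltW.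
    by rewrite lerD2l.
  by apply: le_trans SE; rewrite lerD2r ler_pM2l.
have kz s : k t s = 0 by apply: k0; rewrite negb_and -!ltNge tt orbT.
rewrite (eq_Int (f := fun s => h s * k t s) (g := fun=> 0)); last by move=> s _; rewrite kz mulr0.
by rewrite Int0 (eq_Int (g := fun=> 0)) ?Int0// => s _; rewrite /restr kz mulr0 if_same.
Qed.

Lemma strip_time s : 0 < s < S -> intg 0 T (fun t => strip A B k t s) /\
  \int[mu]_(t in `]0, T[) (strip A B k t s) = m ((s - A) / w) s - m ((s - B) / w) s.
Proof.
move=> /andP[s0 sS].
have cs := @cont2_section R k s ck.
have I a b c d : intg a b (restr c d (k^~ s)).
  by apply: restr_intg => x y; exact: intg_cont.
have lu : (s - B) / w <= (s - A) / w by rewrite ler_pM2r ?invr_gt0// lerD2l lerN2.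
have E t : 0 < t < T -> strip A B k t s = restr (pos ((s - B) / w)) (pos ((s - A) / w)) (k^~ s) t.
  move=> /andP[t0 _]; rewrite stripE /restr; congr (if _ then _ else _).
  have h1 : (w * t + A < s) = (t < (s - A) / w) by rewrite ltr_pdivlMr// mulrC ltrBrDr.
  have h2 : (s < w * t + B) = ((s - B) / w < t) by rewrite ltr_pdivrMr// mulrC ltrBlDr.
  rewrite h1 h2 andbC /pos; congr andb.
    by case: (ltP ((s - B) / w) 0) => // hh; rewrite t0; apply: lt_trans hh t0.
  by case: (ltP ((s - A) / w) 0) => // hh; rewrite ltNge (ltW (lt_trans hh t0)) ltNge (ltW t0).
split; first by apply: eq_intg (I _ _ _ _) => t /E ->.
rewrite (eq_Int (g := restr (pos ((s - B) / w)) (pos ((s - A) / w)) (k^~ s))); last by move=> t /E.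
have p1 : 0 <= pos ((s - B) / w) by exact: pos_ge0.
have p2 : pos ((s - B) / w) <= pos ((s - A) / w).
  rewrite /pos; case: (ltP ((s - B) / w) 0) => h1; case: (ltP ((s - A) / w) 0) => h2 //.
  by move: h1; rewrite leNgt (le_lt_trans lu h2).
have mpos x : m (pos x) s = m x s.
  rewrite /pos; case: ltP => // x0; rewrite !m0// negb_and -!ltNge; apply/orP; left => //.
  exact: lt_trans x0 t10.
rewrite Int_restr//.
  by rewrite (Int_FTC p2 (dm s) cs) !mpos.
apply: le_trans ST; rewrite /pos; case: ifP => _; first by rewrite divr_ge0 ?(ltW w0)// (ltW (lt_trans s0 sS)).
by rewrite ler_pM2r ?invr_gt0// lerBlDr (le_trans (ltW sS))// lerDl.
Qed.

End Piece.

(** After the exchange of the integrals, k is integrated in t at fixed s, that is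
    along a characteristic; only the values of m where it crosses the two edges of
    the strip remain. *)
Lemma characteristic_Fubini (A1 B1 A2 B2 t1 t2 S : R) (k1 m1 k2 m2 : R -> R -> R) (h : R -> R) :
  0 <= A1 -> A1 <= B1 -> 0 <= A2 -> A2 <= B2 -> 0 < t1 ->
  w * t2 + B1 <= S -> w * t2 + B2 <= S ->
  (forall a b, intg a b h) -> cont2 k1 -> cont2 k2 ->
  (forall s (t : R), is_derive t 1 (m1^~ s) (k1 t s)) ->
  (forall s (t : R), is_derive t 1 (m2^~ s) (k2 t s)) ->
  (forall t s, ~~ (t1 <= t <= t2) -> m1 t s = 0) ->
  (forall t s, ~~ (t1 <= t <= t2) -> m2 t s = 0) ->
  (forall t s, ~~ (t1 <= t <= t2) -> k1 t s = 0) ->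
  (forall t s, ~~ (t1 <= t <= t2) -> k2 t s = 0) ->
  \int[mu]_(t in `]0, +oo[) (\int[mu]_(s in `]w * t + A1, w * t + B1[) (h s * k1 t s) +
    \int[mu]_(s in `]w * t + A2, w * t + B2[) (h s * k2 t s)) =
  \int[mu]_(s in `]0, S[) (h s * (m1 ((s - A1) / w) s - m1 ((s - B1) / w) s +
                                  (m2 ((s - A2) / w) s - m2 ((s - B2) / w) s))).
Proof.
move=> A10 AB1 A20 AB2 t10 S1 S2 hI ck1 ck2 dm1 dm2 m10 m20 k10 k20.
(* T exceeds t2 strictly, and every time at which a line s < S leaves the strip *)
pose T := Num.max (S / w) (t2 + 1).
have T0 : t2 < T by rewrite lt_max ltrDl ltr01 orbT.
have ST : S / w <= T by rewrite le_max lexx.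
rewrite (@Int_support _ 0 T)//; last first.
  move=> t; rewrite negb_and -!leNgt => /orP tI.
  have kz : ~~ (t1 <= t <= t2).
    rewrite negb_and -!ltNge; case: tI => t'; first by rewrite (le_lt_trans t' t10).
    by rewrite (lt_le_trans T0 t') orbT.
  rewrite (eq_Int (g := fun=> 0)); last by move=> s _; rewrite k10// mulr0.
  rewrite Int0 add0r (eq_Int (g := fun=> 0)) ?Int0// => s _; by rewrite k20// mulr0.
pose K t s := strip A1 B1 k1 t s + strip A2 B2 k2 t s.
rewrite (eq_Int (g := fun t => \int[mu]_(s in `]0, S[) (h s * K t s))); last first.
  move=> t /andP[t0 _].
  have [I1 ->] := strip_space A10 AB1 S1 hI ck1 k10 t0.
  have [I2 ->] := strip_space A20 AB2 S2 hI ck2 k20 t0.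
  by rewrite -IntD//; apply: eq_Int => s _; rewrite /K mulrDr.
have [C1 HC1] := strip_bd A1 B1 T S ck1.
have [C2 HC2] := strip_bd A2 B2 T S ck2.
rewrite (@Int_Fubini R 0 S 0 T (C1 + C2) h K)//.
- apply: eq_Int => s sI; congr (_ * _).
  have [I1 <-] := strip_time A10 AB1 t10 ST ck1 dm1 m10 sI.
  have [I2 <-] := strip_time A20 AB2 t10 ST ck2 dm2 m20 sI.
  by rewrite -IntD.
- by apply: measurable_funD; [exact: (strip_measurable _ _ t10 ck1 k10)|exact: (strip_measurable _ _ t10 ck2 k20)].
- by move=> t s tI sI; apply: le_trans (ler_normD _ _) _; apply: lerD; [exact: HC1|exact: HC2].
Qed.

End Characteristic.

(** * The travelling wave satisfies the variational equation *)

Section WeakForm.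
Variable R : realType.
Local Notation mu := (@lebesgue_measure R).
Variables (L v eta : R).
Hypotheses (L0 : 0 < L) (v0 : 0 <= v) (v1 : v < 1).
Local Notation g := (gamma_v v).
Local Notation M := (L_2 L v).
Local Notation w := (1 + v).

Let g0 : 0 < g. Proof. exact: gamma_v_gt0. Qed.
Let gE : g * (1 - v) = 1 + v. Proof. exact: gamma_vM. Qed.
Let M0 : 0 < M. Proof. exact: L_2_gt0. Qed.
Let MgL : M - g * L = L. Proof. exact: L_2E. Qed.
Let w0 : 0 < w. Proof. by rewrite ltr_wpDr. Qed.
Let LM : L <= M. Proof. by rewrite ltW// L_2_gtL. Qed.

Variable h : R -> R.
Hypothesis hL : forall a b, L2 a b h.
Hypothesis hq : forall s, 0 <= s -> (1 - eta) * h s + (1 + eta) * h (s + M) = 0.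
Local Notation F := (prim h).
Let hI a b : intg a b h. Proof. exact: L2_intg. Qed.

Variable psi : R -> R -> R.
Variables t1 t2 : R.
Hypothesis dpsi : forall x t, derivable (psi^~ t) x 1 /\ derivable (psi x) t 1.
Hypotheses (cx : cont2 (dx psi)) (ct : cont2 (dt psi)) (t10 : 0 < t1).
Hypothesis psi0 : forall x t, ~~ (t1 <= t <= t2) -> psi x t = 0.
Hypothesis psiL : forall t, 0 < t -> psi (L + v * t) t = 0.

Lemma dx0 x t : ~~ (t1 <= t <= t2) -> dx psi x t = 0.
Proof.
move=> tI; rewrite /dx (_ : psi^~ t = cst 0) ?derive1_cst//.
by apply/funext => y /=; exact: psi0.
Qed.

Lemma dt0 x t : ~~ (t1 <= t <= t2) -> dt psi x t = 0.
Proof.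
move=> tI; rewrite /dt derive1E.
have D : is_derive t 1 (psi x) 0.
  have N : \forall s \near t, (cst 0 : R -> R) s = psi x s.
    move: tI; rewrite negb_and -!ltNge => /orP[] tt.
      have d0 : 0 < t1 - t by rewrite subr_gt0.
      apply/nbhs_ballP; exists (t1 - t) => //= s; rewrite /ball /= ltr_norml => /andP[h1 h2].
      by rewrite psi0// negb_and -ltNge; apply/orP; left; lra.
    have d0 : 0 < t - t2 by rewrite subr_gt0.
    apply/nbhs_ballP; exists (t - t2) => //= s; rewrite /ball /= ltr_norml => /andP[h1 h2].
    by rewrite psi0// negb_and -!ltNge; apply/orP; right; lra.
  exact: (near_eq_is_derive N (is_derive_cst 0 t 1)).
by rewrite derive_val.
Qed.

Lemma psiL' t : psi (L + v * t) t = 0.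
Proof.
have [t0|t0] := ltP 0 t; first exact: psiL.
by rewrite psi0// negb_and -ltNge (le_lt_trans t0 t10).
Qed.

Definition psi_trace t := psi (v * t) t.
Definition psi_trace' t := v * dx psi (v * t) t + dt psi (v * t) t.

Lemma psi_trace_deriv (t : R) : is_derive t 1 psi_trace (psi_trace' t).
Proof.
have := chain_rule 0 v t dpsi cx ct; rewrite add0r.
rewrite (_ : (fun r => psi (0 + v * r) r) = psi_trace)//.
by apply/funext => r; rewrite add0r.
Qed.

Lemma psi_trace'_cont : continuous psi_trace'.
Proof.
move=> t; rewrite /psi_trace'.
have C (k : R -> R -> R) : cont2 k -> continuous (fun t : R => k (v * t) t).
  move=> ck; apply: eq_cont (@cont2_section R _ 0 (@cont2_aff R k v 0 0 ck)) _ => r.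
  by rewrite mul0r !addr0.
by apply: cvgD; [apply: cvgM; [exact: cvg_cst|exact: C]|exact: C].
Qed.

Lemma psi_trace0 t : ~~ (t1 <= t <= t2) -> psi_trace t = 0. Proof. exact: psi0. Qed.
Lemma psi_trace'0 t : ~~ (t1 <= t <= t2) -> psi_trace' t = 0. Proof. by move=> tI; rewrite /psi_trace' dx0// dt0// mulr0 addr0. Qed.

(** The test function along the characteristics x + t = s and
    g (t - x) + M = s; the second sign is that of the reflected wave in phi. *)
Definition lchar t s := psi (s + -1 * t) t.
Definition lchar' t s := -1 * dx psi (s + -1 * t) t + dt psi (s + -1 * t) t.
Definition rchar t s := - psi (- ((s - M) / g) + 1 * t) t.
Definition rchar' t s := - (1 * dx psi (- ((s - M) / g) + 1 * t) t + dt psi (- ((s - M) / g) + 1 * t) t).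

Lemma lchar_deriv s (t : R) : is_derive t 1 (lchar^~ s) (lchar' t s).
Proof. exact: chain_rule. Qed.
Lemma rchar_deriv s (t : R) : is_derive t 1 (rchar^~ s) (rchar' t s).
Proof. by have := is_deriveN (chain_rule (- ((s - M) / g)) 1 t dpsi cx ct). Qed.

Lemma lchar'_cont : cont2 lchar'.
Proof.
have C (k : R -> R -> R) : cont2 k -> cont2 (fun t s : R => k (s + -1 * t) t).
  move=> ck; have := @cont2_aff R k (-1) 1 0 ck; congr cont2.
  by apply/funext => t; apply/funext => s; congr (k _ _); ring.
move=> z; apply: cvgD; first by apply: cvgM; [exact: cvg_cst|exact: (C _ cx)].
exact: (C _ ct).
Qed.

Lemma rchar'_cont : cont2 rchar'.
Proof.
have C (k : R -> R -> R) : cont2 k -> cont2 (fun t s : R => k (- ((s - M) / g) + 1 * t) t).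
  move=> ck; have := @cont2_aff R k 1 (- g^-1) (M / g) ck; congr cont2.
  by apply/funext => t; apply/funext => s; congr (k _ _); ring.
move=> z; apply: cvgN; apply: cvgD; first by apply: cvgM; [exact: cvg_cst|exact: (C _ cx)].
exact: (C _ ct).
Qed.

Let T0 := `|t2| + 1.
Let T00 : 0 < T0. Proof. by rewrite ltr_wpDl. Qed.
Let tT0 : t2 < T0. Proof. by apply: (le_lt_trans (ler_norm _)); rewrite ltrDl. Qed.

Lemma outside t : t <= 0 \/ T0 <= t -> ~~ (t1 <= t <= t2).
Proof.
rewrite negb_and -!ltNge => -[t0|tT]; first by rewrite (le_lt_trans t0 t10).
by rewrite (lt_le_trans tT0 tT) orbT.
Qed.

Lemma space_integral t :
  \int[mu]_(x in `](v * t), (L + v * t)[) (wave_t L v h x t * dt psi x t - wave_x L v h x t * dx psi x t) =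
  \int[mu]_(s in `]w * t + 0, w * t + L[) (h s * lchar' t s) +
  \int[mu]_(s in `]w * t + L, w * t + M[) (h s * rchar' t s).
Proof.
have c1 := cont2_section' (t := t) lchar'_cont; have c2 := cont2_section' (t := t) rchar'_cont.
have I1 a b : intg a b (fun s => h s * lchar' t s) by exact: intgM_cont.
have I2 a b : intg a b (fun s => h s * rchar' t s) by exact: intgM_cont.
have E1 : w * t + 0 = v * t + t by ring.
have E2 : w * t + L = L + v * t + t by ring.
have E3 : w * t + L = g * t + M - g * (L + v * t).
  have -> : g * t + M - g * (L + v * t) = M - g * L + g * (1 - v) * t by ring.
  by rewrite MgL gE; ring.
have E4 : w * t + M = g * t + M - g * (v * t).
  by rewrite -gE; ring.
have -> : \int[mu]_(s in `]w * t + 0, w * t + L[) (h s * lchar' t s) =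
  \int[mu]_(x in `](v * t), (L + v * t)[) (h (x + t) * lchar' t (x + t)).
  by rewrite E1 E2 (Int_shift (f := fun s => h s * lchar' t s)).
have -> : \int[mu]_(s in `]w * t + L, w * t + M[) (h s * rchar' t s) =
  g * \int[mu]_(x in `](v * t), (L + v * t)[) (h (g * t + M - g * x) * rchar' t (g * t + M - g * x)).
  by rewrite E3 E4 (Int_refl (f := fun s => h s * rchar' t s)).
have J1 : intg (v * t) (L + v * t) (fun x => h (x + t) * lchar' t (x + t)) by exact: (intg_shift (I1 _ _)).
have J2 : intg (v * t) (L + v * t) (fun x => h (g * t + M - g * x) * rchar' t (g * t + M - g * x)) by exact: (intg_refl g0 (I2 _ _)).
rewrite -IntZ// -IntD//; last exact: intgZ.
apply: eq_Int => x _; rewrite /wave_t /wave_x /lchar' /rchar'.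
have -> : x + t + -1 * t = x by ring.
have -> : - ((g * t + M - g * x - M) / g) + 1 * t = x by field; exact: lt0r_neq0.
have -> : g * (t - x) + M = g * t + M - g * x by ring.
by rewrite [x + t]addrC; ring.
Qed.

(** Both families of characteristics meet x = L + v t, where psi vanishes; on
    x = v t each of them leaves a trace of psi. *)
Lemma interior_term :
  \int[mu]_(t in `]0, +oo[) (\int[mu]_(x in `](v * t), (L + v * t)[)
    (wave_t L v h x t * dt psi x t - wave_x L v h x t * dx psi x t)) =
  \int[mu]_(s in `]0, w * T0[) ((h s + h (s + M)) * psi_trace (s / w)).
Proof.
(* beyond S the strips are only met after the time T0, when psi has vanished *)
pose S := w * T0 + M.
have S1 : w * t2 + L <= S by rewrite /S lerD// ler_pM2l// ltW.
have S2 : w * t2 + M <= S by rewrite /S lerD2r ler_pM2l// ltW.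
have m10 t s : ~~ (t1 <= t <= t2) -> lchar t s = 0 by exact: psi0.
have m20 t s : ~~ (t1 <= t <= t2) -> rchar t s = 0 by move=> tI; rewrite /rchar psi0// oppr0.
have k10 t s : ~~ (t1 <= t <= t2) -> lchar' t s = 0 by move=> tI; rewrite /lchar' dx0// dt0// mulr0 addr0.
have k20 t s : ~~ (t1 <= t <= t2) -> rchar' t s = 0 by move=> tI; rewrite /rchar' dx0// dt0// mulr0 addr0 oppr0.
transitivity (\int[mu]_(t in `]0, +oo[) (\int[mu]_(s in `]w * t + 0, w * t + L[) (h s * lchar' t s) +
    \int[mu]_(s in `]w * t + L, w * t + M[) (h s * rchar' t s))).
  by congr Rintegral; apply/funext => t; rewrite space_integral.
rewrite (characteristic_Fubini w0 (lexx 0) (ltW L0) (ltW L0) LM t10 S1 S2 hI lchar'_cont rchar'_cont lchar_deriv rchar_deriv m10 m20 k10 k20).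
have E s : lchar ((s - 0) / w) s - lchar ((s - L) / w) s + (rchar ((s - L) / w) s - rchar ((s - M) / w) s) =
   psi_trace (s / w) + psi_trace ((s - M) / w).
  rewrite /lchar /rchar subr0.
  have wn : w != 0 by rewrite gt_eqF.
  have gn : g != 0 by rewrite gt_eqF.
  have vn : 1 - v != 0 by rewrite nz_v.
  have -> : s + -1 * (s / w) = v * (s / w) by field.
  have -> : s + -1 * ((s - L) / w) = L + v * ((s - L) / w) by field.
  have -> : - ((s - M) / g) + 1 * ((s - L) / w) = L + v * ((s - L) / w).
    have -> : M = L + g * L by apply/eqP; rewrite -subr_eq; apply/eqP; exact: MgL.
    by rewrite /gamma_v; field; rewrite wn vn.
  have -> : - ((s - M) / g) + 1 * ((s - M) / w) = v * ((s - M) / w).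
    by rewrite /gamma_v; field; rewrite wn vn.
  by rewrite !psiL' /psi_trace; ring.
have cb : continuous psi_trace by exact: (is_derive_cont psi_trace_deriv).
have cb1 : continuous (fun s : R => psi_trace (s / w)).
  by apply: eq_cont (affine_cont (c := w^-1) (d := 0) cb) _ => s; rewrite addr0 mulrC.
have cb2 : continuous (fun s : R => psi_trace ((s - M) / w)).
  by apply: eq_cont (affine_cont (c := w^-1) (d := - M / w) cb) _ => s; congr psi_trace; ring.
have I1 a b : intg a b (fun s => h s * psi_trace (s / w)) by exact: intgM_cont.
have I2 a b : intg a b (fun s => h s * psi_trace ((s - M) / w)) by exact: intgM_cont.
have I3 a b : intg a b (fun s => h (s + M) * psi_trace (s / w)) by apply: intgM_cont => //; exact: intg_shift.
have wT : 0 <= w * T0 by rewrite mulr_ge0 ?ltW.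
rewrite (eq_Int (g := fun s => h s * psi_trace (s / w) + h s * psi_trace ((s - M) / w))); last first.
  by move=> s _; rewrite E mulrDr.
rewrite IntD// (eq_Int (f := fun s => (h s + _) * _) (g := fun s => h s * psi_trace (s / w) + h (s + M) * psi_trace (s / w))); last first.
  by move=> s _; rewrite mulrDl.
rewrite IntD//; congr (_ + _).
  have TS : w * T0 <= S by rewrite /S lerDl ltW.
  rewrite (Int_cat wT TS)// (@eq_Int _ (w * T0) _ _ (fun=> 0)) ?Int0 ?addr0//.
  move=> s /andP[s1 _]; rewrite psi_trace0 ?mulr0//; apply: outside; right.
  by rewrite ler_pdivlMr// mulrC ltW.
have MS : M <= S by rewrite /S lerDr.
rewrite (Int_cat (ltW M0) MS)// (@eq_Int _ 0 M _ (fun=> 0)) ?Int0 ?add0r; last first.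
  move=> s /andP[_ s1]; rewrite psi_trace0 ?mulr0//; apply: outside; left.
  by rewrite pmulr_lle0 ?invr_gt0// subr_le0 ltW.
rewrite -[X in `]X, S[]add0r /S Int_shift ?add0r//.
by apply: eq_Int => s _; rewrite addrK.
Qed.

(** Integration by parts in the variable s = (1 + v) t. *)
Lemma boundary_term :
  \int[mu]_(t in `]0, +oo[) (wave L v h (v * t) t * (dt psi (v * t) t + v * dx psi (v * t) t)) =
  - \int[mu]_(s in `]0, w * T0[) ((h s - h (s + M)) * psi_trace (s / w)).
Proof.
have wn : w != 0 by rewrite gt_eqF.
have wT : 0 <= w * T0 by rewrite mulr_ge0 ?ltW.
pose H s := h s - h (s + M).
have IH a b : intg a b H by apply: intgB => //; exact: intg_shift.
pose k s := psi_trace (s / w); pose k' s := w^-1 * psi_trace' (s / w).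
have dk (s : R) : is_derive s 1 k (k' s).
  have D : is_derive s 1 (fun s => s / w) (w^-1).
    apply: (derive_cast (is_deriveM (is_derive_id s 1) (is_derive_cst (w^-1) s 1))).
    by rewrite /GRing.scale /= mulr0 add0r mulr1.
  by have := is_derive1_comp (f := psi_trace) (g := fun s => s / w) (psi_trace_deriv _) D; rewrite mulrC.
have ck' : continuous k'.
  have := affine_cont (c := w^-1) (d := 0) psi_trace'_cont => C s.
  apply: cvgM; first exact: cvg_cst.
  by have := C s; rewrite (_ : (fun x => psi_trace' (w^-1 * x + 0)) = (fun x => psi_trace' (x / w)))//; apply/funext => x; rewrite addr0 mulrC.
have kT : k (w * T0) = 0 by rewrite /k psi_trace0//; apply: outside; right; rewrite mulrC mulKf.
have k00 : k 0 = 0 by rewrite /k psi_trace0//; apply: outside; left; rewrite mul0r.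
have FE s : 0 <= s -> F s - F (s + M) = (F 0 - F M) + \int[mu]_(r in `]0, s[) H r.
  move=> s0; rewrite IntB//; last exact: intg_shift.
  by rewrite -Int_shift// -!primB ?lerD2r// add0r; ring.
have cI : continuous (fun s => F s - F (s + M)).
  have cF := prim_cont hI.
  have cFM : continuous (fun s : R => F (s + M)) by exact: shift_cont.
  by move=> s; apply: cvgB; [exact: cF|exact: cFM].
rewrite (@Int_support _ 0 T0)//; last first.
  move=> t; rewrite negb_and -!leNgt => /orP tI.
  by have := psi_trace'0 (outside tI); rewrite /psi_trace' addrC => ->; rewrite mulr0.
transitivity (\int[mu]_(s in `]0, w * T0[) ((F s - F (s + M)) * k' s)).
  have I : intg 0 (w * T0) (fun s => (F s - F (s + M)) * k' s).
    by apply: intgM_cont => //; exact: intg_cont.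
  rewrite (Int_scale w0 I) -IntZ; last exact: (intg_scale w0 I).
  apply: eq_Int => t _; rewrite /k' (mulrC w t) mulfK// /wave.
  have -> : t + v * t = t * w by ring.
  have -> : g * (t - v * t) + M = t * w + M by rewrite -gE; ring.
  rewrite /psi_trace'; field; exact: wn.
rewrite (eq_Int (g := fun s => (F 0 - F M) * k' s + (\int[mu]_(r in `]0, s[) H r) * k' s)); last first.
  by move=> s /andP[s0 _]; rewrite (FE _ (ltW s0)) mulrDl.
have IP : intg 0 (w * T0) (fun s => (\int[mu]_(r in `]0, s[) H r) * k' s).
  apply: intgM_cont => //.
  apply: (@eq_intg _ _ _ (fun s => (F s - F (s + M)) - (F 0 - F M))).
    by move=> s /andP[s0 _]; rewrite FE ?(ltW s0)//; ring.
  by apply: intg_cont => s; apply: cvgB; [exact: cI|exact: cvg_cst].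
rewrite IntD//; last by apply: intgZ; exact: intg_cont.
rewrite IntZ; last exact: intg_cont.
rewrite (Int_FTC wT dk ck') (Int_by_parts wT (IH _ _) dk ck') kT k00.
by rewrite subrr !mulr0 add0r sub0r.
Qed.

(** The interior contributes h(s) + h(s + M), the boundary
    - eta (h(s) - h(s + M)), and the relation between h(s) and h(s + M) makes the
    sum vanish. *)
Lemma weak_balance :
  \int[mu]_(t in `]0, +oo[) (\int[mu]_(x in `](v * t), (L + v * t)[)
    (wave_t L v h x t * dt psi x t - wave_x L v h x t * dx psi x t)) +
  eta * \int[mu]_(t in `]0, +oo[) (wave L v h (v * t) t * (dt psi (v * t) t + v * dx psi (v * t) t)) = 0.
Proof.
rewrite interior_term boundary_term mulrN.
have cb : continuous psi_trace by exact: (is_derive_cont psi_trace_deriv).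
have cb1 : continuous (fun s : R => psi_trace (s / w)).
  by apply: eq_cont (affine_cont (c := w^-1) (d := 0) cb) _ => s; rewrite addr0 mulrC.
have Ip a b : intg a b (fun s => h (s + M)) by exact: intg_shift.
rewrite -IntZ; last by apply: intgM_cont => //; exact: intgB.
rewrite -IntB; [|by apply: intgM_cont => //; exact: intgD|by apply: intgZ; apply: intgM_cont => //; exact: intgB].
rewrite (eq_Int (g := fun=> 0)) ?Int0// => s /andP[s0 _].
transitivity (((1 - eta) * h s + (1 + eta) * h (s + M)) * psi_trace (s / w)); first by ring.
by rewrite hq ?mul0r// ltW.
Qed.

End WeakForm.

(** * Existence and expansion *)

Section Existence.
Variable R : realType.
Local Notation mu := (@lebesgue_measure R).
Variables (L v eta : R).
Hypotheses (L0 : 0 < L) (v0 : 0 <= v) (v1 : v < 1) (e0 : 0 <= eta) (e1 : eta != 1).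
Variables (phi0 phi0x phi1 : R -> R).
Hypotheses (phi0_H1 : H1r 0 L phi0 phi0x) (phi1_L2 : L2 0 L phi1).
Local Notation M := (L_2 L v).

(** The factor per period is the one that the damped end imposes. *)
Definition profile : R -> R :=
  quasi M (- (gamma_eta eta)^-1) (fun z => 2^-1 * unfold L v phi0x phi1 z).

Lemma profile_L2 a b : L2 a b profile.
Proof.
have [[_ _ Lx _] _] := phi0_H1.
by apply: quasi_L2; [exact: L_2_gt0|apply: L2Z; exact: unfold_L2].
Qed.

Lemma profile_reflect s : 0 <= s -> (1 - eta) * profile s + (1 + eta) * profile (s + M) = 0.
Proof.
move=> s0; rewrite /profile quasi_period ?L_2_gt0//; set h := quasi _ _ _ s.
have e1n : 1 - eta != 0 by rewrite subr_eq0 eq_sym.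
have e1p : 1 + eta != 0 by rewrite gt_eqF// ltr_wpDr.
by rewrite /gamma_eta; field; rewrite e1n e1p.
Qed.

Lemma existence : is_solution L v eta phi0 phi1
  (wave L v profile) (wave_x L v profile) (wave_t L v profile).
Proof.
have init := wave_initial L0 v0 v1 profile_L2 phi0_H1 phi1_L2 (fun z zM => quasi_base _ _ (L_2_gt0 L0 v1) zM).
split.
- by move=> T _; apply: wave_regular => //; exact: profile_L2.
- move=> psi [dpsi cx ct [t1 [t2 [t10 psi0]]] psiL].
  exact: (weak_balance L0 v0 v1 profile_L2 profile_reflect dpsi cx ct t10 psi0 psiL).
- by move=> x /init[].
- by apply: aeW => x /init[].
Qed.

End Existence.

Theorem theorem1 (R : realType) (L v eta : R) (phi0 phi0x phi1 : R -> R)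
    (L_gt0 : 0 < L) (v_ge0 : 0 <= v) (v_lt1 : v < 1)
    (eta_ge0 : 0 <= eta) (eta_neq1 : eta != 1)
    (phi0_H1 : H1r 0 L phi0 phi0x) (phi1_L2 : L2 0 L phi1) :
  (exists phi phix phit : R -> R -> R,
     is_solution L v eta phi0 phi1 phi phix phit) /\
  (forall phi phix phit : R -> R -> R,
     is_solution L v eta phi0 phi1 phi phix phit ->
     (forall x t : R, 0 <= t -> v * t < x < L + v * t ->
        sumZ_to (fun n => coef L v eta phi0x phi1 n * mode L v eta n x t)
                (phi x t)%:C) /\
     (forall t : R, 0 <= t ->
        let E := (\int[@lebesgue_measure R]_(x in `](v * t)%R, (L_2 L v + v * t)%R[)
            (expR ((1 - v) / L * ln `|gamma_eta eta| * (t + x)) *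
             (ext_x L v t (phix^~ t) x + ext_t L v t (phit^~ t) x) ^+ 2)%:E)%E in
        (\esum_(n in [set: int])
            (sqnormC (omega eta n * coef L v eta phi0x phi1 n))%:E
         = (L / (8 * (1 - v) * gamma_eta eta ^+ 2))%:E * E)%E
        /\ (E < +oo)%E)).
Proof.
split.
  exists (wave L v (profile L v eta phi0x phi1)), (wave_x L v (profile L v eta phi0x phi1)),
    (wave_t L v (profile L v eta phi0x phi1)).
  exact: existence.
move=> phi phix phit sol; split.
  by move=> x t t0 xI; exact: (pointwise_series L_gt0 v_ge0 v_lt1 eta_ge0 eta_neq1 phi0_H1 phi1_L2 sol t0 xI).
by move=> t t0; exact: (energy L_gt0 v_ge0 v_lt1 eta_ge0 eta_neq1 phi0_H1 phi1_L2 sol t0).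
Qed.
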